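(* Let $0\le l\le k$ be integers. The mapping $\iota$ restricts to a bijection from $C^{(k,l)}_{\rm pos}$ onto $R^{(l)}_{\rm pos}$, and the mapping $\kappa$ restricts to a bijection from $R^{(l)}_{\rm pos}$ onto $C^{(k,l)}_{\rm pos}$ (these two bijections being inverse to each other).
   Context: **Configurations.** Fix an integer $k\ge 0$. A configuration is a sequence $\mathbf a=(a_i)_{i\in\mathbb Z}$ of non-negative integers; it is finite if $a_i=0$ for all but finitely many $i$. $C^{(k)}$ is the set of finite configurations with $a_i+a_{i+1}+a_{i+2}\le k$ for all $i$. Put $S[i,\mathbf a]=a_i+a_{i+1}$ and $L[i,\mathbf a]=a_{i-1}+2a_i+2a_{i+1}+a_{i+2}$. For $0\le l\le k$, $C^{(k,l)}$ is the set of $\mathbf a\in C^{(k)}$ with $S[i,\mathbf a]\le l$ and $L[i,\mathbf a]\le k+l$ for all $i$. So $C^{(k,0)}=\{\mathbf 0\}$ and $C^{(k,k)}=C^{(k)}$. $C^{(k,l)}_{\rm pos}$ is the set of $\mathbf a\in C^{(k,l)}$ with $a_i=0$ for all $i<0$. For $1\le l\le k$, $\underline C^{(k,l)}=C^{(k,l)}\setminus C^{(k,l-1)}$, i.e. the $\mathbf a\in C^{(k,l)}$ with $S[i,\mathbf a]=l$ or $L[i,\mathbf a]=k+l$ for some $i$. Put $A_{l,l'}=2\min(l,l')+\max(l+l'-k,0)$. **Rigged partitions.** A rigged partition is a pair $(\lambda,\rho)$ with $\lambda=(\lambda_1\ge\dots\ge\lambda_n\ge1)$ a partition ($n\ge0$)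 and $\rho=(\rho_1,\dots,\rho_n)\in\mathbb Z^n$ such that $\rho_i\ge\rho_{i+1}$ whenever $\lambda_i=\lambda_{i+1}$; $\emptyset$ denotes the one with $n=0$. $R^{(l)}$ is the set of rigged partitions with $\lambda_1\le l$ (so $R^{(0)}=\{\emptyset\}$), and $R^{(l)}_{\rm pos}$ is the subset where all $\rho_i\ge0$. **Right move and $\iota$.** For $\mathbf a\in\underline C^{(k,l)}$, $l\ge1$, let $i_1$ be the largest integer $i$ with $S[i,\mathbf a]=l$ or $L[i,\mathbf a]=k+l$; $M_+\mathbf a\in \underline C^{(k,l)}$ is obtained from $\mathbf a$ by replacing $(a_{i_1},a_{i_1+1})$ by $(a_{i_1}-1,a_{i_1+1}+1)$. $\mathbf a\in\underline C^{(k,l)}$ contains a free particle of weight $l$ at the highest position $i$ if $a_i+a_{i+1}=l$, $a_i\ne0$ and $a_j=0$ for all $j\ge i+2$. The map $\iota:C^{(k,l)}\to R^{(l)}$ is defined inductively on $\sum_i a_i$: $\iota(\mathbf 0)=\emptyset$. For $\mathbf a\neq\mathbf 0$ let $l_0\ge1$ be the integer with $\mathbf a\in\underline C^{(k,l_0)}$. For all sufficiently large $t$, $M_+^t\mathbf a$ contains a free particle of weight $l_0$ at the highest position $i$ for some $i$; with $c=(M_+^t\mathbf a)_i$ put $d=ic+(i+1)(l_0-c)$ and $s=d-t$, and let $\overline{\mathbf a}$ be obtained from $M_+^t\mathbf a$ by setting the entries at columns $i,i+1$ to $0$ ($s$ and $\overline{\mathbf a}$ do not depend on $t$). If $\iota(\overline{\mathbf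 a})=(\overline\lambda,\overline\rho)$, then $\iota(\mathbf a)=(\lambda,\rho)$ with $\lambda=(l_0,\overline\lambda)$, $\rho=(\rho_1,\overline\rho)$, $\rho_1=s-\sum_j A_{l_0,\overline\lambda_j}$. **Left moves and $\kappa$.** For $\mathbf a\in C^{(k,l)}$, $l\ge1$, define positions $j_1<j_2<\dots$ as follows: if $\mathbf a\in\underline C^{(k,l)}$, $j_1$ is the smallest integer $j$ with $S[j,\mathbf a]=l$ or $L[j,\mathbf a]=k+l$. Replace all entries of $\mathbf a$ at columns $\le j_1+1$ by $0$; if the result is still in $\underline C^{(k,l)}$, $j_2$ is its smallest such integer; and so on. $C^{(k,l)}_m$ denotes the set of $\mathbf a\in C^{(k,l)}$ for which exactly $m$ positions arise. $M_-^{(c)}$ replaces $(a_{j_c},a_{j_c+1})$ by $(a_{j_c}+1,a_{j_c+1}-1)$; the composite $M_-^{(m)}\cdots M_-^{(1)}$ is well defined on $C^{(k,l)}_m$. The map $\kappa:R^{(l)}\to C^{(k,l)}$ is defined inductively on $l$ from $\kappa(\emptyset)=\mathbf 0$. Given $(\lambda,\rho)\in R^{(l)}$ with exactly $m\geq 1$ parts equal to $l$ (if $m=0$, it lies in $R^{(l-1)}$ and $\kappa$ is already defined), let $\overline\lambda=(\lambda_{m+1},\dots,\lambda_n)$, $\overline\rho=(\rho_{m+1},\dots,\rho_n)$, $\overline{\mathbf a}=\kappa(\overline\lambda,\overline\rho)$. For $1\le i\le m$ set $s_i=\rho_i+\sum_{j>i}A_{l,\lambda_j}$ and, for sufficiently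 large $t$, $d_i=s_i+t$. Let $j_i,c_i$ be the unique integers with $1\le c_i\le l$ and $j_ic_i+(j_i+1)(l-c_i)=d_i$, let $\mathbf a_{\rm free}$ have entries $c_i$ at column $j_i$, $l-c_i$ at column $j_i+1$ ($1\le i\le m$) and $0$ elsewhere, and put $\kappa(\lambda,\rho)=(M_-^{(m)}\cdots M_-^{(1)})^t(\overline{\mathbf a}+\mathbf a_{\rm free})$, which is independent of the large $t$. *)

(* Defs.v *)
From mathcomp Require Import all_boot all_order all_algebra.
From mathcomp Require Import finmap.
From mathcomp Require Import boolp classical_sets functions.

Set Implicit Arguments.
Unset Strict Implicit.
Unset Printing Implicit Defensive.

Import Order.TTheory GRing.Theory Num.Theory.
Local Open Scope classical_set_scope.
Local Open Scope ring_scope.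

(* Uniquely characterised objects ("the largest i such that", "the value for
   all sufficiently large t") are selected with [xget x0 P], which returns an
   element of P when P is nonempty; the default x0 is irrelevant otherwise. *)

Definition config := {fsfun int -> nat with 0%N}.

Definition config0 : config := [fsfun].

Definition addc (a b : config) : config :=
  [fsfun i in (finsupp a `|` finsupp b)%fset => (a i + b i)%N].

Definition mass (a : config) : nat := (\sum_(i <- finsupp a) a i)%N.

Definition Sfun (i : int) (a : config) : nat := (a i + a (i + 1)%R)%N.

Definition Lfun (i : int) (a : config) : nat :=
  (a (i - 1)%R + 2 * a i + 2 * a (i + 1)%R + a (i + 2)%R)%N.

Definition Ck (k : nat) : set config :=
  [set a | forall i : int, (a i + a (i + 1)%R + a (i + 2)%R <= k)%N].

Definition C (k l : nat) : set config :=
  [set a | Ck k a /\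
    forall i : int, (Sfun i a <= l)%N /\ (Lfun i a <= k + l)%N].

Definition Cpos (k l : nat) : set config :=
  [set a | C k l a /\ forall i : int, i < 0 -> a i = 0%N].

(* Only meaningful for 1 <= l; for l = 0 it is the empty set. *)
Definition Cunder (k l : nat) : set config := C k l `\` C k l.-1.

(* Truncated subtraction computes max (l + l' - k) 0. *)
Definition Acoef (k l l' : nat) : nat := (2 * minn l l' + (l + l' - k))%N.

(* The rigged partition (lambda, rho) is encoded as the list of its pairs
   (lambda_i, rho_i). *)
Definition rigged := seq (nat * int).

Definition is_rigged (r : rigged) : bool :=
  [&& sorted geq (unzip1 r), all (leq 1) (unzip1 r)
    & sorted (fun p q : nat * int => (p.1 == q.1) ==> (q.2 <= p.2)) r].

Definition R (l : nat) : set rigged :=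
  [set r | is_rigged r /\ (head 0%N (unzip1 r) <= l)%N].

Definition Rpos (l : nat) : set rigged :=
  [set r | R l r /\ all (fun rho : int => 0 <= rho) (unzip2 r)].

Definition Asum (k l : nat) (r : rigged) : int :=
  \sum_(p <- r) ((Acoef k l p.1)%:Z).

Definition saturated (k l : nat) (a : config) : set int :=
  [set i | Sfun i a = l \/ Lfun i a = (k + l)%N].

Definition last_pos (k l : nat) (a : config) : int :=
  xget 0 [set i | saturated k l a i /\ forall j, saturated k l a j -> j <= i].

Definition first_pos (k l : nat) (a : config) : int :=
  xget 0 [set i | saturated k l a i /\ forall j, saturated k l a j -> i <= j].

(* The unique x such that f t x holds for all sufficiently large t. *)
Definition eventual (T : choiceType) (x0 : T) (f : nat -> T -> Prop) : T :=
  xget x0 [set x | exists t0 : nat, forall t : nat, (t0 <= t)%N -> f t x].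

(** Right move and the map iota *)

Definition Mplus (k l : nat) (a : config) : config :=
  let i := last_pos k l a in
  [fsfun a with i |-> (a i).-1, (i + 1) |-> (a (i + 1)%R).+1].

Definition has_free (k l : nat) (a : config) (i : int) : Prop :=
  [/\ Cunder k l a, (a i + a (i + 1)%R)%N = l, a i <> 0%N
    & forall j : int, i + 2 <= j -> a j = 0%N].

Definition clear2 (i : int) (a : config) : config :=
  [fsfun a with i |-> 0%N, (i + 1) |-> 0%N].

Definition weight (k : nat) (a : config) : nat :=
  xget 0%N [set l | (1 <= l <= k)%N /\ Cunder k l a].

(* d = j c + (j + 1) (l - c) *)
Definition energy (l : nat) (j : int) (c : nat) : int :=
  j * c%:Z + (j + 1) * (l%:Z - c%:Z).

(* The pair (s, a-bar). *)
Definition strip (k l0 : nat) (a : config) : int * config :=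
  eventual (0, config0) (fun t x =>
    let b := iter t (Mplus k l0) a in
    exists2 i : int, has_free k l0 b i &
      x = (energy l0 i (b i) - t%:Z, clear2 i b)).

(* Removing a free particle of weight l0 >= 1 lowers the mass by l0, so
   [mass a] is enough fuel. *)
Fixpoint iota_fuel (n k : nat) (a : config) : rigged :=
  if n is n'.+1 then
    if a == config0 then [::] else
    let l0 := weight k a in
    let: (s, abar) := strip k l0 a in
    let r := iota_fuel n' k abar in
    (l0, s - Asum k l0 r) :: r
  else [::].

Definition iota_map (k : nat) (a : config) : rigged := iota_fuel (mass a) k a.

(** Left moves and the map kappa *)

Definition erase_le (j : int) (a : config) : config :=
  [fsfun i in finsupp a => if i <= j then 0%N else a i].

(* [left_rest k l c a] is what is left of a once the columns up to j_c + 1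
   have been erased. *)
Fixpoint left_rest (k l c : nat) (a : config) : config :=
  if c is c'.+1 then
    let b := left_rest k l c' a in erase_le (first_pos k l b + 1) b
  else a.

(* The position j_c, for c >= 1. *)
Definition left_pos (k l c : nat) (a : config) : int :=
  first_pos k l (left_rest k l c.-1 a).

Definition Mminus (k l c : nat) (a : config) : config :=
  let j := left_pos k l c a in
  [fsfun a with j |-> (a j).+1, (j + 1) |-> (a (j + 1)%R).-1].

(* M_-^(m) ... M_-^(1), with M_-^(1) applied first. *)
Definition Mminus_all (k l m : nat) (a : config) : config :=
  foldl (fun b c => Mminus k l c b) a (iota 1 m).

Definition free_coord (l : nat) (d : int) : int * nat :=
  xget (0, 0%N) [set jc | (1 <= jc.2 <= l)%N /\ energy l jc.1 jc.2 = d].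

Definition particle (l : nat) (d : int) : config :=
  let: (j, c) := free_coord l d in
  [fsfun config0 with j |-> c, (j + 1) |-> (l - c)%N].

(* s_(i+1) in 1-based notation: the index i is 0-based here. *)
Definition s_of (k l : nat) (r : rigged) (i : nat) : int :=
  (nth (0%N, 0) r i).2 + Asum k l (drop i.+1 r).

(* Consecutive d_i differ by at least Acoef k l l >= 2 l, so the particles have
   disjoint supports and their sum is the juxtaposition of their entries. *)
Definition a_free (k l m : nat) (r : rigged) (t : nat) : config :=
  \big[addc/config0]_(0 <= i < m) particle l (s_of k l r i + t%:Z).

Fixpoint kappa_map (k l : nat) (r : rigged) : config :=
  if l is l'.+1 then
    let m := count (pred1 l) (unzip1 r) in
    if m == 0%N then kappa_map k l' r else
    let abar := kappa_map k l' (drop m r) in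
    eventual config0 (fun t x =>
      x = iter t (Mminus_all k l m) (addc abar (a_free k l m r t)))
  else config0.

(* Main.v *)
Require Import Defs.
From mathcomp Require Import all_boot all_order all_algebra.
From mathcomp Require Import finmap.
From mathcomp Require Import boolp classical_sets functions.
From mathcomp Require Import zify.

(** Throughout, a particle of weight [l] is a pair of neighbouring columns at which
[Sfun] or [Lfun] reaches its bound, and a unit move shifts one unit of mass by one
column.

Two facts reduce the theorem to a question of signs.  First, [iota_map] is
injective and takes values in rigged partitions.  Right moves push the last
particle of weight [l] until it has left the rest of the configuration behind
([eventually_free]); after that its energy grows by 1 at each move while the rest is
unchanged ([free_step]), so that [strip] is well defined, and it is injective
because [Mplus] is ([Mplus_inj]).  The riggings of equal parts are weakly decreasing
because the last two particles can be made free together, and two free particles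
standing next to each other have energies that differ by at least [Acoef k l l]
([strip_order]).

Second, [kappa_map] is a section of [iota_map] ([kappa_spec]).  The collective left
move lowers by 1 every rigging of a part equal to [l] and changes nothing else
([iota_Mminus_all]): it commutes with right moves as long as each particle stays
clear of its neighbours.  Free particles laid out far to the right have the expected
riggings ([juxtapose_spec]), and the left moves bring these riggings back to the
prescribed values.  The independence of the number of moves is then a consequence of
the injectivity of [iota_map].

It remains to see that a configuration lives in the columns [>= 0] if and only if
its riggings are [>= 0].  Both directions come from one computation
([strip_leftmost]): a particle that sits as [l] in column 0, with nothing to its
left, has rigging exactly 0.  Such a particle is the last stage before the left
moves enter the negative columns, and a left move lowers its rigging by 1.

For this computation, let a particle of weight [l] cross a background [x] whose
particles are lighter.  The mass it can carry across an edge [e] is [l] minus a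
deficit [h e], where [h] solves a recursion running from the right to the left
([hole]).  The total delay of the particle is the mass of [h].  That mass does not
change when the last particle of the background moves to the right ([hole_rmv],
a finite local computation), and a far column of mass [c] contributes
[Acoef k l c] to it ([hole_add_column]).  Moving away the particles of the background
one after another, the mass of [h] is therefore [Asum k l (iota_map k x)]
([mass_hole]), which is the correction in the definition of the rigging. *)

Set Implicit Arguments.
Unset Strict Implicit.
Unset Printing Implicit Defensive.

Import Order.TTheory GRing.Theory Num.Theory.
Local Open Scope ring_scope.

(** * Unit moves and saturated columns *)

(** Linear arithmetic treats [a (i + 2 - 1)] and [a (i + 1)] as unrelated atoms; bringing
every argument of a configuration to the form [i + literal] lets the local
inequalities below be decided by [lia]. *)
Ltac norm_arg i e :=
  let f := eval pattern i in e in
  lazymatch f with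
  | ?g _ =>
    let v := eval vm_compute in (g (Posz 0)) in
    let r := lazymatch v with Posz 0 => constr:(i) | _ => constr:(i + v) end in
    tryif constr_eq e r then fail else
    (let H := fresh in assert (H : e = r) by lia; rewrite H; clear H)
  end.
Ltac idx i := repeat match goal with |- context [fun_of_fsfun ?a ?e] => norm_arg i e end.

Definition rmv (i : int) (a : config) : config :=
  [fsfun a with i |-> (a i).-1, (i + 1) |-> (a (i + 1)%R).+1].
Definition lmv (j : int) (a : config) : config :=
  [fsfun a with j |-> (a j).+1, (j + 1) |-> (a (j + 1)%R).-1].
Definition Tri (i : int) (a : config) : nat := (a i + a (i+1)%R + a (i+2)%R)%N.

Lemma rmvE (i : int) (a : config) (j : int) : rmv i a j =
  if j == i then (a i).-1 else if j == i + 1 then (a (i+1)%R).+1 else a j.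
Proof. rewrite /rmv fsfun_withE /=. by case: ifP => // _; rewrite fsfun_withE. Qed.

Lemma lmvE (i : int) (a : config) (j : int) : lmv i a j =
  if j == i then (a i).+1 else if j == i + 1 then (a (i+1)%R).-1 else a j.
Proof. rewrite /lmv fsfun_withE /=. by case: ifP => // _; rewrite fsfun_withE. Qed.

Lemma rmvD (i : int) (a : config) (j : int) : (0 < a i)%N ->
    (rmv i a j + (j == i) = a j + (j == (i + 1)%R))%N.
Proof. move=> h; rewrite rmvE; case: eqP => [->|h1]; first by lia. case: eqP => [->|h2]; lia. Qed.

Lemma lmvD (i : int) (a : config) (j : int) : (0 < a (i+1)%R)%N ->
    (lmv i a j + (j == (i+1)%R) = a j + (j == i))%N.
Proof. move=> h; rewrite lmvE; case: eqP => [->|h1]; first by lia. case: eqP => [->|h2]; lia. Qed.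

Lemma Sfun_rmv (i : int) (a : config) (j : int) : (0 < a i)%N ->
  (Sfun j (rmv i a) + (j == i - 1)%R = Sfun j a + (j == i + 1)%R)%N.
Proof.
move=> h; rewrite /Sfun; have := rmvD j h; have := rmvD (j+1) h; lia.
Qed.

Lemma Lfun_rmv (i : int) (a : config) (j : int) : (0 < a i)%N ->
  (Lfun j (rmv i a) + (j == i - 1)%R + (j == i - 2)%R = Lfun j a + (j == i + 1)%R + (j == i+2)%R)%N.
Proof.
move=> h; rewrite /Lfun; have := rmvD j h; have := rmvD (j+1) h; have := rmvD (j-1) h;
  have := rmvD (j+2) h; lia.
Qed.

Lemma Tri_rmv (i : int) (a : config) (j : int) : (0 < a i)%N ->
  (Tri j (rmv i a) + (j == i - 2)%R = Tri j a + (j == i + 1)%R)%N.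
Proof.
move=> h; rewrite /Tri; have := rmvD j h; have := rmvD (j+1) h; have := rmvD (j+2) h; lia.
Qed.

Lemma Sfun_lmv (i : int) (a : config) (j : int) : (0 < a (i+1)%R)%N ->
  (Sfun j (lmv i a) + (j == i + 1)%R = Sfun j a + (j == i - 1)%R)%N.
Proof.
move=> h; rewrite /Sfun; have := lmvD j h; have := lmvD (j+1) h; lia.
Qed.

Lemma Lfun_lmv (i : int) (a : config) (j : int) : (0 < a (i+1)%R)%N ->
  (Lfun j (lmv i a) + (j == i + 1)%R + (j == i+2)%R= Lfun j a + (j == i - 1)%R + (j == i - 2)%R )%N.
Proof.
move=> h; rewrite /Lfun; have := lmvD j h; have := lmvD (j+1) h; have := lmvD (j-1) h;
  have := lmvD (j+2) h; lia.
Qed.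

Lemma Tri_lmv (i : int) (a : config) (j : int) : (0 < a (i+1)%R)%N ->
  (Tri j (lmv i a) + (j == i + 1)%R = Tri j a + (j == i - 2)%R)%N.
Proof.
move=> h; rewrite /Tri; have := lmvD j h; have := lmvD (j+1) h; have := lmvD (j+2) h; lia.
Qed.

Definition sat (k l : nat) (a : config) (i : int) : Prop := Sfun i a = l \/ Lfun i a = (k + l)%N.
Definition is_last k l a (i : int) := sat k l a i /\ forall j : int, i < j -> ~ sat k l a j.
Definition is_first k l a (i : int) := sat k l a i /\ forall j : int, j < i -> ~ sat k l a j.

Section Local.
Variables (k l : nat) (a : config).

Lemma C_intro : (forall i : int, Tri i a <= k)%N -> (forall i : int, Sfun i a <= l)%N ->
    (forall i : int, Lfun i a <= k + l)%N -> C k l a.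
Proof. by move=> h1 h2 h3; split; [exact: h1|move=> i; split]. Qed.

Hypothesis Ca : C k l a.

Lemma C_Tri (i : int) : (Tri i a <= k)%N. Proof. exact: Ca.1. Qed.

Lemma C_Sfun (i : int) : (Sfun i a <= l)%N. Proof. by case: (Ca.2 i). Qed.

Lemma C_Lfun (i : int) : (Lfun i a <= k + l)%N. Proof. by case: (Ca.2 i). Qed.

Lemma unsatS (i : int) : ~ sat k l a i -> (Sfun i a < l)%N.
Proof. by move=> h; rewrite ltn_neqAle C_Sfun andbT; apply/eqP => e; apply: h; left. Qed.

Lemma unsatL (i : int) : ~ sat k l a i -> (Lfun i a < k + l)%N.
Proof. by move=> h; rewrite ltn_neqAle C_Lfun andbT; apply/eqP => e; apply: h; right. Qed.

Lemma unsat_intro (i : int) : (Sfun i a < l)%N -> (Lfun i a < k + l)%N -> ~ sat k l a i.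
Proof. by move=> h1 h2 [h|h]; lia. Qed.

(** Otherwise [a i = 0], and saturation at [i], with the bound on the triple sum at [i - 1],
would give [Sfun (i + 1) a >= l]. *)
Lemma sat_entryl (i : int) : sat k l a i -> (Sfun (i+1) a < l)%N -> (0 < a i)%N.
Proof.
rewrite /sat; move: (C_Tri (i-1)) (C_Lfun i); rewrite /Tri /Lfun /Sfun; idx i; lia.
Qed.

Lemma sat_entryr (i : int) : sat k l a i -> (Sfun (i-1) a < l)%N -> (0 < a (i+1)%R)%N.
Proof.
rewrite /sat; move: (C_Tri i) (C_Lfun i); rewrite /Tri /Lfun /Sfun; idx i; lia.
Qed.

Lemma sat_Trir (i : int) : sat k l a i -> (Sfun (i+1) a < l)%N -> (Sfun (i+2) a < l)%N ->
    (Lfun (i+1) a < k + l)%N ->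
  (Tri (i+1) a < k)%N.
Proof.
rewrite /sat; move: (C_Tri (i-1)) (C_Tri i) (C_Tri (i+1)); rewrite /Tri /Lfun /Sfun; idx i; lia.
Qed.

Lemma sat_Tril (i : int) : sat k l a i -> (Sfun (i-1) a < l)%N -> (Sfun (i-2) a < l)%N ->
    (Lfun (i-1) a < k + l)%N ->
  (Tri (i-2) a < k)%N.
Proof.
rewrite /sat; move: (C_Tri (i-2)) (C_Tri (i-1)) (C_Tri i); rewrite /Tri /Lfun /Sfun; idx i; lia.
Qed.

(** The difference [Lfun p a - Lfun (p + 1) a] is [Sfun (p - 1) a - Sfun (p + 2) a], and it is
nonnegative when [Lfun p a] is maximal.  This keeps two neighbouring particles from
hindering each other: a particle saturated through [Lfun] is followed at distance 2 by
one saturated through [Sfun] only if it is itself preceded by a saturated column. *)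
Lemma satL_next (p : int) : Lfun p a = (k + l)%N -> Sfun (p+2) a = l -> (l <= Sfun (p-1) a)%N.
Proof.
move: (C_Lfun (p+1)); rewrite /Lfun /Sfun; idx p; lia.
Qed.

Lemma satL_prev (p : int) : Lfun p a = (k + l)%N -> Sfun (p-2) a = l -> (l <= Sfun (p+1) a)%N.
Proof.
move: (C_Lfun (p-1)); rewrite /Lfun /Sfun; idx p; lia.
Qed.

Lemma satL_prev0 (i : int) : a (i - 1)%R = 0%N -> Lfun i a = (k + l)%N -> Sfun i a = l.
Proof. by move: (C_Tri i) (C_Sfun i); rewrite /Tri /Lfun /Sfun; idx i; lia. Qed.

Lemma satL_next0 (i : int) : a (i + 2)%R = 0%N -> Lfun i a = (k + l)%N -> Sfun i a = l.
Proof. by move: (C_Tri (i-1)) (C_Sfun i); rewrite /Tri /Lfun /Sfun; idx i; lia. Qed.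

End Local.

(** A unit move raises the sums [Tri], [Sfun] and [Lfun] at no other columns than those
listed here. *)
Lemma rmvC k l a (i : int) : C k l a -> (0 < a i)%N -> (Sfun (i+1) a < l)%N ->
    (Lfun (i+1) a < k+l)%N -> (Lfun (i+2) a < k+l)%N -> (Tri (i+1) a < k)%N ->
  C k l (rmv i a).
Proof.
move=> Ca h hS hL1 hL2 hT; apply: C_intro => j.
- have := Tri_rmv j h; have := C_Tri Ca j; case: (eqVneq j (i+1)) => [e|_]; last by lia.
  by move: hT; rewrite -e; lia.
- have := Sfun_rmv j h; have := C_Sfun Ca j; case: (eqVneq j (i+1)) => [e|_]; last by lia.
  by move: hS; rewrite -e; lia.
- have := Lfun_rmv j h; have := C_Lfun Ca j; case: (eqVneq j (i+1)) => [e|_]; first by (move: hL1;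
    rewrite -e; lia).
  case: (eqVneq j (i+2)) => [e|_]; first by (move: hL2; rewrite -e; lia).
  lia.
Qed.

Lemma lmvC k l a (i : int) : C k l a -> (0 < a (i+1)%R)%N -> (Sfun (i-1) a < l)%N ->
    (Lfun (i-1) a < k+l)%N -> (Lfun (i-2) a < k+l)%N -> (Tri (i-2) a < k)%N ->
  C k l (lmv i a).
Proof.
move=> Ca h hS hL1 hL2 hT; apply: C_intro => j.
- have := Tri_lmv j h; have := C_Tri Ca j; case: (eqVneq j (i-2)) => [e|_]; last by lia.
  by move: hT; rewrite -e; lia.
- have := Sfun_lmv j h; have := C_Sfun Ca j; case: (eqVneq j (i-1)) => [e|_]; last by lia.
  by move: hS; rewrite -e; lia.
- have := Lfun_lmv j h; have := C_Lfun Ca j; case: (eqVneq j (i-1)) => [e|_]; first by (move: hL1;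
    rewrite -e; lia).
  case: (eqVneq j (i-2)) => [e|_]; first by (move: hL2; rewrite -e; lia).
  lia.
Qed.

Lemma last_entry k l a (i : int) : C k l a -> is_last k l a i -> (0 < a i)%N.
Proof. move=> Ca [si hi]; apply: (sat_entryl Ca si); apply: (unsatS Ca); apply: hi; lia. Qed.

Lemma first_entry k l a (i : int) : C k l a -> is_first k l a i -> (0 < a (i+1)%R)%N.
Proof. move=> Ca [si hi]; apply: (sat_entryr Ca si); apply: (unsatS Ca); apply: hi; lia. Qed.

Lemma rmv_last_C k l a (i : int) : C k l a -> is_last k l a i -> C k l (rmv i a).
Proof.
move=> Ca hl; have h := last_entry Ca hl; case: hl => si hi.
have h1 : ~ sat k l a (i+1) by apply: hi; lia.
have h2 : ~ sat k l a (i+2) by apply: hi; lia.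
apply: rmvC => //; try solve [exact: (unsatS Ca)|exact: (unsatL Ca)].
by apply: (sat_Trir Ca si); [exact: (unsatS Ca)|exact: (unsatS Ca)|exact: (unsatL Ca)].
Qed.

Lemma lmv_first_C k l a (i : int) : C k l a -> is_first k l a i -> C k l (lmv i a).
Proof.
move=> Ca hl; have h := first_entry Ca hl; case: hl => si hi.
have h1 : ~ sat k l a (i-1) by apply: hi; lia.
have h2 : ~ sat k l a (i-2) by apply: hi; lia.
apply: lmvC => //; try solve [exact: (unsatS Ca)|exact: (unsatL Ca)].
by apply: (sat_Tril Ca si); [exact: (unsatS Ca)|exact: (unsatS Ca)|exact: (unsatL Ca)].
Qed.

Lemma rmv_sat k l (a : config) (i : int) : (0 < a i)%N -> sat k l (rmv i a) i <-> sat k l a i.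
Proof. move=> h; rewrite /sat; move: (Sfun_rmv i h) (Lfun_rmv i h); lia. Qed.

Lemma lmv_sat k l (a : config) (i : int) : (0 < a (i+1)%R)%N -> sat k l (lmv i a) i <-> sat k l a i.
Proof. move=> h; rewrite /sat; move: (Sfun_lmv i h) (Lfun_lmv i h); lia. Qed.

Lemma lmvK (i : int) (a : config) : (0 < a (i+1)%R)%N -> rmv i (lmv i a) = a.
Proof.
move=> h; apply/fsfunP => j.
have h2 : (0 < lmv i a i)%N by rewrite lmvE eqxx.
have := lmvD j h; have := rmvD j h2; lia.
Qed.

Lemma rmvK (i : int) (a : config) : (0 < a i)%N -> lmv i (rmv i a) = a.
Proof.
move=> h; apply/fsfunP => j.
have h2 : (0 < rmv i a (i+1)%R)%N by (rewrite rmvE; case: eqP; first lia; rewrite eqxx).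
have := rmvD j h; have := lmvD j h2; lia.
Qed.

(** * Extremal saturated columns and the right move *)

Lemma supp_bound (a : config) : exists N : nat, forall j : int, a j <> 0%N -> - N%:Z <= j <= N%:Z.
Proof.
have H (s : seq int) : exists N : nat, forall j : int, j \in s -> - N%:Z <= j <= N%:Z.
  elim: s => [|x s [N hN]]; first by (exists 0%N => j; rewrite in_nil).
  exists (N + `|x|)%N => j; rewrite inE => /orP [/eqP ->|/hN]; lia.
have [N hN] := H (enum_fset (finsupp a)).
by exists N => j /eqP h; apply: hN; rewrite mem_finsupp.
Qed.

Lemma int_max_ex (P : int -> Prop) (N j0 : int) : P j0 -> (forall j : int, P j -> j <= N) ->
  exists i : int, P i /\ forall j : int, i < j -> ~ P j.
Proof.
move=> h0 hN; have [n hn] : exists n : nat, N - j0 <= n%:Z by exists `|N - j0|%N; lia.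
elim: n j0 h0 hn => [|n IH] j0 h0 hn.
  by exists j0; split=> // j hj /hN; lia.
have [[j [hj pj]]|h] := pselect (exists j : int, j0 < j /\ P j); first by apply: (IH j) => //; lia.
by exists j0; split=> // j hj pj; apply: h; exists j.
Qed.

Lemma int_min_ex (P : int -> Prop) (N j0 : int) : P j0 -> (forall j : int, P j -> N <= j) ->
  exists i : int, P i /\ forall j : int, j < i -> ~ P j.
Proof.
move=> h0 hN; have [||i [pi hi]] := @int_max_ex (fun j => P (- j)) (- N) (- j0).
- by rewrite opprK.
- by move=> j /hN; lia.
exists (- i); split=> // j hj pj; apply: (hi (- j)); first lia.
by rewrite opprK.
Qed.

Lemma sat_supp k l a (i : int) : (0 < l)%N -> sat k l a i ->
  exists j : int, a j <> 0%N /\ i - 1 <= j <= i + 2.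
Proof.
move=> l0 h; apply: contrapT => hn.
have z (j : int) : i - 1 <= j <= i + 2 -> a j = 0%N.
  by move=> hj; apply: contrapT => aj; apply: hn; exists j.
by case: h; rewrite /Sfun /Lfun !z; lia.
Qed.

Lemma sat_bound k l a : (0 < l)%N -> exists N : int, forall i : int, sat k l a i -> - N <= i <= N.
Proof.
move=> l0; have [N hN] := supp_bound a; exists (N%:Z + 2) => i /(sat_supp l0) [j [/hN]]; lia.
Qed.

Lemma last_ex k l a (i : int) : (0 < l)%N -> sat k l a i -> exists j : int, is_last k l a j.
Proof. move=> /(@sat_bound k l a) [N hN] h; apply: (int_max_ex (N := N) h) => j /hN; lia. Qed.

Lemma first_ex k l a (i : int) : (0 < l)%N -> sat k l a i -> exists j : int, is_first k l a j.
Proof. move=> /(@sat_bound k l a) [N hN] h; apply: (int_min_ex (N := - N) h) => j /hN; lia. Qed.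

Lemma last_uniq k l a (i : int) (j : int) : is_last k l a i -> is_last k l a j -> i = j.
Proof.
move=> [si hi] [sj hj]; case: (ltgtP i j) => // h; [by case: (hi j h)|by case: (hj i h)].
Qed.

Lemma first_uniq k l a (i : int) (j : int) : is_first k l a i -> is_first k l a j -> i = j.
Proof.
move=> [si hi] [sj hj]; case: (ltgtP i j) => // h; [by case: (hj i h)|by case: (hi j h)].
Qed.

Lemma last_posE k l a (i : int) : is_last k l a i -> last_pos k l a = i.
Proof.
move=> h; apply: (last_uniq (k := k) (l := l) (a := a)) => //.
rewrite /last_pos; case: xgetP => [y _ [sy hy]|/(_ i) []].
  by split=> // j hj /hy; lia.
case: h => si hi; split=> // j sj; rewrite leNgt; apply/negP => hj; exact: (hi j).
Qed.

Lemma first_posE k l a (i : int) : is_first k l a i -> first_pos k l a = i.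
Proof.
move=> h; apply: (first_uniq (k := k) (l := l) (a := a)) => //.
rewrite /first_pos; case: xgetP => [y _ [sy hy]|/(_ i) []].
  by split=> // j hj /hy; lia.
case: h => si hi; split=> // j sj; rewrite leNgt; apply/negP => hj; exact: (hi j).
Qed.

Lemma C_mono_l k l l' a : (l <= l')%N -> C k l a -> C k l' a.
Proof. move=> h Ca; apply: C_intro => i; have := C_Tri Ca i; have := C_Sfun Ca i;
  have := C_Lfun Ca i; lia. Qed.

Lemma CunderE k l a : (0 < l)%N -> Cunder k l a <-> C k l a /\ exists i : int, sat k l a i.
Proof.
move=> l0; split=> [[Ca h]|[Ca [i hi]]]; split=> //.
  apply: contrapT => hn; apply: h; apply: C_intro => i; first exact: C_Tri Ca i.
    have: ~ sat k l a i by (move=> s; apply: hn; exists i).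
    move/(unsatS Ca); lia.
  have: ~ sat k l a i by (move=> s; apply: hn; exists i).
  move/(unsatL Ca); lia.
move=> Cb; have := C_Sfun Cb i; have := C_Lfun Cb i; case: hi; lia.
Qed.

Lemma unsat_C k l a : (0 < l)%N -> C k l a -> (forall i : int, ~ sat k l a i) -> C k l.-1 a.
Proof.
move=> l0 Ca h; apply: contrapT => hn.
have /(CunderE k a l0) [_ [i /h]] // : Cunder k l a by [].
Qed.

Lemma C_unsat k l a (i : int) : (0 < l)%N -> C k l.-1 a -> ~ sat k l a i.
Proof. by move=> l0 Ca; have := C_Sfun Ca i; have := C_Lfun Ca i; rewrite /sat; lia. Qed.

Lemma C0_config0 k a : C k 0 a -> a = config0.
Proof.
move=> Ca; apply/fsfunP => i; rewrite /config0 fsfun0E; have := C_Sfun Ca i; rewrite /Sfun; lia.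
Qed.

Lemma config0E (i : int) : config0 i = 0%N. Proof. by rewrite /config0 fsfun0E. Qed.

Lemma C_config0 k l : C k l config0.
Proof. by apply: C_intro => i; rewrite /Tri /Sfun /Lfun !config0E. Qed.

Lemma Cunder_last k l a : (0 < l)%N -> Cunder k l a -> exists i : int, is_last k l a i.
Proof. by move=> l0 /(CunderE k a l0) [_ [i /(last_ex l0)]]. Qed.

Lemma MplusE k l a (i : int) : is_last k l a i -> Mplus k l a = rmv i a.
Proof. by move=> h; rewrite /Mplus /= (last_posE h). Qed.

Lemma Mplus_Cunder k l a : (0 < l)%N -> Cunder k l a -> Cunder k l (Mplus k l a).
Proof.
move=> l0 h; have [i hi] := Cunder_last l0 h; have Ca := h.1; rewrite (MplusE hi).
apply/(CunderE _ _ l0); split; first exact: rmv_last_C hi.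
by exists i; apply/rmv_sat; [exact: last_entry hi|case: hi].
Qed.

Lemma iter_Mplus_Cunder k l a n : (0 < l)%N -> Cunder k l a -> Cunder k l (iter n (Mplus k l) a).
Proof. by move=> l0 h; elim: n => //= n; apply: Mplus_Cunder. Qed.

(** If two preimages moved different columns [i < i'], their common image would be
saturated at both, and at [i'] only because of the move at [i]; this leaves
[i' = i + 1] or [i' = i + 2], and the local inequalities exclude both. *)
Lemma Mplus_inj k l a a' : (0 < l)%N -> Cunder k l a -> Cunder k l a' ->
    Mplus k l a = Mplus k l a' -> a = a'.
Proof.
move=> l0; wlog: a a' / last_pos k l a <= last_pos k l a'.
  move=> H h h' e; case: (leP (last_pos k l a) (last_pos k l a')) => hh; first exact: H.
  by symmetry; apply: H => //; lia.
move=> hle h h'; have [i hi] := Cunder_last l0 h; have [i' hi'] := Cunder_last l0 h'.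
rewrite (last_posE hi) (last_posE hi') in hle.
rewrite (MplusE hi) (MplusE hi') => e.
have ai := last_entry h.1 hi; have ai' := last_entry h'.1 hi'.
case: (eqVneq i i') => [ee|ne].
  by rewrite -(rmvK ai) e ee rmvK.
set b := rmv i a in e.
have Cb : C k l b := rmv_last_C h.1 hi.
have s1 : sat k l b i by apply/rmv_sat => //; case: hi.
have s2 : sat k l b i' by rewrite e; apply/rmv_sat => //; case: hi'.
have u2 : ~ sat k l a i' by apply: hi.2; lia.
(* Only at these two columns does the move at [i] raise [Sfun] or [Lfun]. *)
have [e1|e2] : i' = i + 1 \/ i' = i + 2.
- move: u2 s2; rewrite /sat; have := Sfun_rmv i' ai; have := Lfun_rmv i' ai; rewrite -/b; lia.
- subst i'; move: s1; have := Sfun_rmv i ai'; have := Lfun_rmv i ai'; rewrite -e;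
  have := C_Sfun h'.1 i; have := C_Lfun h'.1 i; rewrite /sat; lia.
subst i'.
move: s1 u2 s2; have := Sfun_rmv i ai'; have := Lfun_rmv i ai'; have := Lfun_rmv (i+1) ai';
  rewrite -e;
  have := C_Sfun h'.1 i; have := C_Lfun h'.1 i; have := C_Lfun h'.1 (i+1);
  have := Sfun_rmv (i+2) ai; have := Lfun_rmv (i+2) ai; rewrite -/b.
have := C_Sfun Cb i; have := C_Sfun Cb (i+2); have := C_Lfun Cb i; have := C_Lfun Cb (i+2).
move=> H1 H2 H3 H4 H5 H6 H7 H8 H9 H10 H11 H12 H13 u2 H14.
have B1 : Sfun i b = l by move: H13; rewrite /sat; lia.
have B2 : Lfun (i+2) b = (k+l)%N by apply: contrapT => B2; case: H14 => B; [apply: u2; left;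
  lia|lia].
have B3 : (Lfun (i+1) b + 1 <= k + l)%N by lia.
move: B1 B2 B3 (C_Tri Cb (i+3)) (C_Tri Cb (i+2)) (C_Sfun Cb (i+3)) (C_Tri Cb i); clear;
  rewrite /Lfun /Sfun /Tri; idx i; lia.
Qed.

(** * Window sums and mass *)

(** A sum over a window of columns [lo, ..., lo + W - 1] with a weight for each of them:
constant weights give the mass, monotone weights the termination measures of the
moves. *)
Definition wsum (w : nat -> nat) (lo : int) (W : nat) (a : config) : nat := (\sum_(n < W) a (lo +
    n%:Z)%R * w n)%N.

Lemma sum_delta (W : nat) (w : nat -> nat) (n0 : nat) : (n0 < W)%N ->
    (\sum_(n < W) (n == n0 :> nat) * w n = w n0)%N.
Proof.
move=> h; rewrite (bigD1 (Ordinal h)) //= eqxx mul1n big1 ?addn0 // => i /negP hi.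
case: eqP => // e; case: hi; apply/eqP; exact: val_inj.
Qed.

Lemma wsum_rmv w (lo : int) W (a : config) (n0 : nat) : (0 < a (lo + n0%:Z)%R)%N -> (n0.+1 < W)%N ->
  (wsum w lo W (rmv (lo + n0%:Z) a) + w n0 = wsum w lo W a + w n0.+1)%N.
Proof.
move=> h hW; rewrite -(@sum_delta W w n0) -?(@sum_delta W w n0.+1); [|lia|lia].
rewrite /wsum -!big_split /=; apply: eq_bigr => n _.
rewrite -!mulnDl; congr (_ * _)%N; have := rmvD (lo + n%:Z) h.
have -> : (lo + n%:Z == lo + n0%:Z) = (n == n0 :> nat) by lia.
by have -> : (lo + n%:Z == lo + n0%:Z + 1) = (n == n0.+1 :> nat) by lia.
Qed.

Lemma wsum_lmv w (lo : int) W (a : config) (n0 : nat) : (0 < a (lo + n0%:Z + 1)%R)%N ->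
    (n0.+1 < W)%N ->
  (wsum w lo W (lmv (lo + n0%:Z) a) + w n0.+1 = wsum w lo W a + w n0)%N.
Proof.
move=> h hW; rewrite -(@sum_delta W w n0) -?(@sum_delta W w n0.+1); [|lia|lia].
rewrite /wsum -!big_split /=; apply: eq_bigr => n _.
rewrite -!mulnDl; congr (_ * _)%N; have := lmvD (lo + n%:Z) h.
have -> : (lo + n%:Z == lo + n0%:Z) = (n == n0 :> nat) by lia.
by have -> : (lo + n%:Z == lo + n0%:Z + 1) = (n == n0.+1 :> nat) by lia.
Qed.

Lemma mass_wsum (lo : int) (W : nat) (a : config) : (forall j : int, a j <> 0%N ->
    lo <= j < lo + W%:Z) -> mass a = wsum (fun=> 1%N) lo W a.
Proof.
move=> h; rewrite /wsum; under [RHS]eq_bigr do rewrite muln1.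
rewrite -(big_mkord xpredT (fun n => a (lo + n%:Z))) -(big_map (fun n : nat => lo + n%:Z) xpredT a)
  /mass.
rewrite [RHS](bigID (fun i => i \in finsupp a)) /= [X in (_ + X)%N]big1 ?addn0; last first.
  by move=> i; rewrite mem_finsupp negbK => /eqP.
rewrite -[RHS]big_filter; apply: perm_big; apply: uniq_perm; first exact: fset_uniq.
  by rewrite filter_uniq // map_inj_uniq ?iota_uniq // => x y; lia.
move=> i; rewrite mem_filter; case: (boolP (i \in finsupp a)) => //= hi; symmetry.
apply/mapP; have := hi; rewrite mem_finsupp => /eqP /h hb.
by exists `|i - lo|%N; rewrite ?mem_index_iota; lia.
Qed.

Lemma supp_window (a : config) : exists (lo : int) (W : nat), forall j : int, a j <> 0%N ->
    lo <= j /\ j + 3 <= lo + W%:Z.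
Proof. by have [N hN] := supp_bound a; exists (- N%:Z), (N + N + 4)%N => j /hN; lia. Qed.

Lemma mass_rmv (i : int) (a : config) : (0 < a i)%N -> mass (rmv i a) = mass a.
Proof.
move=> ai; have [lo [W hW]] := supp_window a.
have hi := hW i (ltac:(lia)).
have [n0 en] : exists n0 : nat, i = lo + n0%:Z by exists `|i - lo|%N; lia.
subst i; rewrite !(@mass_wsum lo W) => [|j /hW|j].
- by have := @wsum_rmv (fun=> 1%N) lo W a n0 ai (ltac:(lia)); lia.
- lia.
- move=> hj; have := rmvD j ai; case: (eqVneq (a j) 0%N) => [e|/eqP /hW]; lia.
Qed.

Lemma clear2E (i : int) (a : config) (j : int) : clear2 i a j = if (j == i) || (j == i + 1) then 0%N
    else a j.
Proof. rewrite /clear2 fsfun_withE /=. by case: (eqVneq j i) => //= _; rewrite fsfun_withE. Qed.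

Lemma mass_clear2 (i : int) (a : config) : (mass (clear2 i a) + Sfun i a)%N = mass a.
Proof.
have [lo0 [W0 hW0]] := supp_window a.
pose lo := lo0 - `|i - lo0|%:Z; pose W := (W0 + `|i - lo0| + `|i - lo0| + 2)%N.
have hW (j : int) : a j <> 0%N -> lo <= j < lo + W%:Z by move=> /hW0; rewrite /lo /W; lia.
rewrite !(@mass_wsum lo W) => [|//|j]; last first.
  by rewrite clear2E; case: ifP => // _ /hW.
have [n0 en] : exists n0 : nat, i = lo + n0%:Z by exists `|i - lo|%N; rewrite /lo; lia.
have hn : (n0.+1 < W)%N by rewrite /lo /W in en *; lia.
have -> : Sfun i a = (\sum_(n < W) (n == n0 :> nat) * a (lo + n%:Z)%R + \sum_(n < W) (n == n0.+1 :>
  nat) * a (lo + n%:Z)%R)%N.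
  rewrite (@sum_delta W (fun n => a (lo + n%:Z)) n0) ?(@sum_delta W (fun n => a (lo + n%:Z)) n0.+1);
    [|lia|lia].
  rewrite /Sfun en; congr (_ + a _)%N; lia.
rewrite /wsum -!big_split /=; apply: eq_bigr => n _; rewrite clear2E !muln1.
have -> : (lo + n%:Z == i) = (n == n0 :> nat) by lia.
have -> : (lo + n%:Z == i + 1) = (n == n0.+1 :> nat) by lia.
case: (eqVneq (n : nat) n0) => [->|_] /=; last by case: ifP => _; lia.
have -> : (n0 == n0.+1) = false by lia.
by rewrite /= mul0n mul1n addn0.
Qed.

(** * Free particles and stripping *)

Section Free.
Variables (k l : nat).
Hypotheses (l0 : (0 < l)%N) (lk : (l <= k)%N).

Lemma has_freeP (a : config) (i : int) : has_free k l a i <->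
  [/\ C k l a, Sfun i a = l, (0 < a i)%N & forall j : int, i + 2 <= j -> a j = 0%N].
Proof.
split=> [[[Ca _] h1 h2 h3]|[Ca h1 h2 h3]]; split=> //; first by lia.
  by apply/(CunderE k a l0); split=> //; exists i; left.
lia.
Qed.

Lemma free_last (a : config) (i : int) : has_free k l a i -> is_last k l a i.
Proof.
move=> /has_freeP [Ca h1 h2 h3]; split; first by left.
move=> j hj; have [e|[e|hj3]] : j = i + 1 \/ j = i + 2 \/ i + 3 <= j by lia.
- subst j; move: h1 (h3 (i+2)) (h3 (i+3)); rewrite /sat /Sfun /Lfun; idx i; lia.
- subst j; move: h1 (h3 (i+2)) (h3 (i+3)) (h3 (i+4)); rewrite /sat /Sfun /Lfun; idx i; lia.
- rewrite /sat /Sfun /Lfun !h3; lia.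
Qed.

Lemma free_pos_uniq a (i : int) (i' : int) : has_free k l a i -> has_free k l a i' -> i = i'.
Proof. by move=> /free_last h /free_last; apply: last_uniq. Qed.

Lemma clear2_rmv (i : int) (a : config) : clear2 i (rmv i a) = clear2 i a.
Proof.
by apply/fsfunP => j; rewrite !clear2E; case: ifP => // h; rewrite rmvE; case: eqP => [e|_];
  [lia|case: eqP => //; lia].
Qed.

Lemma energyE (j : int) (c : nat) : (c <= l)%N -> energy l j c = (j + 1) * l%:Z - c%:Z.
Proof. by rewrite /energy => h; lia. Qed.

Lemma energy_inj (j : int) c (j' : int) c' : (0 < c <= l)%N -> (0 < c' <= l)%N ->
    energy l j c = energy l j' c' -> j = j' /\ c = c'.
Proof.
move=> h h'; rewrite !energyE; [|lia|lia] => e.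
have ee : (j - j') * l%:Z = c%:Z - c'%:Z by lia.
have ej : j = j' by nia.
subst; lia.
Qed.

Lemma free_step a (i : int) : has_free k l a i ->
  exists i' : int, [/\ has_free k l (Mplus k l a) i', energy l i' (Mplus k l a i') = energy l i (a
    i) + 1,
    clear2 i' (Mplus k l a) = clear2 i a & i <= i'].
Proof.
move=> h; have hl := free_last h; have := h => /has_freeP [Ca h1 h2 h3].
rewrite (MplusE hl); have Cb := rmv_last_C Ca hl.
have bi : rmv i a i = (a i).-1 by rewrite rmvE eqxx.
have bi1 : rmv i a (i+1) = (a (i+1)%R).+1 by rewrite rmvE eqxx; case: eqP => //; lia.
have bj (j : int) : i + 2 <= j -> rmv i a j = 0%N.
  by move=> hj; rewrite rmvE; case: eqP; [lia|case: eqP; [lia|rewrite h3]].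
have Sb : Sfun i (rmv i a) = l by rewrite -h1 /Sfun bi bi1; lia.
case: (ltnP 1 (a i)) => hai.
  exists i; split => //.
  - by apply/has_freeP; split=> //; rewrite bi; lia.
  - by rewrite bi !energyE; move: h1; rewrite /Sfun; lia.
  - exact: clear2_rmv.
exists (i + 1); split; last by lia.
- apply/has_freeP; split=> //; last by move=> j hj; apply: bj; lia.
    move: Sb (bj (i+2)); rewrite /Sfun bi bi1; idx i; lia.
  rewrite bi1; lia.
- rewrite bi1 !energyE; move: h1; rewrite /Sfun; lia.
- apply/fsfunP => j; rewrite !clear2E.
  case: (eqVneq j i) => [->|h4].
    rewrite bi; case: ifP => //=; lia.
  case: (eqVneq j (i+1)) => [->|h5] //=.
  case: (eqVneq j (i+1+1)) => [->|h6] /=; first by rewrite h3; lia.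
  by rewrite rmvE (negbTE h4) (negbTE h5).
Qed.

Lemma free_iter a (i : int) n : has_free k l a i -> let b := iter n (Mplus k l) a in
  exists i' : int, [/\ has_free k l b i', energy l i' (b i') = energy l i (a i) + n%:Z,
    clear2 i' b = clear2 i a & i <= i'].
Proof.
move=> h /=; elim: n => [|n [i' [h1 h2 h3 h4]]] /=; first by exists i; split=> //; lia.
have [i'' [h5 h6 h7 h8]] := free_step h1; exists i''; split=> //; try lia.
by rewrite h7.
Qed.

(** A right move decreases the sum weighted by the distance to the right end of the
support.  At that end the particle is free, since next to an empty column saturation
of [Lfun] forces saturation of [Sfun] ([satL_next0]). *)
Lemma eventually_free a : Cunder k l a -> exists t i, has_free k l (iter t (Mplus k l) a) i.
Proof.
move=> h; have [lo [W hW]] := supp_window a.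
have [n hn] : exists n, (wsum (fun n => W - n)%N lo W a < n)%N by eexists; apply: ltnSn.
have {}hW : forall j : int, a j <> 0%N -> lo <= j < lo + W%:Z - 1 by move=> j /hW; lia.
elim: n a h hn hW => // n IH a h hn hW.
have [i hi] := Cunder_last l0 h; have ai := last_entry h.1 hi.
have hib := hW i (ltac:(lia)).
have [n0 en] : exists n0 : nat, i = lo + n0%:Z by exists `|i - lo|%N; lia.
case: (ltnP n0.+2 W) => hn0; last first.
  exists 0%N, i; apply/has_freeP; have z (j : int) : i + 1 <= j -> a j = 0%N.
    by move=> hj; apply: contrapT => /hW; lia.
  split=> //; [exact: h.1| |by move=> j hj; apply: z; lia].
  by case: hi.1 => //; apply: (satL_next0 h.1); apply: z; lia.
have [|||t [i' ht]] := IH (rmv i a).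
- by rewrite -(MplusE hi); apply: Mplus_Cunder.
- by subst i; have := @wsum_rmv (fun n => W - n)%N lo W a n0 ai (ltac:(lia)); lia.
- move=> j hj; have := rmvD j ai; case: (eqVneq (a j) 0%N) => [e|/eqP /hW]; lia.
by exists t.+1, i'; rewrite iterSr (MplusE hi).
Qed.

(** By [free_iter], all later times give the same energy minus time and the same rest, so
any time at which the particle is free computes the eventual value. *)
Lemma stripE a t (i : int) : has_free k l (iter t (Mplus k l) a) i ->
  strip k l a = (energy l i (iter t (Mplus k l) a i) - t%:Z, clear2 i (iter t (Mplus k l) a)).
Proof.
move=> h; rewrite /strip /eventual.
set P := (X in xget _ X).
have hP : P (energy l i (iter t (Mplus k l) a i) - t%:Z, clear2 i (iter t (Mplus k l) a)).
  exists t => t' htt; have [i' [h1 h2 h3 _]] := free_iter (t' - t) h.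
  move: h1 h2 h3; rewrite -iterD subnK // => h1 h2 h3; exists i' => //.
  by rewrite h3 h2; congr (_, _); lia.
case: xgetP => [y _ [t0 hy]|/(_ _ hP)] //.
case: hP => t1 ht1.
have [i1 f1 ->] := hy (maxn t0 t1) (leq_maxl _ _).
have [i2 f2 ->] := ht1 (maxn t0 t1) (leq_maxr _ _).
by rewrite (free_pos_uniq f1 f2).
Qed.

Lemma strip_ex a : Cunder k l a -> exists t i, [/\ has_free k l (iter t (Mplus k l) a) i &
  strip k l a = (energy l i (iter t (Mplus k l) a i) - t%:Z, clear2 i (iter t (Mplus k l) a))].
Proof. by move=> /eventually_free [t [i h]]; exists t, i; split=> //; apply: stripE. Qed.

Lemma iter_Mplus_inj n a a' : Cunder k l a -> Cunder k l a' ->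
    iter n (Mplus k l) a = iter n (Mplus k l) a' -> a = a'.
Proof.
move=> h h'; elim: n => //= n IH /(Mplus_inj l0) e; apply: IH; apply: e; exact: iter_Mplus_Cunder.
Qed.

Lemma free_eq a a' (i : int) (i' : int) : has_free k l a i -> has_free k l a' i' ->
    energy l i (a i) = energy l i' (a' i') ->
  clear2 i a = clear2 i' a' -> a = a'.
Proof.
move=> /has_freeP [_ h1 h2 _] /has_freeP [_ h1' h2' _] e ec.
have [||ei ea] := energy_inj _ _ e; try by (move: h1 h1'; rewrite /Sfun; lia).
subst i'; apply/fsfunP => j; have := congr1 (fun f : config => f j) ec; rewrite /= !clear2E.
case: (eqVneq j i) => [->|_] //=; case: (eqVneq j (i+1)) => [->|_] //= _.
move: h1 h1' ea; rewrite /Sfun; lia.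
Qed.

(** Equal strips lead to the same configuration after equally many right moves, and right
moves are injective. *)
Lemma strip_inj a a' : Cunder k l a -> Cunder k l a' -> strip k l a = strip k l a' -> a = a'.
Proof.
move=> h h'; have [t [i [f e]]] := strip_ex h; have [t' [i' [f' e']]] := strip_ex h'.
have [j [fj ej cj _]] := free_iter t' f; have [j' [fj' ej' cj' _]] := free_iter t f'.
rewrite -iterD in fj ej cj; rewrite -iterD in fj' ej' cj'.
rewrite e e' => -[e1 e2].
apply: (@iter_Mplus_inj (t' + t)) => //; rewrite [in RHS]addnC.
apply: (free_eq fj fj'); [lia|by rewrite cj cj' e2].
Qed.

Lemma mass_iter a n : Cunder k l a -> mass (iter n (Mplus k l) a) = mass a.
Proof.
move=> h; elim: n => //= n <-; have hc := iter_Mplus_Cunder n l0 h;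
  have [i hi] := Cunder_last l0 hc.
by rewrite (MplusE hi); apply: mass_rmv; exact: last_entry hc.1 hi.
Qed.

Lemma clear2_C (i : int) (a : config) : C k l a -> C k l (clear2 i a).
Proof.
move=> Ca; have h (j : int) : (clear2 i a j <= a j)%N by rewrite clear2E; case: ifP.
apply: C_intro => j; [have := C_Tri Ca j|have := C_Sfun Ca j|have := C_Lfun Ca j];
  rewrite /Tri /Sfun /Lfun;
have := h j; have := h (j+1); have := h (j+2); have := h (j-1); lia.
Qed.

Lemma strip_C a s x : Cunder k l a -> strip k l a = (s, x) -> C k l x /\ (mass x + l)%N = mass a.
Proof.
move=> h; have [t [i [f ->]]] := strip_ex h => -[_ <-]; split.
  by apply: clear2_C; case: (iter_Mplus_Cunder t l0 h).
by move: f => /has_freeP [_ hS _ _]; rewrite -[in RHS](mass_iter t h) -(mass_clear2 i (iter t _ a))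
  hS.
Qed.

End Free.

(** * First properties of iota *)

Lemma weight_ex k l a : C k l a -> a <> config0 -> exists l', (0 < l' <= l)%N /\ Cunder k l' a.
Proof.
elim: l => [|l IH] Ca ha; first by case: ha; exact: C0_config0 Ca.
have [Cb|h] := pselect (C k l a); last by (exists l.+1; split; [lia|split]).
by have [l' [h1 h2]] := IH Cb ha; exists l'; split=> //; lia.
Qed.

Lemma Cunder_uniq k l l' a : (0 < l)%N -> (0 < l')%N -> Cunder k l a -> Cunder k l' a -> l = l'.
Proof.
move=> h0 h0' [h1 h2] [h3 h4]; apply: contrapT => ne.
have [h|h] : (l <= l'.-1)%N \/ (l' <= l.-1)%N by lia.
  by apply: h4; apply: C_mono_l h1.
by apply: h2; apply: C_mono_l h3.
Qed.

Lemma weightE k l a : (0 < l <= k)%N -> Cunder k l a -> weight k a = l.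
Proof.
move=> h ha; rewrite /weight; case: xgetP => [y _ [hy1 hy2]|/(_ l)].
  by apply: (Cunder_uniq _ _ hy2 ha); lia.
by case; split.
Qed.

Lemma Cunder_neq0 k l a : (0 < l)%N -> Cunder k l a -> a <> config0.
Proof.
move=> l0 /(CunderE k a l0) [_ [i hi]] e; subst a; move: hi; rewrite /sat /Sfun /Lfun !config0E;
  lia.
Qed.

Lemma iota0 k : iota_map k config0 = [::].
Proof. by rewrite /iota_map; case: (mass config0) => //= n; rewrite eqxx. Qed.

(** Stripping a particle lowers the mass, hence the fuel in the definition of [iota_map]
is sufficient and any larger amount gives the same result. *)
Lemma iota_fuelE k n a : C k k a -> (mass a <= n)%N -> iota_fuel n k a = iota_map k a.
Proof.
elim/ltn_ind: n a => n IH a Ca hn; have [e|ha] := pselect (a = config0).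
  by rewrite e iota0; case: n {IH hn} => //= n; rewrite eqxx.
have [l [hl hc]] := weight_ex Ca ha.
have hl0 : (0 < l)%N by lia. have hlk : (l <= k)%N by lia.
case es : (strip k l a) => [s x]; have [Cx hm] := strip_C hl0 hlk hc es.
have Cxk : C k k x by apply: C_mono_l Cx.
case: n IH hn => [|n] IH hn; first by lia.
rewrite /iota_map; case em: (mass a) => [|m]; first by lia.
rewrite /=; case: eqP => // _; rewrite (weightE hl hc) es.
by rewrite !IH //; lia.
Qed.

Lemma iota_cons k l a s x : (0 < l <= k)%N -> Cunder k l a -> strip k l a = (s, x) ->
  iota_map k a = (l, s - Asum k l (iota_map k x)) :: iota_map k x.
Proof.
move=> hl hc es; have [hl0 hlk] := andP hl; have [Cx hm] := strip_C hl0 hlk hc es.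
rewrite {1}/iota_map; case em: (mass a) => [|m]; first by lia.
rewrite /=; case: eqP => [e|_]; first by case: (Cunder_neq0 hl0 hc e).
by rewrite (weightE hl hc) es iota_fuelE //; [apply: C_mono_l Cx|lia].
Qed.

Lemma iota_inj k a a' : C k k a -> C k k a' -> iota_map k a = iota_map k a' -> a = a'.
Proof.
have [n hn] := ex_intro (fun n => (mass a < n)%N) _ (ltnSn (mass a)).
elim: n a a' hn => // n IH a a' hn Ca Ca'.
have [ea|ha] := pselect (a = config0); have [ea'|ha'] := pselect (a' = config0).
- by rewrite ea ea'.
- have [l [hl hc]] := weight_ex Ca' ha'; case es : (strip k l a') => [s x].
  by rewrite ea iota0 (iota_cons hl hc es).
- have [l [hl hc]] := weight_ex Ca ha; case es : (strip k l a) => [s x].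
  by rewrite ea' iota0 (iota_cons hl hc es).
have [l [hl hc]] := weight_ex Ca ha; case es : (strip k l a) => [s x].
have [l' [hl' hc']] := weight_ex Ca' ha'; case es' : (strip k l' a') => [s' x'].
rewrite (iota_cons hl hc es) (iota_cons hl' hc' es') => -[ell e1 e2]; subst l'.
have [hl0 hlk] := andP hl; have [Cx hm] := strip_C hl0 hlk hc es.
have [Cx' hm'] := strip_C hl0 hlk hc' es'.
have ex : x = x' by (apply: IH => //; [lia|apply: C_mono_l Cx|apply: C_mono_l Cx']).
apply: (strip_inj hl0 hlk hc hc'); rewrite es es' ex; congr (_, _); rewrite e2 in e1; lia.
Qed.

(** * A free particle above the rest of a configuration *)

Lemma C_le k l (a b : config) : (forall j : int, (b j <= a j)%N) -> C k l a -> C k l b.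
Proof.
move=> h Ca; apply: C_intro => j; [have := C_Tri Ca j|have := C_Sfun Ca j|have := C_Lfun Ca j];
  rewrite /Tri /Sfun /Lfun;
have := h j; have := h (j+1); have := h (j+2); have := h (j-1); lia.
Qed.

Lemma sat_le k l (a b : config) (i : int) : (forall j : int, (b j <= a j)%N) -> C k l a ->
    sat k l b i -> sat k l a i.
Proof.
move=> h Ca; have := C_Sfun Ca i; have := C_Lfun Ca i; rewrite /sat /Sfun /Lfun;
have := h i; have := h (i+1); have := h (i+2); have := h (i-1); lia.
Qed.

Section Order.
Variables (k l : nat).
Hypotheses (l0 : (0 < l)%N) (lk : (l <= k)%N).

Lemma clear2_le (i : int) (a : config) (j : int) : (clear2 i a j <= a j)%N.
Proof. by rewrite clear2E; case: ifP. Qed.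

(** The columns from [i] on are empty in [clear2 i b].  Next to empty columns saturation of
[Lfun] implies saturation of [Sfun], and [Sfun] at [i - 1] cannot be saturated without
the mass in column [i]. *)
Lemma free_sat_ge b (i : int) (u : int) : has_free k l b i -> sat k l (clear2 i b) u ->
    u + 2 <= i /\ (u + 2 = i -> Sfun u b = l).
Proof.
move=> /(has_freeP l0 lk) [Cb h1 h2 h3] su.
have z (j : int) : i <= j -> clear2 i b j = 0%N.
  move=> hj; rewrite clear2E; case: ifP => // h; apply: h3; lia.
have Cx : C k l (clear2 i b) by apply: C_le Cb; apply: clear2_le.
have E (j : int) : j < i -> clear2 i b j = b j by (move=> hj; rewrite clear2E ifF //; lia).
have [h|[h|[h|h]]] : u + 2 < i \/ u + 2 = i \/ u + 1 = i \/ i <= u by lia.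
- lia.
- have uE : u = i - 2 by lia. subst u; split; first by lia.
  move=> _; have : Sfun (i - 2) (clear2 i b) = l.
    by case: su => // su; apply: (satL_next0 Cx) => //; apply: z; lia.
  by rewrite /Sfun !E; lia.
- exfalso; have uE : u = i - 1 by lia. subst u.
  have: Sfun (i - 1) (clear2 i b) = l.
    by case: su => // su; apply: (satL_next0 Cx) => //; apply: z; lia.
  rewrite /Sfun E ?z; [|lia|lia]; have := C_Sfun Cb (i-1); rewrite /Sfun; idx i; lia.
- exfalso; move: su; rewrite /sat /Sfun /Lfun !(z u, z (u+1), z (u+2)); [|lia..].
  have := C_Sfun Cx (u-1); rewrite /Sfun. lia.
Qed.

Lemma free_rmv_second b (i : int) (u : int) : has_free k l b i -> is_last k l (clear2 i b) u ->
    C k l (rmv u b) ->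
  [/\ has_free k l (rmv u b) i, rmv u b i = b i & clear2 i (rmv u b) = rmv u (clear2 i b)].
Proof.
move=> hf hu C'; have [hui hS] := free_sat_ge hf hu.1.
have [Cb h1 h2 h3] := (has_freeP l0 lk b i).1 hf.
have E (j : int) : j < i -> clear2 i b j = b j by (move=> hj; rewrite clear2E ifF //; lia).
have nu (j : int) : i <= j -> rmv u b j = b j.
  by move=> hj; rewrite rmvE; case: eqP; [lia|case: eqP; [lia|]].
split.
- apply/(has_freeP l0 lk); split=> //.
  + by rewrite -h1 /Sfun !nu //; lia.
  + by rewrite nu.
  + by move=> j hj; rewrite nu ?h3 //; lia.
- by rewrite nu.
- apply/fsfunP => j; rewrite clear2E (rmvE u b) (rmvE u (clear2 i b)) !clear2E.
  case: (eqVneq j u) => [e|n1]; first by rewrite !ifF; lia.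
  case: (eqVneq j (u+1)) => [e|n2]; first by rewrite !ifF; lia.
  by [].
Qed.

(** At distance 2 or 3 the gap is enforced by the local bounds; from distance 4 on it is
automatic, since [Acoef k l l <= 3 * l]. *)
Lemma free_gap b (i : int) (i2 : int) : has_free k l b i -> has_free k l (clear2 i b) i2 ->
  energy l i2 (clear2 i b i2) + (Acoef k l l)%:Z <= energy l i (b i).
Proof.
move=> hf hf2; have [hui hS] := free_sat_ge hf (free_last l0 lk hf2).1.
have [Cb h1 h2 h3] := (has_freeP l0 lk b i).1 hf.
have E (j : int) : j < i -> clear2 i b j = b j by (move=> hj; rewrite clear2E ifF //; lia).
have [_ g1 g2 g3] := (has_freeP l0 lk _ i2).1 hf2.
rewrite !(energyE l0 lk); [|move: g1 h1; rewrite /Sfun; lia..].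
rewrite /Acoef; move: g1 h1; rewrite /Sfun !E; [|lia..] => g1 h1.
rewrite E in g2; last by lia.
have [e|[e|e]] : i2 + 2 = i \/ i2 + 3 = i \/ i2 + 4 <= i by lia.
- have ie : i2 = i - 2 by lia. subst i2; have -> : (i - 2 + 1) * l%:Z = (i + 1) * l%:Z - 2 * l%:Z by
    lia.
  move: ((i + 1) * _) g1 h1 g2 (C_Lfun Cb (i-1)) (C_Sfun Cb (i-1)) => E1; rewrite /Sfun /Lfun;
    idx i; lia.
- have ie : i2 = i - 3 by lia. subst i2; have -> : (i - 3 + 1) * l%:Z = (i + 1) * l%:Z - 3 * l%:Z by
    lia.
  move: ((i + 1) * _) g1 h1 g2 (C_Tri Cb (i-2)) => E1; rewrite /Tri; idx i; lia.
- have : (i2 + 4) * l%:Z <= i * l%:Z by nia.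
  lia.
Qed.

End Order.

(** * Left positions and the collective left move *)

Lemma rmv_at (j : int) (a : config) : rmv j a j = (a j).-1.
Proof. by rewrite rmvE eqxx. Qed.

Lemma rmv_at1 (j : int) (a : config) : rmv j a (j + 1) = (a (j + 1)%R).+1.
Proof. by rewrite rmvE ifF ?eqxx //; lia. Qed.

Lemma lmv_at (j : int) (a : config) : lmv j a j = (a j).+1.
Proof. by rewrite lmvE eqxx. Qed.

Lemma lmv_at1 (j : int) (a : config) : lmv j a (j + 1) = (a (j + 1)%R).-1.
Proof. by rewrite lmvE ifF ?eqxx //; lia. Qed.

Lemma lmv_id (j : int) (a : config) (i : int) : i < j \/ j + 1 < i -> lmv j a i = a i.
Proof. by move=> h; rewrite lmvE; case: eqP; [lia|case: eqP; [lia|]]. Qed.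

Lemma rmv_id (j : int) (a : config) (i : int) : i < j \/ j + 1 < i -> rmv j a i = a i.
Proof. by move=> h; rewrite rmvE; case: eqP; [lia|case: eqP; [lia|]]. Qed.

Lemma erase_leE (j : int) (a : config) (i : int) : erase_le j a i = if i <= j then 0%N else a i.
Proof.
rewrite /erase_le fsfun_fun; case: finsuppP => [|//]; first by case: ifP.
Qed.

Lemma erase_le_le (j : int) (a : config) (i : int) : (erase_le j a i <= a i)%N.
Proof. by rewrite erase_leE; case: ifP. Qed.

Lemma erase_erase (q : int) (q' : int) a : q <= q' -> erase_le q' (erase_le q a) = erase_le q' a.
Proof. move=> h; apply/fsfunP => j; rewrite !erase_leE; case: ifP => // h1; case: ifP => //;
  lia. Qed.

Lemma erase_lmv_lt (q : int) (j : int) a : q < j -> erase_le q (lmv j a) = lmv j (erase_le q a).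
Proof.
move=> h; apply/fsfunP => i; rewrite erase_leE !lmvE !erase_leE.
case: (eqVneq i j) => [->|n1]; first by rewrite !ifF; lia.
case: (eqVneq i (j+1)) => [->|n2]; first by rewrite !ifF; lia.
by [].
Qed.

Lemma erase_rmv_lt (q : int) (j : int) a : q < j -> erase_le q (rmv j a) = rmv j (erase_le q a).
Proof.
move=> h; apply/fsfunP => i; rewrite erase_leE !rmvE !erase_leE.
case: (eqVneq i j) => [->|n1]; first by rewrite !ifF; lia.
case: (eqVneq i (j+1)) => [->|n2]; first by rewrite !ifF; lia.
by [].
Qed.

Section Left.
Variables (k l : nat).
Hypotheses (l0 : (0 < l)%N) (lk : (l <= k)%N).

(** The complete list of the positions [j_1 < j_2 < ...] from which the left moves start.
It is a relation rather than a value computed with [first_pos], so that the default of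
[first_pos] never enters. *)
Fixpoint positions (a : config) (js : seq int) : Prop :=
  if js is j :: js' then is_first k l a j /\ positions (erase_le (j + 1) a) js'
  else forall i : int, ~ sat k l a i.

Lemma eraseC (q : int) a : C k l a -> C k l (erase_le q a).
Proof. by apply: C_le; apply: erase_le_le. Qed.

Lemma erase_sat (q : int) a (i : int) : C k l a -> sat k l (erase_le q a) i -> sat k l a i.
Proof. by apply: sat_le; apply: erase_le_le. Qed.

(** Mirror image of [free_sat_ge]: successive positions are at least 2 apart, and when they
are exactly 2 apart the second one is saturated through [Sfun]. *)
Lemma sat_erase_ge a (j : int) (u : int) : C k l a -> (0 < a (j+1)%R)%N ->
    sat k l (erase_le (j+1) a) u ->
  j + 2 <= u /\ (u = j + 2 -> Sfun u a = l).
Proof.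
move=> Ca aj su.
have Cr := eraseC (j + 1) Ca.
have z (i : int) : i <= j + 1 -> erase_le (j+1) a i = 0%N by rewrite erase_leE => ->.
have E (i : int) : j + 1 < i -> erase_le (j+1) a i = a i by move=> h; rewrite erase_leE ifF //; lia.
have hS : u <= j + 2 -> Sfun u (erase_le (j+1) a) = l.
  by move=> hu; case: su => // su; apply: (satL_prev0 Cr) => //; apply: z; lia.
have [h|[h|h]] : j + 2 <= u \/ u = j + 1 \/ u <= j by lia.
- split=> // e; subst u; have := hS (lexx _); rewrite /Sfun !E //; lia.
- subst u; have := hS (ltac:(lia)); rewrite /Sfun z ?E; [|lia|lia].
  have := C_Sfun Ca (j+1); rewrite /Sfun. lia.
- have := hS (ltac:(lia)); rewrite /Sfun !z; lia.
Qed.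

Lemma positions_mem a js (u : int) : C k l a -> positions a js -> u \in js ->
    sat k l a u /\ (0 < a (u+1)%R)%N.
Proof.
elim: js a => [|j js IH] a Ca //= [hj hp]; rewrite inE => /orP [/eqP ->|hu].
  by split; [case: hj|apply: first_entry hj].
have [h1 h2] := IH _ (eraseC _ Ca) hp hu; split; first exact: erase_sat h1.
by apply: leq_trans h2 (erase_le_le _ _ _).
Qed.

Lemma positions_ge a (j : int) js (u : int) : C k l a -> positions a (j :: js) -> u \in js ->
    j + 2 <= u /\ (u = j + 2 -> Sfun u a = l).
Proof.
move=> Ca [hj hp] hu; apply: sat_erase_ge => //; first exact: first_entry hj.
by case: (positions_mem (eraseC _ Ca) hp hu).
Qed.

Lemma positions_erase a pre (j : int) js : C k l a -> positions a (pre ++ j :: js) ->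
    positions (erase_le (j+1) a) js.
Proof.
elim: pre a => [|p pre IH] a Ca; first by case.
rewrite cat_cons => hp; have [h _] := @positions_ge _ _ _ j Ca hp (ltac:(by rewrite mem_cat inE eqxx
  orbT)).
case: hp => hf hp; have := IH _ (eraseC _ Ca) hp; rewrite erase_erase //; lia.
Qed.

(** After its first entry, the list is determined by the columns that survive the first
erasure. *)
Lemma positions_ext r r' (q : int) js : C k l r -> (forall i : int,
    sat k l r' i <-> sat k l r i) -> (forall i : int, q <= i -> r' i = r i) ->
  {in js, forall u, q <= u + 2} -> positions r js -> positions r' js.
Proof.
case: js => [|j js] Cr hs hE hq /=; first by move=> h i /hs; apply: h.
have hj := hq j (mem_head _ _).
move=> [[sj hj2] hp]; split; first by split; [apply/hs|move=> i /hj2 h /hs].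
suff -> : erase_le (j + 1) r' = erase_le (j + 1) r by [].
apply/fsfunP => i; rewrite !erase_leE; case: ifP => // h; apply: hE; lia.
Qed.

(** The moved particle may become saturated further to the left, at [j'], but what lies
beyond [j + 1] is untouched.  The one danger is a new saturation of [Lfun] at [j - 2] that
lets column [j] count as a second particle; [satL_next] rules it out. *)
Lemma positions_lmv_head a (j : int) js : C k l a -> positions a (j :: js) ->
    exists j' : int, positions (lmv j a) (j' :: js).
Proof.
move=> Ca hp; have [hf hr] := hp; have aj := first_entry Ca hf.
have Cb := lmv_first_C Ca hf; set b := lmv j a in Cb *.
have sb : sat k l b j by apply/lmv_sat => //; case: hf.
have [j' hj'] := first_ex l0 sb; exists j'; split=> //.
have j'le : j' <= j by rewrite leNgt; apply/negP => h; exact: (hj'.2 j).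
have bj := first_entry Cb hj'.
have Cr := eraseC (j+1) Ca; have Cr' := eraseC (j'+1) Cb.
have E (i : int) : j + 2 <= i -> erase_le (j' + 1) b i = erase_le (j + 1) a i.
  move=> hi; rewrite !erase_leE !ifF; [|lia|lia].
  by rewrite /b lmvE; case: eqP; [lia|case: eqP; [lia|]].
apply: (positions_ext (q := j + 2) Cr _ E) hr; last first.
  by move=> u hu; have := positions_ge Ca hp hu; lia.
have le (i : int) : (erase_le (j + 1) a i <= erase_le (j' + 1) b i)%N.
  by case: (leP (j+2) i) => h; [rewrite E|rewrite erase_leE ifT //; lia].
move=> i; split; last by apply: sat_le.
move=> si; have [hi hS] := sat_erase_ge Cb bj si.
have sbi := erase_sat Cb si.
have HS := Sfun_lmv i aj; have HL := Lfun_lmv i aj; rewrite -/b in HS HL.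
have CSa := C_Sfun Ca i; have CLa := C_Lfun Ca i.
have [h|[h|[h|h]]] : j + 3 <= i \/ i = j + 2 \/ i = j + 1 \/ i <= j by lia.
- by move: si; rewrite /sat /Sfun /Lfun !E //; lia.
- have e : Sfun i b = l by case: sbi => // sbi; lia.
  left; rewrite -e /Sfun !erase_leE !ifF; [|lia|lia].
  by rewrite /b !lmv_id //; lia.
- by exfalso; move: sbi; rewrite /sat; lia.
exfalso.
have sj' := hj'.1; have HS' := Sfun_lmv j' aj; have HL' := Lfun_lmv j' aj; rewrite -/b in HS' HL'.
have ua : ~ sat k l a j' by apply: hf.2; lia.
have CSa' := C_Sfun Ca j'; have CLa' := C_Lfun Ca j'.
have ej : j' = j - 2 by move: ua sj'; rewrite /sat; lia.
have ei : i = j' + 2 by lia.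
have := hS ei; rewrite ei => S2.
have L2 : Lfun j' b = (k + l)%N by move: ua sj'; rewrite /sat; lia.
have := satL_next Cb L2 S2.
have := Sfun_lmv (j' - 1) aj; rewrite -/b.
have := unsatS Ca (hf.2 (j' - 1) (ltac:(lia))).
lia.
Qed.

(** The move raises [Sfun] and [Lfun] only at [j - 2] and [j - 1] and lowers them only beyond
[j].  An earlier position [p <= j - 2] thus stays saturated, and no new saturated column
appears before it. *)
Lemma positions_lmv a pre (j : int) js : C k l a -> C k l (lmv j a) ->
    positions a (pre ++ j :: js) ->
  exists j' : int, positions (lmv j a) (pre ++ j' :: js).
Proof.
elim: pre a => [|p pre IH] a Ca Cb; first exact: positions_lmv_head.
rewrite cat_cons => hp.
have jin : j \in pre ++ j :: js by rewrite mem_cat inE eqxx orbT.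
have [hj _] := positions_ge Ca hp jin.
have [_ aj] : sat k l a j /\ (0 < a (j+1)%R)%N by apply: (positions_mem Ca hp);
  rewrite inE jin orbT.
case: hp => hf hp.
have [|j' hj'] := IH _ (eraseC (p+1) Ca) _ hp.
  by rewrite -erase_lmv_lt; [apply: eraseC|lia].
exists j'; rewrite cat_cons; split; last by rewrite erase_lmv_lt //; lia.
have HS i := Sfun_lmv i aj; have HL i := Lfun_lmv i aj.
split; last first.
  by move=> i hi; move: (hf.2 i hi) (HS i) (HL i); rewrite /sat; lia.
by move: hf.1 (HS p) (HL p) (C_Lfun Cb p); rewrite /sat; lia.
Qed.

(** When [j1] is close to [j], the next particle may be unable to move left; the first move
makes the room that the second one needs. *)
Lemma lmv_next_C a (j : int) (j1 : int) : C k l a -> C k l (lmv j a) -> (0 < a (j+1)%R)%N ->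
    is_first k l (erase_le (j+1) a) j1 ->
  C k l (lmv j1 (lmv j a)).
Proof.
move=> Ca Cb aj hf; have Cr := eraseC (j+1) Ca.
have [h S1] := sat_erase_ge Ca aj hf.1.
have rj1 := first_entry Cr hf.
set b := lmv j a in Cb *.
have E (i : int) : j + 2 <= i -> b i = erase_le (j + 1) a i.
  move=> hi; rewrite !erase_leE !ifF; [|lia].
  by rewrite /b lmvE; case: eqP; [lia|case: eqP; [lia|]].
have us (i : int) : i < j1 -> (Sfun i (erase_le (j+1) a) < l)%N /\
  (Lfun i (erase_le (j+1) a) < k + l)%N.
  by move=> hi; split; [apply: (unsatS Cr)|apply: (unsatL Cr)]; apply: hf.2.
have HS i := Sfun_lmv i aj; have HL i := Lfun_lmv i aj; have HT i := Tri_lmv i aj;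
  rewrite -/b in HS HL HT.
have key : j1 = j + 2 -> (Lfun j b < k + l)%N /\ (Tri j b < k)%N.
  move=> e; rewrite e in S1; have {}S1 := S1 erefl; split.
    have := HL j; have := C_Lfun Ca j; case: (ltngtP (Lfun j a) (k + l)%N) => [|//|e2]; try lia.
    have := satL_next Ca e2 S1; have := HS (j-1); have := C_Sfun Cb (j-1); lia.
  have := HT j; have := C_Tri Ca j; move: S1 aj (C_Lfun Ca (j+1)); rewrite /Tri /Sfun /Lfun; idx j;
    lia.
apply: lmvC => //.
- by rewrite E //; lia.
- have [e|h2] : j1 = j + 2 \/ j + 3 <= j1 by lia.
    have := HS (j1-1); have := C_Sfun Ca (j1-1); lia.
  have := (us (j1-1) (ltac:(lia))).1; rewrite /Sfun !E; lia.
- have [h2|h2] : j1 <= j + 3 \/ j + 4 <= j1 by lia.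
    have := HL (j1-1); have := C_Lfun Ca (j1-1); lia.
  have := (us (j1-1) (ltac:(lia))).2; rewrite /Lfun !E; lia.
- have [e|[h2|h2]] : j1 = j + 2 \/ j + 3 <= j1 <= j + 4 \/ j + 5 <= j1 by lia.
  + by rewrite (_ : j1 - 2 = j); [case: (key e)|lia].
  + have := HL (j1-2); have := C_Lfun Ca (j1-2); lia.
  + have := (us (j1-2) (ltac:(lia))).2; rewrite /Lfun !E; lia.
- have [e|[h2|h2]] : j1 = j + 2 \/ j1 = j + 3 \/ j + 4 <= j1 by lia.
  + by rewrite (_ : j1 - 2 = j); [case: (key e)|lia].
  + have := HT (j1-2); have := C_Tri Ca (j1-2); lia.
  + have := sat_Tril Cr hf.1 (us (j1-1) (ltac:(lia))).1 (us (j1-2) (ltac:(lia))).1 (us (j1-1)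
    (ltac:(lia))).2.
    by rewrite /Tri !E //; lia.
Qed.

Lemma left_rest_cons c a (j : int) : is_first k l a j -> left_rest k l c.+1 a = left_rest k l c
    (erase_le (j+1) a).
Proof.
move=> hf; elim: c => [|c IH] /=; first by rewrite (first_posE hf).
by rewrite -IH.
Qed.

Lemma left_posE a pre (j : int) js : positions a (pre ++ j :: js) ->
    left_pos k l (size pre).+1 a = j.
Proof.
rewrite /left_pos /=; elim: pre a => [|p pre IH] a; first by case=> hf _;
  rewrite /= (first_posE hf).
rewrite cat_cons => -[hf hp]; rewrite (left_rest_cons _ hf); exact: IH.
Qed.

Lemma MminusE a pre (j : int) js : positions a (pre ++ j :: js) ->
    Mminus k l (size pre).+1 a = lmv j a.
Proof. by move=> h; rewrite /Mminus /= (left_posE h). Qed.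

Definition lmvs (a : config) (js : seq int) := foldl (fun b j => lmv j b) a js.

(** After some left moves the next position is no longer the first saturated one, so the
admissibility of the next move has to be carried along as an invariant. *)
Definition next_ok (a : config) (js : seq int) := if js is j :: _ then C k l (lmv j a) else True.

(** The entries [pre] belong to the particles that have already moved, [js] to those that
move now, and [rest] to those that stay for the moment. *)
Lemma lmvs_chain rest js a pre : C k l a -> positions a (pre ++ js ++ rest) ->
    next_ok a (js ++ rest) ->
  let b := lmvs a js in
  [/\ C k l b, exists pre', size pre' = (size pre + size js)%N /\
    positions b (pre' ++ rest), next_ok b rest &
   foldl (fun b c => Mminus k l c b) a (iota (size pre).+1 (size js)) = b].
Proof.
elim: js a pre => [|j js IH] a pre Ca hp hn /=.
  by split=> //; exists pre; split=> //; rewrite addn0.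
have Cb : C k l (lmv j a) by [].
have hp2 : positions a (pre ++ j :: (js ++ rest)) by [].
have [j' hj'] := positions_lmv Ca Cb hp2.
have [||h1 [pre' [h2 h3]] h4 h5] := IH (lmv j a) (rcons pre j') Cb.
- by rewrite cat_rcons.
- have aj : (0 < a (j+1)%R)%N by apply: (positions_mem Ca hp _).2; rewrite mem_cat inE eqxx orbT.
  have := positions_erase Ca hp2; case e : (js ++ rest) => [|j1 js1] //= [hf _].
  exact: lmv_next_C.
split=> //; first by exists pre'; split=> //; rewrite h2 size_rcons; lia.
by rewrite (MminusE hp) -h5 size_rcons.
Qed.

Lemma positions_next_ok a js : C k l a -> positions a js -> next_ok a js.
Proof. by case: js => //= j js Ca [hf _]; apply: lmv_first_C hf. Qed.

Lemma Mminus_allE a js rest : C k l a -> positions a (js ++ rest) ->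
  let b := Mminus_all k l (size js) a in
  [/\ b = lmvs a js, C k l b, exists pre', size pre' = size js /\
    positions b (pre' ++ rest) & next_ok b rest].
Proof.
move=> Ca hp; have [h1 h2 h3 h4] := @lmvs_chain rest js a [::] Ca hp (positions_next_ok Ca hp).
by rewrite /Mminus_all h4.
Qed.

(** Since the list ends with [j], the columns beyond can be saturated only with the help of
column [j + 1], and the left move has lowered it; so the right move undoes it. *)
Lemma Mplus_lmv b pre (j : int) : C k l b -> C k l (lmv j b) -> positions b (pre ++ [:: j]) ->
  Mplus k l (lmv j b) = b.
Proof.
move=> Cb Cc hp; have jin : j \in pre ++ [:: j] by rewrite mem_cat inE eqxx orbT.
have [sj bj] := positions_mem Cb hp jin.
have := positions_erase Cb hp => /= hu.
suff hl : is_last k l (lmv j b) j by rewrite (MplusE hl) lmvK.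
split; first by apply/lmv_sat.
move=> i hi si; have HS := Sfun_lmv i bj; have HL := Lfun_lmv i bj; have CSb := C_Sfun Cb i;
  have CLb := C_Lfun Cb i.
have E (i' : int) : j + 2 <= i' -> lmv j b i' = erase_le (j+1) b i'.
  by move=> h; rewrite erase_leE lmvE ifF ?ifF ?ifF //; lia.
have [h|[h|h]] : j + 3 <= i \/ i = j + 2 \/ i = j + 1 by lia.
- by apply: (hu i); move: si; rewrite /sat /Sfun /Lfun !E //; lia.
- have e : Sfun i (lmv j b) = l by move: si; rewrite /sat; lia.
  by apply: (hu i); left; rewrite -e /Sfun !E //; lia.
- by move: si; rewrite /sat; lia.
Qed.

End Left.

(** The recursion stops because each erasure moves the first saturated column at least 2
to the right, within a bounded range. *)
Lemma positions_ex k l a : (0 < l)%N -> (l <= k)%N -> C k l a -> exists js, positions k l a js.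
Proof.
move=> l0 lk; have [N hN] := @sat_bound k l a l0 => Ca.
have [n hn] : exists n : nat, forall i : int, sat k l a i -> N - n%:Z < i <= N.
  by exists (`|N| + `|N| + 1)%N => i /hN; lia.
clear hN; elim: n a Ca hn => [|n IH] a Ca hn.
  by exists [::] => i /hn; lia.
have [[i hi]|h] := pselect (exists i : int, sat k l a i); last first.
  by exists [::] => i hi; apply: h; exists i.
have [j hj] := first_ex l0 hi; have [|js hjs] := IH _ (eraseC (j + 1) Ca).
  move=> u su; have := hn _ (erase_sat Ca su); have := hn _ hj.1.
  by have := (sat_erase_ge l0 lk Ca (first_entry Ca hj) su).1; lia.
by exists (j :: js).
Qed.

(** * Mirror image *)

(** Right moves of the last particle are left moves of the first particle in the mirror
image.  This transfers the results on successive left moves to pairs of right moves. *)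
Definition mirror (a : config) : config := [fsfun i in [fset - x | x in finsupp a]%fset => a (- i)].
Lemma mirrorE a (i : int) : mirror a i = a (- i).
Proof.
rewrite /mirror fsfun_fun; case: ifP => // /negP h; symmetry; apply/eqP;
  apply: contrapT => /negP h2; apply: h.
by apply/imfsetP; exists (- i); rewrite ?opprK //= mem_finsupp.
Qed.

Lemma mirrorK a : mirror (mirror a) = a.
Proof. by apply/fsfunP => i; rewrite !mirrorE opprK. Qed.

Lemma Sfun_mirror a (i : int) : Sfun i (mirror a) = Sfun (- i - 1) a.
Proof.
rewrite /Sfun !mirrorE addnC; congr (_ + _)%N; congr (fun_of_fsfun _ _); lia.
Qed.

Lemma Lfun_mirror a (i : int) : Lfun i (mirror a) = Lfun (- i - 1) a.
Proof.
have H (x y z t x' y' z' t' : nat) : x = t' -> y = z' -> z = y' -> t = x' ->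
  (x + 2 * y + 2 * z + t = x' + 2 * y' + 2 * z' + t')%N by lia.
by rewrite /Lfun !mirrorE; apply: H; congr (fun_of_fsfun _ _); lia.
Qed.

Lemma Tri_mirror a (i : int) : Tri i (mirror a) = Tri (- i - 2) a.
Proof.
have H (x y z x' y' z' : nat) : x = z' -> y = y' -> z = x' -> (x + y + z = x' + y' + z')%N by lia.
by rewrite /Tri !mirrorE; apply: H; congr (fun_of_fsfun _ _); lia.
Qed.

Lemma mirror_C k l a : C k l a -> C k l (mirror a).
Proof.
move=> Ca; apply: C_intro => i.
- by rewrite Tri_mirror; exact: C_Tri Ca _.
- by rewrite Sfun_mirror; exact: C_Sfun Ca _.
- by rewrite Lfun_mirror; exact: C_Lfun Ca _.
Qed.

Lemma sat_mirror k l a (i : int) : sat k l (mirror a) i <-> sat k l a (- i - 1).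
Proof. by rewrite /sat Sfun_mirror Lfun_mirror. Qed.

Lemma first_mirror k l a (j : int) : is_first k l (mirror a) j <-> is_last k l a (- j - 1).
Proof.
split=> -[h1 h2]; split; [exact/sat_mirror| |exact/sat_mirror|].
  move=> i hi si; apply: (h2 (- i - 1)); first lia.
  by apply/sat_mirror; rewrite (_ : - (- i - 1) - 1 = i) //; lia.
by move=> i hi /sat_mirror si; apply: (h2 (- i - 1)) => //; lia.
Qed.

Lemma last_mirror k l a (j : int) : is_last k l (mirror a) j <-> is_first k l a (- j - 1).
Proof.
rewrite -{2}(mirrorK a) first_mirror.
by rewrite (_ : - (- j - 1) - 1 = j) //; lia.
Qed.

Lemma lmv_mirror (j : int) a : lmv j (mirror a) = mirror (rmv (- j - 1) a).
Proof.
apply/fsfunP => i; rewrite mirrorE lmvE rmvE !mirrorE.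
case: (eqVneq i j) => [->|n1].
  rewrite ifF; last lia. rewrite ifT; last lia. congr (_ _).+1; lia.
case: (eqVneq i (j+1)) => [->|n2].
  rewrite ifT; last lia. congr (_ _).-1; lia.
by rewrite !ifF //; lia.
Qed.

Definition erase_ge (i : int) (a : config) : config := mirror (erase_le (- i) (mirror a)).
Lemma erase_geE (i : int) a (j : int) : erase_ge i a j = if i <= j then 0%N else a j.
Proof. by rewrite /erase_ge mirrorE erase_leE mirrorE opprK lerN2. Qed.

(** * Order of the riggings *)

Section Pair.
Variables (k l : nat).
Hypotheses (l0 : (0 < l)%N) (lk : (l <= k)%N).

Definition last_two a (i u : int) := is_last k l a i /\ is_last k l (erase_ge i a) u.

Lemma last_two_mirror a (i u : int) : last_two a i u <->
  is_first k l (mirror a) (- i - 1) /\ is_first k l (erase_le ((- i - 1) + 1) (mirror a)) (- u - 1).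
Proof.
rewrite /last_two first_mirror /erase_ge last_mirror.
rewrite (_ : - (- i - 1) - 1 = i); last lia.
by rewrite (_ : - i - 1 + 1 = - i); last lia.
Qed.

(** The mirror image of [lmv_next_C], [positions_lmv_head] and [positions_lmv] for the first
two positions. *)
Lemma last_two_step a (i u : int) : C k l a -> last_two a i u ->
  [/\ C k l (rmv i a), C k l (rmv u (rmv i a)), u + 2 <= i &
      exists i' u' : int, [/\ last_two (rmv i a) i' u, u + 2 <= i' & last_two (rmv u (rmv i a)) i'
        u']].
Proof.
move=> Ca h; have [hi hu] := h; have hc := rmv_last_C Ca hi.
move/last_two_mirror: h; set A := mirror a; set j := - i - 1; set j1 := - u - 1 => -[hj hj1].
have CA : C k l A := mirror_C Ca; have aj := first_entry CA hj.
have [js hjs] := positions_ex l0 lk (eraseC (j+1) CA).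
case: js hjs => [/(_ _ hj1.1)//|j2 js hp]; have e : j2 = j1 by case: hp => h2 _;
  apply: first_uniq h2 hj1.
subst j2; have {}hp : positions k l A (j :: j1 :: js) by [].
have CB := lmv_first_C CA hj; have CD := lmv_next_C l0 lk CA CB aj hj1.
have [j' hj'] := positions_lmv_head l0 lk CA hp.
have [j1' hj1'] := positions_lmv l0 lk (pre := [:: j']) CB CD hj'.
have eB : lmv j A = mirror (rmv i a) by rewrite /A lmv_mirror (_ : - j - 1 = i) //; rewrite /j; lia.
have eD : lmv j1 (lmv j A) = mirror (rmv u (rmv i a)) by rewrite eB lmv_mirror (_ : - j1 - 1 = u)
  //; rewrite /j1; lia.
rewrite eB in hj'; rewrite eD in hj1' CD.
have E (x : int) : - (- x - 1) - 1 = x by lia.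
split=> //; first by rewrite -(mirrorK (rmv u _)); apply: mirror_C.
  by have := (positions_ge l0 lk CA hp (mem_head _ _)).1; rewrite /j /j1; lia.
exists (- j' - 1), (- j1' - 1); split.
- by apply/last_two_mirror; rewrite !E; case: hj' => h1 [h2 _].
- by rewrite -eB in hj'; have := (positions_ge l0 lk CB hj' (mem_head _ _)).1; rewrite /j1; lia.
- by apply/last_two_mirror; rewrite !E; case: hj1' => h1 [h2 _].
Qed.

Definition has_two a := C k l a /\ exists i u : int, last_two a i u.
Definition second_last a : int := last_pos k l (erase_ge (last_pos k l a) a).
Definition move_two a := rmv (second_last a) (Mplus k l a).

Lemma last_twoE a (i u : int) : last_two a i u -> last_pos k l a = i /\ second_last a = u.
Proof. by move=> [h1 h2]; rewrite /second_last (last_posE h1) (last_posE h2). Qed.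

Lemma rmv_rmv (i u : int) (a : config) : u + 2 <= i -> rmv i (rmv u a) = rmv u (rmv i a).
Proof.
move=> h; apply/fsfunP => j; have [e|[e|[e|[e|e]]]] : j = i \/ j = i + 1 \/ j = u \/ j = u + 1 \/
  (j < u \/ u + 1 < j) /\ (j < i \/ i + 1 < j) by lia.
- by rewrite e [RHS]rmv_id ?rmv_at ?[in LHS]rmv_id //; right; lia.
- by rewrite e [RHS]rmv_id ?rmv_at1 ?[in LHS]rmv_id //; right; lia.
- by rewrite e [LHS]rmv_id ?rmv_at ?[in RHS]rmv_id //; left; lia.
- by rewrite e [LHS]rmv_id ?rmv_at1 ?[in RHS]rmv_id //; left; lia.
- by case: e => e1 e2; rewrite !rmv_id.
Qed.

(** Moving the last particle neither stops the second last one nor changes its position,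
and the two moves commute. *)
Lemma has_two_step a : has_two a -> [/\ has_two (Mplus k l a), has_two (move_two a),
    second_last (Mplus k l a) = second_last a &
  Mplus k l (move_two a) = rmv (second_last a) (Mplus k l (Mplus k l a))].
Proof.
move=> [Ca [i [u h]]]; have [ei eu] := last_twoE h.
have [h1 h2 h3 [i' [u' [h4 h5 h6]]]] := last_two_step Ca h.
have eM : Mplus k l a = rmv i a by rewrite (MplusE h.1).
have eG : move_two a = rmv u (rmv i a) by rewrite /move_two eM eu.
rewrite eM eG; split.
- by split=> //; exists i', u.
- by split=> //; exists i', u'.
- by rewrite eu; case: (last_twoE h4).
- by rewrite (MplusE h6.1) (MplusE h4.1) eu; apply: rmv_rmv.
Qed.

Lemma iter_has_two a t : has_two a -> has_two (iter t (Mplus k l) a).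
Proof. by move=> h; elim: t => //= t /has_two_step []. Qed.

(** Moving both particles once and then the last one [t] times is the same as moving the
last one [t + 1] times and the second last one once. *)
Lemma iter_Mplus_move_two a t : has_two a -> iter t (Mplus k l) (move_two a) = rmv (second_last
    (iter t.+1 (Mplus k l) a)) (iter t.+1 (Mplus k l) a).
Proof.
move=> h; elim: t => [|t IH] /=; first by have [_ _ -> _] := has_two_step h.
rewrite IH /=; have hb := iter_has_two t h; have [h1 _ e1 e2] := has_two_step hb.
have [h3 _ e3 _] := has_two_step h1.
by rewrite e1 e3 e1 -e2 /move_two.
Qed.

Lemma free_erase_ge b (i : int) : has_free k l b i -> erase_ge i b = clear2 i b.
Proof.
move=> /(has_freeP l0 lk) [_ _ _ h]; apply/fsfunP => j; rewrite erase_geE clear2E.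
case: (ltP j i) => hj; first by rewrite ifF //; lia.
by case: ifP => // hh; rewrite h //; lia.
Qed.

Lemma last_two_free b (i u : int) : has_free k l b i -> is_last k l (clear2 i b) u ->
    last_two b i u.
Proof. by move=> h hu; split; [apply: free_last h|rewrite (free_erase_ge h)]. Qed.

(** The [t] simultaneous moves amount to [t] moves of the last particle, which set it free,
and then [t] right moves of the rest.  Both particles are thus made free inside one
admissible configuration. *)
Lemma iter_move_two_free t a (i : int) : has_two a -> let b := iter t (Mplus k l) a in has_free k l
    b i -> Cunder k l (clear2 i b) ->
  let g := iter t move_two a in [/\ has_free k l g i, g i = b i & clear2 i g = iter t (Mplus k l)
    (clear2 i b)].
Proof.
elim: t a => [|t IH] a ha b hb hx; first by [].
have [u hu] := Cunder_last l0 hx.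
have ha' : has_two (move_two a) by case: (has_two_step ha).
have e := iter_Mplus_move_two t ha; rewrite -/b in e.
have [_ e2] := last_twoE (last_two_free hb hu); rewrite e2 in e.
have Cb' : C k l (rmv u b) by rewrite -e; case: (iter_has_two t ha').
have [f1 f2 f3] := free_rmv_second l0 lk hb hu Cb'.
rewrite -e in f1 f2 f3; rewrite -(MplusE hu) in f3.
have [|g1 g2 g3] := IH _ ha' f1; first by rewrite f3; apply: Mplus_Cunder.
rewrite iterSr /=; split=> //; first by rewrite g2.
by rewrite g3 f3 -iterSr.
Qed.

(** If there were only one position, in the mirror image, the right moves would preserve
this; but after [t] moves the free particle and a saturated column of the rest give two. *)
Lemma has_two_free a t (i : int) : Cunder k l a -> has_free k l (iter t (Mplus k l) a) i ->
  Cunder k l (clear2 i (iter t (Mplus k l) a)) -> has_two a.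
Proof.
move=> ha hb hx; split; first by case: ha.
have [j hj] := Cunder_last l0 ha.
have hjr : is_first k l (mirror a) (- j - 1) by apply/first_mirror;
  rewrite (_ : - (- j - 1) - 1 = j) //; lia.
have [js hjs] := positions_ex l0 lk (eraseC ((- j - 1) + 1) (mirror_C ha.1)).
case: js hjs => [h|j1 js [h _]]; last first.
  by exists j, (- j1 - 1); apply/last_two_mirror; split=> //;
    rewrite (_ : - (- j1 - 1) - 1 = j1) //; lia.
exfalso; have {}h : positions k l (mirror a) [:: - j - 1] by [].
have [j' hj'] : exists j', positions k l (mirror (iter t (Mplus k l) a)) [:: j'].
  elim: t {hb hx} => [|t [j' hp]] /=; first by exists (- j - 1).
  have hc := iter_Mplus_Cunder t l0 ha.
  have [j'' hp2] := positions_lmv_head l0 lk (mirror_C hc.1) hp.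
  exists j''; have hl := hp.1; rewrite first_mirror in hl; rewrite (MplusE hl).
  by rewrite -lmv_mirror.
have [u hu] := Cunder_last l0 hx.
have /last_two_mirror [h1 h2] := last_two_free hb hu.
by have e := first_uniq h1 hj'.1; rewrite e in h2; apply: (hj'.2 _ h2.1).
Qed.

(** By [iter_move_two_free] both particles become free in a common admissible configuration,
in which [free_gap] compares their energies. *)
Lemma strip_order a s1 s2 x x2 : Cunder k l a -> strip k l a = (s1, x) -> Cunder k l x ->
    strip k l x = (s2, x2) ->
  s2 + (Acoef k l l)%:Z <= s1.
Proof.
move=> ha + hx; have [t [i [f ->]]] := strip_ex l0 lk ha => -[<- ex].
have [n [i2 [f2 ->]]] := strip_ex l0 lk hx => -[<- _].
have hx' : Cunder k l (clear2 i (iter t (Mplus k l) a)) by rewrite ex.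
have ga := has_two_free ha f hx'.
have [i' [g1 e1 c1 _]] := free_iter l0 lk n f; have [i2' [g2 e2 _ _]] := free_iter l0 lk t f2.
rewrite -iterD in g1 e1 c1; rewrite -iterD in g2 e2; rewrite ex in c1.
have [|h1 h2 h3] := iter_move_two_free ga g1; first by rewrite c1.
rewrite c1 in h3; rewrite [(t + n)%N]addnC in g2 e2; rewrite -h3 in g2 e2;
  have := free_gap l0 lk h1 g2; rewrite h2. lia.
Qed.

End Pair.

Lemma Asum_cons k l p r : Asum k l (p :: r) = (Acoef k l p.1)%:Z + Asum k l r.
Proof. by rewrite /Asum big_cons. Qed.

(** The parts decrease because stripping a particle of weight [l] leaves a configuration of
[C k l]; for equal parts the difference [Acoef k l l] in [strip_order] is the additional
term of [Asum] in the first rigging. *)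
Lemma iota_R k l a : (l <= k)%N -> C k l a -> R l (iota_map k a).
Proof.
have [n hn] := ex_intro (fun n => (mass a < n)%N) _ (ltnSn (mass a)).
elim: n l a hn => // n IH l' a hn hlk Ca.
have [->|ha] := pselect (a = config0); first by rewrite iota0; split.
have [l [hl hc]] := weight_ex Ca ha.
have l0 : (0 < l)%N by lia. have lk : (l <= k)%N by lia.
have hl2 : (0 < l <= k)%N by lia.
case es : (strip k l a) => [s x]; rewrite (iota_cons hl2 hc es).
have [Cx hm] := strip_C l0 lk hc es.
have [hr hh] : R l (iota_map k x) by apply: IH => //; lia.
split; last by rewrite /=; lia.
case er : (iota_map k x) hr hh => [|[l1 r1] r] hr hh; first by rewrite /is_rigged /= l0.
move: hr; rewrite /is_rigged /= l0 /= => /and3P [h1 h2 h3]; rewrite h1 h2 h3 /= in hh *.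
rewrite andbT; have -> /= : (l1 <= l)%N by [].
rewrite andbT; apply/implyP => /eqP el; subst l1.
have hx : x <> config0 by move=> e; rewrite e iota0 in er.
have [l1 [hl1 hc1]] := weight_ex Cx hx.
have hl12 : (0 < l1 <= k)%N by lia.
case es1 : (strip k l1 x) => [s1 x1].
have := iota_cons hl12 hc1 es1; rewrite er => -[e1 e2 e3]; subst l1.
have := strip_order l0 lk hc es hc1 es1; rewrite Asum_cons /= -e3 in e2 *; lia.
Qed.

(** * Left moves commute with right moves *)

Section Commute.
Variables (k l : nat).
Hypotheses (l0 : (0 < l)%N) (lk : (l <= k)%N).

(** With at least two positions, the particle that is moved right is not the first one. *)
Lemma last_erase a (p i : int) js : C k l a -> positions k l a (p :: js) -> js <> [::] ->
    is_last k l a i ->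
  [/\ is_last k l (erase_le (p+1) a) i, p + 2 <= i & (i = p + 2 -> Sfun i a = l)].
Proof.
move=> Ca [hf hp] hjs hi; have ap := first_entry Ca hf.
have Cr := eraseC (p+1) Ca.
case: js hp hjs => // j js [hj _] _.
have [i' hi'] := last_ex l0 hj.1.
have [h1 h2] := sat_erase_ge l0 lk Ca ap hi'.1.
have si' := erase_sat Ca hi'.1.
have hle : i' <= i by rewrite leNgt; apply/negP => h; exact: (hi.2 i').
suff e : i' = i by subst i'.
apply: contrapT => ne; apply: (hi'.2 i); first lia.
have E (x : int) : p + 2 <= x -> erase_le (p + 1) a x = a x by move=> h; rewrite erase_leE ifF //;
  lia.
by move: hi.1; rewrite /sat /Sfun /Lfun !E //; lia.
Qed.

(** By [satL_next], saturation of [Lfun] alone would make [p - 1] an earlier saturated column. *)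
Lemma first_next_S a (p : int) : C k l a -> is_first k l a p -> Sfun (p+2) a = l -> Sfun p a = l.
Proof.
move=> Ca [[//|hL] hp] hS; have := satL_next Ca hL hS; have := unsatS Ca (hp (p-1) (ltac:(lia)));
  lia.
Qed.

(** The greedy choice from the left and the choice of [Mplus] from the right may pick
different columns [j <= i < j + 3] of the same last particle; after the move both
pick [i]. *)
Lemma positions_rmv_last a js (j i : int) : C k l a -> positions k l a (rcons js j) ->
    is_last k l a i ->
  positions k l (rmv i a) (rcons js i).
Proof.
elim: js a => [|p js IH] a Ca hp hi.
  have [hf hu] := hp; have ai := last_entry Ca hi; have Cb := rmv_last_C Ca hi.
  have aj := first_entry Ca hf.
  have ij : j <= i by rewrite leNgt; apply/negP => h; exact: (hi.2 j h hf.1).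
  have HS (x : int) := Sfun_rmv x ai; have HL (x : int) := Lfun_rmv x ai.
  have E (x : int) : j + 2 <= x -> erase_le (j + 1) a x = a x by move=> h;
    rewrite erase_leE ifF //; lia.
  have ij2 : i < j + 3.
    rewrite ltNge; apply/negP => h; apply: (hu i); move: hi.1; rewrite /sat /Sfun /Lfun !E //; lia.
  have hf' : is_first k l (rmv i a) i.
    split; first by apply/rmv_sat => //; case: hi.
    move=> x hx sx; have CSx := C_Sfun Ca x; have CLx := C_Lfun Ca x.
    have [h|h] : x < j \/ j <= x by lia.
      by apply: (hf.2 x h); move: sx (HS x) (HL x); rewrite /sat; lia.
    have [e|ne] : x = i - 2 \/ i - 2 < x by lia.
      have S0 : Sfun x a = l by move: sx (HS x) (HL x); rewrite /sat; lia.
      have S1 : Sfun i a <> l.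
        by move=> S1; apply: (hu i); left; rewrite -S1 /Sfun !E //; lia.
      case: hi => -[//|hL] hi2; rewrite e in S0.
      have := unsatS Ca (hi2 (i+1) (ltac:(lia))); have := satL_prev Ca hL S0; lia.
    by move: sx (HS x) (HL x); rewrite /sat; lia.
  split=> //= x sx; have [h1 h2] := sat_erase_ge l0 lk Cb (first_entry Cb hf') sx.
  have sbx := erase_sat Cb sx.
  have hx : ~ sat k l a x by apply: hi.2; lia.
  have e : x = i + 2 by move: hx sbx (HS x) (HL x); rewrite /sat; lia.
  by apply: hx; left; have := h2 e; have := HS x; rewrite e; lia.
rewrite rcons_cons in hp.
have [h1 h2 h3] := last_erase Ca hp (ltac:(by case: (js))) hi.
have ai := last_entry Ca hi.
have [hf hp'] := hp.
have HS (x : int) := Sfun_rmv x ai; have HL (x : int) := Lfun_rmv x ai.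
rewrite rcons_cons; split; last by rewrite erase_rmv_lt; [apply: IH => //; apply: eraseC|lia].
split; last first.
  by move=> x hx sx; apply: (hf.2 x hx); have := C_Sfun Ca x; have := C_Lfun Ca x;
    move: sx (HS x) (HL x); rewrite /sat; lia.
have [e|ne] : i = p + 2 \/ p + 3 <= i by lia.
  have hS := h3 e; rewrite e in hS; have hh := first_next_S Ca hf hS; left; have := HS p; lia.
by have := hf.1; have := HS p; have := HL p; rewrite /sat; lia.
Qed.

Lemma rmv_lmv (i j : int) (a : config) : j + 2 <= i -> rmv i (lmv j a) = lmv j (rmv i a).
Proof.
move=> h; apply/fsfunP => x; have [e|[e|[e|[e|e]]]] : x = i \/ x = i + 1 \/ x = j \/ x = j + 1 \/
  (x < j \/ j + 1 < x) /\ (x < i \/ i + 1 < x) by lia.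
- by rewrite e [RHS]lmv_id ?rmv_at ?[in LHS]lmv_id //; right; lia.
- by rewrite e [RHS]lmv_id ?rmv_at1 ?[in LHS]lmv_id //; right; lia.
- by rewrite e [LHS]rmv_id ?lmv_at ?[in RHS]rmv_id //; left; lia.
- by rewrite e [LHS]rmv_id ?lmv_at1 ?[in RHS]rmv_id //; left; lia.
- by case: e => e1 e2; rewrite rmv_id // lmv_id // lmv_id // rmv_id.
Qed.

Lemma Cunder_positions a js : C k l a -> positions k l a js -> js <> [::] -> Cunder k l a.
Proof. by case: js => // j js Ca [[sj _] _] _; apply/(CunderE k a l0); split=> //; exists j. Qed.

Lemma positions_last_ge a js (j i u : int) : C k l a -> positions k l a (rcons js j) ->
    is_last k l a i -> u \in js -> u + 2 <= i.
Proof.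
elim: js a => // p js IH a Ca hp hi; rewrite rcons_cons in hp.
have [h1 h2 h3] := last_erase Ca hp (ltac:(by case: (js))) hi.
rewrite inE => /orP [/eqP -> //|hu].
by apply: (IH _ (eraseC (p+1) Ca) _ h1 hu); case: hp.
Qed.

Lemma rmv_lmvs a js (i : int) : (forall u, u \in js -> u + 2 <= i) ->
    rmv i (lmvs a js) = lmvs (rmv i a) js.
Proof.
elim: js a => //= j js IH a h; rewrite IH; last by move=> u hu; apply: h; rewrite inE hu orbT.
by rewrite rmv_lmv //; apply: h; rewrite mem_head.
Qed.

(** The last saturated column [i] is at distance at least 2 from [j], and at distance 2 it is
saturated through [Sfun], which the move leaves unchanged there. *)
Lemma last_lmv a pre js (j j1 i : int) : C k l a -> C k l (lmv j a) ->
    positions k l a (pre ++ j :: rcons js j1) -> is_last k l a i ->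
  is_last k l (lmv j a) i.
Proof.
move=> Ca Cb hp hi.
have jin : j \in pre ++ j :: rcons js j1 by rewrite mem_cat inE eqxx orbT.
have [sj aj] := positions_mem Ca hp jin.
have HS (x : int) := Sfun_lmv x aj; have HL (x : int) := Lfun_lmv x aj.
have hpe : pre ++ j :: rcons js j1 = rcons (pre ++ j :: js) j1 by rewrite -cat_rcons -!cats1 -!catA.
have ji : j + 2 <= i.
  by rewrite hpe in hp; apply: (positions_last_ge Ca hp hi); rewrite mem_cat inE eqxx orbT.
have hS : i = j + 2 -> Sfun i a = l.
  move=> e; have hr := positions_erase l0 lk Ca hp.
  have Cr := eraseC (j+1) Ca.
  have [y hy] : exists y : int, y \in rcons js j1 by exists j1; rewrite mem_rcons mem_head.
  have [sy _] := positions_mem Cr hr hy.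
  have [h1 h2] := sat_erase_ge l0 lk Ca aj sy.
  have yi : y <= i by rewrite leNgt; apply/negP => h; apply: (hi.2 y h); apply: erase_sat sy.
  have ey : y = j + 2 by lia.
  by have := h2 ey; rewrite ey e.
split.
  have := HS i; have := HL i; have := hi.1; rewrite /sat.
  have [e|ne] : i = j + 2 \/ j + 3 <= i by lia.
    by have := hS e; lia.
  lia.
move=> x hx sx; apply: (hi.2 x hx); have := HS x; have := HL x; have := C_Sfun Ca x;
  have := C_Lfun Ca x; move: sx; rewrite /sat; lia.
Qed.

Lemma lmvs_last js a pre (j i : int) : C k l a -> positions k l a (pre ++ js ++ [:: j]) ->
    next_ok k l a (js ++ [:: j]) -> is_last k l a i ->
  is_last k l (lmvs a js) i.
Proof.
elim: js a pre => //= p js IH a pre Ca hp hn hi.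
have hp2 : positions k l a (pre ++ p :: rcons js j) by rewrite -cats1.
have [p' hp'] := positions_lmv l0 lk Ca hn hp2.
have [||h1 _ h3 _] := @lmvs_chain k l l0 lk (rcons js j) [:: p] a pre Ca; [by []|by []|].
apply: (IH _ (rcons pre p')) => //; first by rewrite cat_rcons cats1.
  by rewrite cats1.
exact: (last_lmv Ca hn hp2).
Qed.

Lemma Mminus_all_Mplus a js (j : int) : C k l a -> positions k l a (rcons js j) ->
  Mplus k l (Mminus_all k l (size js) a) = Mminus_all k l (size js) (Mplus k l a).
Proof.
move=> Ca hp; have hp1 : positions k l a (js ++ [:: j]) by rewrite cats1.
have hc := Cunder_positions Ca hp (ltac:(by case: (js))); have [i hi] := Cunder_last l0 hc.
have [-> h2 h3 h4] := Mminus_allE l0 lk Ca hp1.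
have hp2 := positions_rmv_last Ca hp hi; rewrite -cats1 in hp2.
rewrite (MplusE hi); have [-> _ _ _] := Mminus_allE l0 lk (rmv_last_C Ca hi) hp2.
rewrite (MplusE (i := i)); last by apply: (@lmvs_last js a [::] j) => //; apply: positions_next_ok.
by apply: rmv_lmvs => u hu; apply: positions_last_ge hp hi hu.
Qed.

(** The last of the left moves is undone by the right move. *)
Lemma Mplus_Mminus_all a js (j : int) : C k l a -> positions k l a (rcons js j) ->
  Mplus k l (Mminus_all k l (size js).+1 a) = Mminus_all k l (size js) a.
Proof.
move=> Ca hp; have hp1 : positions k l a (js ++ [:: j]) by rewrite cats1.
have [e1 h2 [pre' [h3 h4]] h5] := Mminus_allE l0 lk Ca hp1.
have hp2 : positions k l a (rcons js j ++ [::]) by rewrite cats0.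
have [e2 g2 _ _] := Mminus_allE l0 lk Ca hp2.
rewrite size_rcons in e2 g2; rewrite e2 e1 /lmvs -cats1 foldl_cat /= -/(lmvs a js) -e1.
exact: Mplus_lmv h4.
Qed.

Lemma iter_positions a js (j : int) t : C k l a -> positions k l a (rcons js j) ->
  C k l (iter t (Mplus k l) a) /\ exists j' : int, positions k l (iter t (Mplus k l) a) (rcons js
    j').
Proof.
move=> Ca hp; elim: t => [|t [h1 [j' h2]]] /=; first by split=> //; exists j.
have hc := Cunder_positions h1 h2 (ltac:(by case: (js))); have [i hi] := Cunder_last l0 hc.
rewrite (MplusE hi); split; first exact: rmv_last_C hi.
by exists i; exact: positions_rmv_last h2 hi.
Qed.

Lemma iter_Mplus_Mminus a js (j : int) t : C k l a -> positions k l a (rcons js j) ->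
  iter t (Mplus k l) (Mminus_all k l (size js) a) = Mminus_all k l (size js) (iter t (Mplus k l) a).
Proof.
move=> Ca hp; elim: t => //= t ->; have [h1 [j' h2]] := iter_positions t Ca hp.
exact: Mminus_all_Mplus h1 h2.
Qed.

Lemma free_erase b (p i : int) : has_free k l b i -> p + 1 < i -> has_free k l (erase_le (p+1) b) i.
Proof.
move=> /(has_freeP l0 lk) [h1 h2 h3 h4] hp; apply/(has_freeP l0 lk); split.
- exact: eraseC.
- by rewrite -h2 /Sfun !erase_leE !ifF //; lia.
- by rewrite erase_leE ifF //; lia.
- by move=> j hj; rewrite erase_leE h4 // if_same.
Qed.

Lemma erase_clear2 (p i : int) (b : config) : erase_le p (clear2 i b) = clear2 i (erase_le p b).
Proof. by apply/fsfunP => x; rewrite erase_leE !clear2E erase_leE; do 2 case: ifP. Qed.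

(** Erasing from the left and removing the last free particle commute, so that exactly the
last entry disappears. *)
Lemma positions_clear2 b js (j i : int) : has_free k l b i -> positions k l b (rcons js j) ->
    positions k l (clear2 i b) js.
Proof.
elim: js b => [|p js IH] b hb hp; have [Cb bS bi bz] := (has_freeP l0 lk b i).1 hb;
  have hl := free_last l0 lk hb.
  move=> u su; have [h1 h2] := free_sat_ge l0 lk hb su.
  have sbu := sat_le (@clear2_le i b) Cb su.
  have [hf hu] := hp; have ju : j <= u by rewrite leNgt; apply/negP => h; exact: (hf.2 u h).
  by apply: (hu i); left; rewrite -bS /Sfun !erase_leE !ifF //; lia.
rewrite rcons_cons in hp.
have [h1 h2 h3] := last_erase Cb hp (ltac:(by case: (js))) hl.
have [hf hp'] := hp; rewrite /= erase_clear2; split; last by apply: IH hp';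
  apply: free_erase => //; lia.
have Cx := C_le (@clear2_le i b) Cb.
split; last by move=> u hu su; exact: (hf.2 u hu (sat_le (@clear2_le i b) Cb su)).
have E (x : int) : x < i -> clear2 i b x = b x by move=> h; rewrite clear2E ifF //; lia.
have [e|ne] : i = p + 2 \/ p + 3 <= i by lia.
  have hS := h3 e; rewrite e in hS; have hh := first_next_S Cb hf hS; left.
  by rewrite -hh /Sfun !E //; lia.
by have := hf.1; rewrite /sat /Sfun /Lfun !E //; lia.
Qed.

Lemma clear2_lmvs (i : int) js b : (forall u, u \in js -> u + 2 <= i) ->
    clear2 i (lmvs b js) = lmvs (clear2 i b) js.
Proof.
elim: js b => //= j js IH b h; rewrite IH; last by move=> u hu; apply: h; rewrite inE hu orbT.
have hj : j + 2 <= i by apply: h; rewrite mem_head.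
congr (lmvs _ _); apply/fsfunP => x; rewrite clear2E !lmvE !clear2E.
case: (eqVneq x j) => [->|n1]; first by rewrite !ifF; lia.
by case: (eqVneq x (j+1)) => [->|n2]; first by rewrite !ifF; lia.
Qed.

Lemma lmvs_ge js b (i x : int) : (forall u, u \in js -> u + 2 <= i) -> i <= x -> lmvs b js x = b x.
Proof.
elim: js b => //= j js IH b h hx; rewrite IH //; last by move=> u hu; apply: h; rewrite inE hu orbT.
have hj : j + 2 <= i by apply: h; rewrite mem_head.
by rewrite lmv_id //; lia.
Qed.

(** The left moves of the other particles take place left of the free particle. *)
Lemma Mminus_all_free b js (j i : int) : has_free k l b i -> positions k l b (rcons js j) ->
  let b' := Mminus_all k l (size js) b in
  [/\ has_free k l b' i, b' i = b i & clear2 i b' = Mminus_all k l (size js) (clear2 i b)].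
Proof.
move=> hb hp; have [Cb bS bi bz] := (has_freeP l0 lk b i).1 hb; have hl := free_last l0 lk hb.
have hp1 : positions k l b (js ++ [:: j]) by rewrite cats1.
have hx := positions_clear2 hb hp; have Cx := C_le (@clear2_le i b) Cb; rewrite -(cats0 js) in hx.
have [e1 h2 _ _] := Mminus_allE l0 lk Cb hp1; have [e2 _ _ _] := Mminus_allE l0 lk Cx hx.
have hu u : u \in js -> u + 2 <= i by move=> h; apply: positions_last_ge hp hl h.
have G (x : int) : i <= x -> lmvs b js x = b x by apply: lmvs_ge.
rewrite /= e2 e1; rewrite e1 in h2; split; last exact: clear2_lmvs.
- apply/(has_freeP l0 lk); split=> //.
  + by rewrite -bS /Sfun !G //; lia.
  + by rewrite G.
  + by move=> x hx'; rewrite G ?bz //; lia.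
- by rewrite G.
Qed.

(** After [t + 1] right moves the collective left move has become the collective left move
of all particles but the last one, which is free as after [t] moves in the original
configuration.  One move is lost, hence the energy minus time drops by 1. *)
Lemma strip_Mminus_all a js (j : int) s x : C k l a -> positions k l a (rcons js j) ->
    strip k l a = (s, x) ->
  strip k l (Mminus_all k l (size js).+1 a) = (s - 1, Mminus_all k l (size js) x) /\
    positions k l x js.
Proof.
move=> Ca hp; have hc := Cunder_positions Ca hp (ltac:(by case: (js))).
have [t [i [f ->]]] := strip_ex l0 lk hc => -[<- <-].
have [Cb [j' hb]] := iter_positions t Ca hp.
have [g1 g2 g3] := Mminus_all_free f hb.
have e : iter t.+1 (Mplus k l) (Mminus_all k l (size js).+1 a) = Mminus_all k l (size js) (iter t
  (Mplus k l) a).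
  by rewrite iterSr (Mplus_Mminus_all Ca hp) (iter_Mplus_Mminus t Ca hp).
split; last exact: positions_clear2 f hb.
rewrite -e in g1 g2 g3; rewrite (stripE l0 lk g1) g2 g3; congr (_, _); lia.
Qed.

End Commute.

(** * Effect of the collective left move on the riggings *)

Definition shift_rig (l : nat) (n : int) (r : rigged) : rigged := [seq if p.1 == l then (p.1,
    p.2 + n) else p | p <- r].

Lemma Asum_shift_rig k l' l n r : Asum k l' (shift_rig l n r) = Asum k l' r.
Proof. by rewrite /Asum /shift_rig big_map; apply: eq_bigr => p _; case: ifP. Qed.

Lemma shift_rig_add l m n r : shift_rig l m (shift_rig l n r) = shift_rig l (n + m) r.
Proof.
rewrite /shift_rig -map_comp; apply: eq_map => -[a b] /=; case e : (a == l) => /=; rewrite ?e //=.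
by rewrite -addrA.
Qed.

Lemma shift_rig_id l n r : all (fun p => p.1 != l) r -> shift_rig l n r = r.
Proof. by elim: r => //= p r IH /andP [/negbTE -> /IH ->]. Qed.

Lemma shift_rig0 l r : shift_rig l 0 r = r.
Proof. by rewrite /shift_rig -[RHS]map_id; apply: eq_map => -[a b] /=; case: ifP => // _;
  rewrite addr0. Qed.

Lemma rigged_cons p r : is_rigged (p :: r) -> is_rigged r.
Proof.
rewrite /is_rigged => /and3P [/= h1 /andP [_ h2] h3].
by rewrite (path_sorted h1) h2 (path_sorted h3).
Qed.

Lemma rigged_drop n r : is_rigged r -> is_rigged (drop n r).
Proof. by elim: n r => [|n IH] [|p r] // h; rewrite ?drop0 //=; apply: IH;
  apply: rigged_cons h. Qed.

Lemma rigged_le l p r : is_rigged (p :: r) -> (p.1 <= l)%N -> all (fun q => q.1 <= l)%N (p :: r).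
Proof.
elim: r p => [|q r IH] p h hp; first by rewrite /= hp.
have hq : (q.1 <= p.1)%N by move: h; rewrite /is_rigged /= => /and3P [/andP []].
rewrite -/(all _ (q :: r)) /= hp -/(all _ (q :: r)); apply: IH; first exact: rigged_cons h.
exact: leq_trans hp.
Qed.

Lemma R_le l r : R l r -> all (fun q => q.1 <= l)%N r.
Proof. by case: r => // p r [h1 h2]; apply: rigged_le. Qed.

Lemma rigged_split l r : R l r -> let m := count (pred1 l) (unzip1 r) in
  [/\ all (fun p => p.1 == l) (take m r), size (take m r) = m & all (fun p => p.1 < l)%N (drop m
    r)].
Proof.
move=> hR; have [hr _] := hR; have := R_le hR; elim: r hr {hR} => [|p r IH] hr //=.
move=> /andP [hp ha]; have hr' := rigged_cons hr; have [h1 h2 h3] := IH hr' ha.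
case: (eqVneq p.1 l) => [e|ne] /=; first by rewrite e eqxx add1n /= h1 h2 h3.
have hlt : (p.1 <= l.-1)%N by lia.
have := rigged_le hr hlt; move=> /= /andP [_ h4].
have -> : count (pred1 l) (unzip1 r) = 0%N.
  apply/eqP; rewrite -leqn0 leqNgt -has_count; apply/negP => /hasP [x /mapP [q hq ->]] /= /eqP e.
  by have := allP h4 q hq; rewrite e; lia.
rewrite take0 /= (_ : (p.1 < l)%N); last by lia.
by split=> //; apply: sub_all h4 => q /= hq; lia.
Qed.

Lemma R_lower l r : (0 < l)%N -> is_rigged r -> all (fun p => p.1 < l)%N r -> R l.-1 r.
Proof. by move=> l0 h1 h2; split=> //; case: r h1 h2 => //= p r _ /andP [h _]; lia. Qed.

Section Kappa.
Variables (k l : nat).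
Hypotheses (l0 : (0 < l)%N) (lk : (l <= k)%N).

Lemma iota_no_top a : C k l.-1 a -> all (fun p => p.1 < l)%N (iota_map k a).
Proof.
move=> Ca; have lk' : (l.-1 <= k)%N by lia.
by have := R_le (iota_R lk' Ca); apply: sub_all => q /= hq; lia.
Qed.

(** Iteration of [strip_Mminus_all] over the particles of weight [l].  The rest is a
configuration of [C k l.-1] and stays as it is. *)
Lemma iota_Mminus_all a js : C k l a -> positions k l a js ->
  iota_map k (Mminus_all k l (size js) a) = shift_rig l (- 1) (iota_map k a).
Proof.
have hl : (0 < l <= k)%N by rewrite l0.
elim/last_ind: js a => [|js j IH] a Ca hp.
  have h := iota_no_top (unsat_C l0 Ca hp).
  by rewrite shift_rig_id //; apply: sub_all h => q /= hq; lia.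
have hc := Cunder_positions l0 Ca hp (ltac:(by case: (js))).
case es : (strip k l a) => [s x]; have [h1 h2] := strip_Mminus_all l0 lk Ca hp es.
have [Cx _] := strip_C l0 lk hc es.
have hp2 : positions k l a (rcons js j ++ [::]) by rewrite cats0.
have [_ Cb [pre' [h3 h4]] _] := Mminus_allE l0 lk Ca hp2.
rewrite cats0 in h4; have hc2 : Cunder k l (Mminus_all k l (size (rcons js j)) a).
  by apply: (Cunder_positions l0 Cb h4) => e; rewrite e size_rcons in h3.
rewrite size_rcons in hc2 *.
rewrite (iota_cons hl hc es) (iota_cons hl hc2 h1) IH //= eqxx Asum_shift_rig; congr ((_, _) :: _);
  lia.
Qed.

Lemma iter_Mminus_all a js t : C k l a -> positions k l a js ->
  let b := iter t (Mminus_all k l (size js)) a in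
  [/\ C k l b, exists js', size js' = size js /\ positions k l b js' & iota_map k b = shift_rig l (-
    t%:Z) (iota_map k a)].
Proof.
move=> Ca hp /=; elim: t => [|t [h1 [js' [h2 h3]] h4]] /=.
  by split=> //; [exists js|rewrite shift_rig0].
rewrite -h2; have hp2 : positions k l (iter t (Mminus_all k l (size js')) a) (js' ++ [::]) by
  rewrite cats0 h2.
rewrite -h2 in h1 h3 h4; have [_ Cb [pre' [h5 h6]] _] := Mminus_allE l0 lk h1 hp2.
rewrite cats0 in h6; split=> //; first by (exists pre').
by rewrite iota_Mminus_all // h4 shift_rig_add; congr (shift_rig _ _ _); lia.
Qed.

(** The converse of [positions_clear2]. *)
Lemma positions_add_free b js (i : int) : has_free k l b i -> positions k l (clear2 i b) js ->
    exists j : int, positions k l b (rcons js j).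
Proof.
elim: js b => [|p js IH] b hb hp; have [Cb bS bi bz] := (has_freeP l0 lk b i).1 hb;
  have hl := free_last l0 lk hb;
have Cx := C_le (@clear2_le i b) Cb; have E (x : int) : x < i -> clear2 i b x = b x by (move=> h;
  rewrite clear2E ifF //; lia).
  have [j hj] := first_ex l0 hl.1; exists j; split=> //= u su.
  have bj := first_entry Cb hj; have [h1 h2] := sat_erase_ge l0 lk Cb bj su.
  have ui : u <= i by rewrite leNgt; apply/negP => h; apply: (hl.2 u h); apply: erase_sat su.
  have ej : j = i - 2.
    apply: contrapT => ne; apply: (hp j); move: hj.1; rewrite /sat /Sfun /Lfun !E //; lia.
  have eu : u = j + 2 by lia.
  have hS : Sfun (j + 2) b = l by rewrite -bS; congr (Sfun _ _); lia.
  apply: (hp j); left; rewrite /Sfun !E; [|lia|lia].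
  exact: first_next_S Cb hj hS.
have [hf hp'] := hp.
have xp := first_entry Cx hf.
have z (x : int) : i <= x -> clear2 i b x = 0%N.
  by move=> hx; rewrite clear2E; case: ifP => // h; apply: bz; lia.
have pi2 : p + 2 <= i by case: (free_sat_ge l0 lk hb hf.1).
have sp := sat_le (@clear2_le i b) Cb hf.1.
have hf2 : is_first k l b p.
  split=> // u hu su; apply: (hf.2 u hu); move: su; rewrite /sat /Sfun /Lfun !E //; lia.
rewrite erase_clear2 in hp'.
have [|j hj] := IH (erase_le (p + 1) b) _ hp'; first by apply: free_erase => //; lia.
by exists j; rewrite rcons_cons.
Qed.

(** * Free particles laid out to the right, and kappa *)

Lemma free_coordP (d : int) : let jc := free_coord l d in (0 < jc.2 <= l)%N /\
    energy l jc.1 jc.2 = d.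
Proof.
rewrite /free_coord; case: xgetP => [y _ hy //|].
have h := divz_eq d l%:Z; have h2 := ltz_pmod d (d := l%:Z) (ltac:(lia)).
have h3 := modz_ge0 d (d := l%:Z) (ltac:(lia)).
move: ((d %/ l)%Z) (d %% l)%Z h h2 h3 => q r h h2 h3.
have [n en] : exists n : nat, r = n%:Z by exists `|r|%N; lia.
move=> /(_ (q, l - n)%N) []; split=> /=; first by lia.
rewrite /energy; lia.
Qed.

Lemma particleE (d : int) : exists (j : int) c, [/\ (0 < c <= l)%N, energy l j c = d &
  forall x, particle l d x = if x == j then c else if x == j + 1 then (l - c)%N else 0%N].
Proof.
have := free_coordP d; rewrite /particle; case: (free_coord l d) => j c /= [h1 h2]; exists j, c;
  split=> // x.
by rewrite fsfun_withE /=; case: ifP => // _; rewrite fsfun_withE; case: ifP => // _;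
  rewrite config0E.
Qed.

Lemma addcE (a b : config) (i : int) : addc a b i = (a i + b i)%N.
Proof.
rewrite /addc fsfun_fun inE; case: (finsuppP a i) => h1 /=; last by [].
by case: (finsuppP b i).
Qed.

Section Join.
Variables (x : config) (q : int) (c : nat) (d : int) (y : config).
Hypotheses (Cx : C k l x) (hc : (0 < c <= l)%N) (he : energy l q c = d).
Hypothesis hy : forall j : int, y j = (x j + (if j == q then c else if j == (q + 1)%R then (l - c)
  else 0))%N.

Lemma join_free : C k l y -> (forall j : int, q <= j -> x j = 0%N) ->
    [/\ has_free k l y q, y q = c & clear2 q y = x].
Proof.
move=> Cy hz.
have yq : y q = c by rewrite hy eqxx hz.
have yq1 : y (q+1) = (l - c)%N by rewrite hy ifF ?eqxx ?hz //; lia.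
split=> //.
  apply/(has_freeP l0 lk); split=> //; [by rewrite /Sfun yq yq1; lia|by rewrite yq; lia|].
  by move=> j hj; rewrite hy hz ?ifF //; lia.
apply/fsfunP => j; rewrite clear2E; case: ifP => h; first by rewrite hz //; lia.
by rewrite hy !ifF ?addn0 //; lia.
Qed.

(** Columns at distance at least 4 do not interact. *)
Lemma join_far : (forall j : int, q - 3 <= j -> x j = 0%N) -> C k l y.
Proof.
move=> hz.
have D (i : int) : i < q -> y i = x i by move=> hi; rewrite hy !ifF ?addn0 //; lia.
have B (i : int) : q - 3 <= i -> y i = if i == q then c else if i == q + 1 then (l - c)%N else 0%N.
  by move=> hi; rewrite hy hz.
apply: C_intro => i; have [h|h] : i + 2 < q \/ q <= i + 2 by lia.
- by have := C_Tri Cx i; rewrite /Tri !D //; lia.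
- rewrite /Tri !B; [|lia..]; do ?[case: eqP => ?]; lia.
- by have := C_Sfun Cx i; rewrite /Sfun !D //; lia.
- rewrite /Sfun !B; [|lia..]; do ?[case: eqP => ?]; lia.
- by have := C_Lfun Cx i; rewrite /Lfun !D //; lia.
- rewrite /Lfun !B; [|lia..]; do ?[case: eqP => ?]; lia.
Qed.

(** The converse of [free_gap]: a free particle whose energy exceeds that of the last free
particle of [x] by [Acoef k l l] can be added. *)
Lemma join_near (q' : int) : has_free k l x q' -> energy l q' (x q') + (Acoef k l l)%:Z <= d ->
  C k l y /\ forall j : int, q <= j -> x j = 0%N.
Proof.
move=> /(has_freeP l0 lk) [_ xS xq xz] hd.
have hc' : (0 < x q' <= l)%N by move: xS; rewrite /Sfun; lia.
rewrite -he !(energyE l0 lk) in hd; [|lia|lia].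
have xq1 : x (q' + 1) = (l - x q')%N by move: xS; rewrite /Sfun; lia.
have hq : q' + 2 <= q.
  rewrite leNgt; apply/negP => h; have h2 : q + 1 <= q' + 2 by lia.
  have : (q + 1) * l%:Z <= (q' + 2) * l%:Z by apply: ler_wpM2r.
  rewrite /Acoef in hd; lia.
have zz (j : int) : q <= j -> x j = 0%N by move=> hj; apply: xz; lia.
split=> //.
have D (i : int) : i < q -> y i = x i by move=> hi; rewrite hy !ifF ?addn0 //; lia.
have yq : y q = c by rewrite hy eqxx zz.
have yq1 : y (q+1) = (l - c)%N by rewrite hy ifF ?eqxx ?zz //; lia.
have yz (j : int) : q + 2 <= j -> y j = 0%N by move=> hj; rewrite hy zz ?ifF //; lia.
have W (i : int) : q - 2 <= i <= q + 2 -> (Tri i y <= k)%N /\ (Sfun i y <= l)%N /\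
  (Lfun i y <= k + l)%N.
  move=> hi.
  have F : (x (q-1)%R + x (q-2)%R + c <= k)%N /\ (x (q-1)%R + c <= l)%N /\
    (x (q-3)%R + 2 * x (q-2)%R + 2 * x (q-1)%R + c <= k + l)%N /\
     (x (q-2)%R + 2 * x (q-1)%R + c + l <= k + l)%N /\ (x (q-1)%R + l <= k)%N.
    have [e|[e|[e|e]]] : q = q' + 2 \/ q = q' + 3 \/ q = q' + 4 \/ q' + 5 <= q by lia.
    - have hd' : (c + Acoef k l l <= 2 * l + x q')%N.
        by move: hd; rewrite e (_ : (q' + 2 + 1) * l%:Z = (q' + 1) * l%:Z + 2 * l%:Z); [lia|lia].
      move: hd' hc' xq1 (xz (q' + 2) (lexx _)) (C_Tri Cx (q'-1)) (C_Lfun Cx (q'-1)) (C_Lfun Cx q')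
        (C_Sfun Cx (q'-1)).
      rewrite e /Tri /Sfun /Lfun /Acoef; clear; idx q'; lia.
    - have hd' : (c + Acoef k l l <= 3 * l + x q')%N.
        by move: hd; rewrite e (_ : (q' + 3 + 1) * l%:Z = (q' + 1) * l%:Z + 3 * l%:Z); [lia|lia].
      move: hd' hc hc' xq1 (xz (q' + 2) (lexx _)) (xz (q' + 3) (ltac:(lia))).
      move: lk; rewrite e /Tri /Sfun /Lfun /Acoef; clear; idx q'; lia.
    - move: hc hc' xq1 (xz (q' + 2) (lexx _)) (xz (q' + 3) (ltac:(lia))).
      move: lk; rewrite e; clear; idx q'; lia.
    - by rewrite !xz; move: lk hc; lia.
  move: F (D (q-1) (ltac:(lia))) (D (q-2) (ltac:(lia))) (D (q-3) (ltac:(lia))) yq yq1 (yz (q+2)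
    (ltac:(lia))) (yz (q+3) (ltac:(lia))) lk hc (C_Sfun Cx (q-2)) (yz (q+4) (ltac:(lia))).
  have [->|[->|[->|[->|->]]]] : i = q - 2 \/ i = q - 1 \/ i = q \/ i = q + 1 \/ i = q + 2 by lia.
  - by rewrite /Tri /Sfun /Lfun; clear; idx q; lia.
  - by rewrite /Tri /Sfun /Lfun; clear; idx q; lia.
  - by rewrite /Tri /Sfun /Lfun; clear; idx q; lia.
  - by rewrite /Tri /Sfun /Lfun; clear; idx q; lia.
  - by rewrite /Tri /Sfun /Lfun; clear; idx q; lia.
have V (i : int) : i < q - 2 \/ q + 2 < i -> [/\ Tri i y <= Tri i x,
  Sfun i y <= Sfun i x & Lfun i y <= Lfun i x]%N.
  move=> [h|h]; rewrite /Tri /Sfun /Lfun; first by rewrite !D //; lia.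
  by split; rewrite !yz //; lia.
apply: C_intro => i; have [h|h] : q - 2 <= i <= q + 2 \/ (i < q - 2 \/ q + 2 < i) by lia.
- by have [] := W i h.
- by have [h1 _ _] := V i h; apply: leq_trans h1 (C_Tri Cx i).
- by have [_ []] := W i h.
- by have [_ h1 _] := V i h; apply: leq_trans h1 (C_Sfun Cx i).
- by have [_ []] := W i h.
- by have [_ _ h1] := V i h; apply: leq_trans h1 (C_Lfun Cx i).
Qed.

End Join.

(** The configuration from which the collective left moves start in [kappa_map]. *)
Definition juxtapose (x : config) (m : nat) (r : rigged) (t : nat) := addc x (a_free k l m r t).

Lemma juxtapose_cons x (p : nat * int) r m t (i : int) :
  juxtapose x m.+1 (p :: r) t i = (juxtapose x m r t i + particle l (p.2 + Asum k l r + t%:Z) i)%N.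
Proof.
rewrite /juxtapose !addcE -addnA /a_free big_nat_recl // addcE /s_of /= drop0; congr (_ + _)%N;
  exact: addnC.
Qed.

(** Induction from the particle of least energy upwards.  The first one is far from the
support of [x]; each further one has an energy larger by [Acoef k l l] at least, since the
riggings decrease and [Asum] has one more term.  Each added particle is free, so
[strip] reads off its energy directly. *)
Lemma juxtapose_spec r m : is_rigged r -> all (fun p => p.1 == l) (take m r) ->
    size (take m r) = m -> all (fun p => p.1 < l)%N (drop m r) ->
  forall x, C k l.-1 x -> iota_map k x = drop m r ->
  exists t0, forall t, (t0 <= t)%N -> [/\ C k l (juxtapose x m r t), exists js, size js = m /\
    positions k l (juxtapose x m r t) js,
    iota_map k (juxtapose x m r t) = shift_rig l t%:Z r &
    (0 < m)%N -> exists q : int, has_free k l (juxtapose x m r t) q /\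
      energy l q (juxtapose x m r t q) = s_of k l r 0 + t%:Z].
Proof.
have hl : (0 < l <= k)%N by rewrite l0.
elim: m r => [|m IH] r hr h1 h2 h3 x Cx hx.
  exists 0%N => t _; have e : juxtapose x 0 r t = x.
    by apply/fsfunP => i; rewrite /juxtapose addcE /a_free big_geq // config0E addn0.
  rewrite e; rewrite drop0 in h3 hx; split=> //; first by apply: C_mono_l Cx; lia.
    by exists [::]; split=> // i; apply: C_unsat Cx.
  by rewrite hx shift_rig_id //; apply: sub_all h3 => q /= hq; lia.
case: r hr h1 h2 h3 hx => // p r hr /= /andP [/eqP hp h1] [h2] h3 hx.
have hr' := rigged_cons hr.
have [t0 ht0] := IH r hr' h1 h2 h3 x Cx hx.
have [N hN] := supp_bound x.
pose d (t : nat) : int := p.2 + Asum k l r + t%:Z.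
exists (t0 + `|(p.2 + Asum k l r)%R| + (N + 4) * l)%N => t ht.
have [|C1 [js [hs hp1]] hi hf] := ht0 t; first by lia.
set y := juxtapose x m r t in C1 hp1 hi hf.
set z := juxtapose x m.+1 (p :: r) t.
have [q [c [hc he hq]]] := particleE (d t).
have hz (j : int) : z j = (y j + (if j == q then c else if j == (q + 1)%R then l - c else 0))%N.
  by rewrite /z juxtapose_cons hq.
have [Cz yz] : C k l z /\ forall j : int, q <= j -> y j = 0%N.
  case em : m => [|m'].
    have ey : y = x.
      by apply/fsfunP => i; rewrite /y /juxtapose em addcE /a_free big_geq // config0E addn0.
    have hqN : N%:Z + 4 <= q.
      rewrite leNgt; apply/negP => hlt; rewrite (energyE l0 lk) in he; last by lia.
      have : (q + 1) * l%:Z <= (N%:Z + 4) * l%:Z by apply: ler_wpM2r => //; lia.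
      rewrite /d in he; lia.
    have yz (j : int) : q - 3 <= j -> y j = 0%N by move=> hj; apply: contrapT; rewrite ey => /hN;
      lia.
    by split; [apply: (join_far C1 hc he hz yz)|move=> j hj; apply: yz; lia].
  have [|q' [hq' eq']] := hf; first by rewrite em.
  apply: (join_near C1 hc he hz hq'); rewrite eq' /d.
  case er : r h2 hr {hz hx hi h3} => [|p' r'] h2 hr; first by rewrite em in h2.
  have hp' : p'.1 = l by move: h1; rewrite er em /= => /andP [/eqP].
  rewrite /s_of /= drop0 Asum_cons hp'.
  have : (p'.2 <= p.2) by move: hr; rewrite /is_rigged /= hp hp' eqxx => /and3P [_ _ /andP []].
  lia.
have [f1 f2 f3] := join_free hc he hz Cz yz.
have fst : strip k l z = (energy l q (z q) - 0%:Z, clear2 q z) by apply: (@stripE k l l0 lk z 0 q).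
rewrite f2 he f3 subr0 in fst.
have hcu : Cunder k l z by case: f1.
split=> //.
- rewrite -f3 in hp1; have [j hj] := positions_add_free f1 hp1.
  by exists (rcons js j); rewrite size_rcons hs.
- rewrite (iota_cons hl hcu fst) hi /= hp eqxx Asum_shift_rig /d; congr ((_, _) :: _); lia.
- by move=> _; exists q; rewrite f2 he /s_of /= drop0.
Qed.

End Kappa.

(** By [juxtapose_spec] the free particles have the riggings of [r] raised by [t], and [t]
collective left moves lower them again.  All large [t] give the same configuration
because [iota_map] takes the same value [r] on all of them. *)
Lemma kappa_spec k l r : (l <= k)%N -> R l r -> C k l (kappa_map k l r) /\
    iota_map k (kappa_map k l r) = r.
Proof.
elim: l r => [|l IH] r hlk hR.
  case: r hR => [|p r] [h1 h2]; first by rewrite /= iota0; split=> //; apply: C_config0.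
  by move: h1; rewrite /is_rigged /= => /and3P [_ /andP [h3 _] _]; move: h2 => /=; lia.
have [h1 h2 h3] := rigged_split hR; rewrite /=; set m := count _ _ in h1 h2 h3 *.
have hd : R l (drop m r) by apply: (@R_lower l.+1) => //; apply: rigged_drop; case: hR.
have [Cx hx] := IH _ (ltnW hlk) hd.
case: eqP => hm.
  by rewrite hm drop0 in Cx hx; split=> //; apply: C_mono_l Cx.
have [t0 ht0] := juxtapose_spec (ltn0Sn l) hlk hR.1 h1 h2 h3 Cx hx.
pose b t := iter t (Mminus_all k l.+1 m) (addc (kappa_map k l (drop m r)) (a_free k l.+1 m r t)).
have hb t : (t0 <= t)%N -> C k l.+1 (b t) /\ iota_map k (b t) = r.
  move=> ht; have [C1 [js [hs hp]] hi _] := ht0 t ht.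
  have [C2 _ e] := iter_Mminus_all (ltn0Sn l) hlk t C1 hp.
  rewrite hs hi shift_rig_add addrN shift_rig0 in C2 e; split; [exact: C2|exact: e].
suff -> : eventual config0 (fun t x => x = b t) = b t0 by apply: hb.
have he t : (t0 <= t)%N -> b t = b t0.
  move=> ht; have [C1 e1] := hb t ht; have [C2 e2] := hb t0 (leqnn _).
  by apply: (iota_inj (k := k)); [apply: C_mono_l C1|apply: C_mono_l C2|rewrite e1 e2].
rewrite /eventual; case: xgetP => [y _ [t1 hy]|/(_ (b t0)) []].
  by rewrite (hy _ (leq_maxr t0 t1)) he // leq_maxl.
by exists t0 => t /he.
Qed.

(** * Deficits of the flux through a background *)

(** [h e] is the deficit at the edge between the columns [e] and [e + 1] of a particle of
weight [l] that crosses [x] from right to left.  When the flux [l - h e] has arrived in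
column [e], and nothing has left it yet, column [e - 1] or [e - 2] is saturated: the three terms are
the bounds for [Sfun (e - 1)], [Lfun (e - 2)] and [Lfun (e - 1)], where the last one also
feels the flux across the edge [e + 1]. *)
Definition hole (k l : nat) (x h : config) : Prop := forall e : int,
  h e = maxn (Sfun (e - 1) x) (maxn (Lfun (e - 2) x - k) (Lfun (e - 1) x + l - k - h (e + 1)%R)).

(** The finite computation behind [hole_rmv].  The [a]'s are the nine columns around the
moved column [a3], the [h]'s and [g]'s are the values of the recursion [hole] before and
after the move, from [h5], which is common to both, down to [h0].  The move lowers the
deficit at the moved column by 1 and raises exactly one of the four deficits to its
right by 1. *)
Lemma hole_local (k l m a0 a1 a2 a3 a4 a5 a6 a7 a8 h5 h4 h3 h2 h1 h0 g4 g3 g2 g1 g0 : nat) :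
  (m < l)%N -> (l <= k)%N -> (0 < a3)%N ->
  (a0 + a1 + a2 <= k)%N -> (a1 + a2 + a3 <= k)%N -> (a2 + a3 + a4 <= k)%N ->
    (a3 + a4 + a5 <= k)%N ->
  (a4 + a5 + a6 <= k)%N -> (a5 + a6 + a7 <= k)%N -> (a6 + a7 + a8 <= k)%N ->
  (a0 + a1 <= m)%N -> (a1 + a2 <= m)%N -> (a2 + a3 <= m)%N -> (a3 + a4 <= m)%N ->
  (a4 + a5 < m)%N -> (a5 + a6 < m)%N -> (a6 + a7 < m)%N -> (a7 + a8 < m)%N ->
  (a0 + 2 * a1 + 2 * a2 + a3 <= k + m)%N -> (a1 + 2 * a2 + 2 * a3 + a4 <= k + m)%N ->
  (a2 + 2 * a3 + 2 * a4 + a5 <= k + m)%N -> (a3 + 2 * a4 + 2 * a5 + a6 < k + m)%N ->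
  (a4 + 2 * a5 + 2 * a6 + a7 < k + m)%N -> (a5 + 2 * a6 + 2 * a7 + a8 < k + m)%N ->
  (a3 + a4 = m \/ a2 + 2 * a3 + 2 * a4 + a5 = k + m)%N ->
  (h5 <= l)%N -> (a7 + a8 <= h5)%N -> (a5 + 2 * a6 + 2 * a7 + a8 <= k + h5)%N ->
  h4 = maxn (a6 + a7) (maxn (a4 + 2 * a5 + 2 * a6 + a7 - k) (a5 + 2 * a6 + 2 * a7 + a8 + l - k -
    h5)) ->
  g4 = maxn (a6 + a7) (maxn (a4 + 2 * a5 + 2 * a6 + a7 + 1 - k) (a5 + 2 * a6 + 2 * a7 + a8 + l - k -
    h5)) ->
  h3 = maxn (a5 + a6) (maxn (a3 + 2 * a4 + 2 * a5 + a6 - k) (a4 + 2 * a5 + 2 * a6 + a7 + l - k -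
    h4)) ->
  g3 = maxn (a5 + a6) (maxn (a3 + 2 * a4 + 2 * a5 + a6 + 1 - k) (a4 + 2 * a5 + 2 * a6 + a7 + 1 + l -
    k - g4)) ->
  h2 = maxn (a4 + a5) (maxn (a2 + 2 * a3 + 2 * a4 + a5 - k) (a3 + 2 * a4 + 2 * a5 + a6 + l - k -
    h3)) ->
  g2 = maxn (a4 + a5 + 1) (maxn (a2 + 2 * a3 + 2 * a4 + a5 - k) (a3 + 2 * a4 + 2 * a5 + a6 + 1 + l -
    k - g3)) ->
  h1 = maxn (a3 + a4) (maxn (a1 + 2 * a2 + 2 * a3 + a4 - k) (a2 + 2 * a3 + 2 * a4 + a5 + l - k -
    h2)) ->
  g1 = maxn (a3 + a4) (maxn (a1 + 2 * a2 + 2 * a3 + a4 - 1 - k) (a2 + 2 * a3 + 2 * a4 + a5 + l - k -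
    g2)) ->
  h0 = maxn (a2 + a3) (maxn (a0 + 2 * a1 + 2 * a2 + a3 - k) (a1 + 2 * a2 + 2 * a3 + a4 + l - k -
    h1)) ->
  g0 = maxn (a2 + a3 - 1) (maxn (a0 + 2 * a1 + 2 * a2 + a3 - 1 - k) (a1 + 2 * a2 + 2 * a3 + a4 - 1 +
    l - k - g1)) ->
  (g0 + 1 = h0 /\ (g4 = h4 + 1 /\ g3 = h3 /\ g2 = h2 /\ g1 = h1 \/
    g4 = h4 /\ g3 = h3 + 1 /\ g2 = h2 /\ g1 = h1 \/
    g4 = h4 /\ g3 = h3 /\ g2 = h2 + 1 /\ g1 = h1 \/
    g4 = h4 /\ g3 = h3 /\ g2 = h2 /\ g1 = h1 + 1))%N.
Proof.
move=> Hm Hk H3 T1 T2 T3 T4 T5 T6 T7 S1 S2 S3 S4 S5 S6 S7 S8 L1 L2 L3 L4 L5 L6 st B5 H51 H52.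
(* A maximum attained first at its first, second or third argument: the cases exclude each
   other, which keeps the number of branches small. *)
have M (h A B D y : nat) : h = maxn A (maxn (B - k) (D + l - k - y)) ->
  (h = A /\ B <= A + k /\ D + l <= A + k + y \/
   h + k = B /\ A < h /\ D + l <= B + y \/
   h + k + y = D + l /\ A < h /\ B < h + k)%N by clear; lia.
Ltac max3 M := move=> /M [[? [? ?]]|[[? [? ?]]|[? [? ?]]]]; try (exfalso; lia).
Ltac same_or_up E g h := first [have E : g = h by lia | have E : g = (h + 1)%N by lia].
case: st => st.
all: max3 M; max3 M; same_or_up E4 g4 h4.
all: max3 M; max3 M; same_or_up E3 g3 h3.
all: max3 M; max3 M; same_or_up E2 g2 h2.
all: max3 M; max3 M; same_or_up E1 g1 h1.
all: max3 M; max3 M.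
all: split; first lia.
all: clear - E1 E2 E3 E4; lia.
Qed.

Lemma config_of (g : int -> nat) (lo : int) (W : nat) : (forall j : int, g j <> 0%N ->
    lo <= j < lo + W%:Z) ->
  exists c : config, forall j : int, c j = g j.
Proof.
move=> hg; pose D := seq_fset tt [seq lo + n%:Z | n <- iota 0 W].
exists [fsfun i in D => g i] => j; rewrite fsfun_fun; case: ifP => // /negP hj.
apply/esym; apply: contrapT => gj; apply: hj; rewrite seq_fsetE; apply/mapP.
by have := hg j gj; exists `|j - lo|%N; rewrite ?mem_iota; lia.
Qed.

Section Hole.
Variables (k l : nat).
Hypotheses (l0 : (0 < l)%N) (lk : (l <= k)%N).

Lemma hole_ex x : exists h, hole k l x h.
Proof.
have [N hN] := supp_bound x.
have z (j : int) : j < - N%:Z \/ N%:Z < j -> x j = 0%N by move=> hj; apply: contrapT => /hN; lia.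
have [Q eQ] : exists Q : int, Q = N%:Z + 4 by exists (N%:Z + 4).
pose F := fix F (n : nat) : nat := if n is n'.+1 then let e := Q - n%:Z in
  maxn (Sfun (e - 1) x) (maxn (Lfun (e - 2) x - k) (Lfun (e - 1) x + l - k - F n')) else 0%N.
pose g (e : int) := if Q <= e then 0%N else F `|Q - e|%N.
have gE (e : int) : g e = maxn (Sfun (e - 1) x) (maxn (Lfun (e - 2) x - k) (Lfun (e - 1) x + l - k -
  g (e + 1)%R)).
  rewrite /g; case: (leP Q e) => he.
    rewrite ifT; last by lia.
    by rewrite /Sfun /Lfun !z; lia.
  case en : `|Q - e|%N => [|n]; first by lia.
  rewrite /= (_ : Q - n.+1%:Z = e); last by lia.
  congr (maxn _ (maxn _ (_ - _))); case: (leP Q (e+1)) => he1; first by rewrite (_ : n = 0%N) //;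
    lia.
  by rewrite (_ : `|Q - (e + 1)%R|%N = n) //; lia.
have [|h hh] := @config_of g (- N%:Z - 4) (N + N + 10).
  move=> j gj; apply: contrapT => hj; apply: gj; rewrite gE /Sfun /Lfun !z; lia.
by exists h => e; rewrite !hh gE.
Qed.

(** The recursion runs from the right, where both solutions vanish. *)
Lemma hole_eq x x' h h' (u : int) : hole k l x h -> hole k l x' h' -> (forall j : int, u <= j ->
    x j = x' j) ->
  forall e : int, u + 3 <= e -> h e = h' e.
Proof.
move=> hh hh' hx; have [N hN] := supp_bound h; have [N' hN'] := supp_bound h'.
suff H (n : nat) (e : int) : u + 3 <= e -> N%:Z + N'%:Z < e + n%:Z -> h e = h' e.
  by move=> e he; apply: (H (N + N' + `|e| + 1)%N e he); lia.
elim: n e => [|n IH] e he hn.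
  have -> : h e = 0%N by apply: contrapT => /hN; lia.
  by apply/esym; apply: contrapT => /hN'; lia.
by rewrite hh hh' (IH (e + 1)) /Sfun /Lfun ?hx; lia.
Qed.

Lemma hole_eq_left x x' h h' (v u : int) : hole k l x h -> hole k l x' h' ->
    (forall j : int, j <= u -> x j = x' j) ->
  h v = h' v -> v <= u -> forall e : int, e < v -> h e = h' e.
Proof.
move=> hh hh' hx hv hvu e he; have [n en] : exists n : nat, e = v - n%:Z by exists `|v - e|%N; lia.
elim: n e en {he} => [|n IH] e en; first by rewrite (_ : e = v) //; lia.
rewrite hh hh' (IH (e + 1)); last by lia.
by rewrite /Sfun /Lfun !hx //; lia.
Qed.

Lemma hole_le x h (e : int) : C k l.-1 x -> hole k l x h ->
    [/\ (h e <= l)%N, (Sfun (e-1) x <= h e)%N, (Lfun (e-2) x <= k + h e)%N &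
  (Lfun (e-1) x + l <= k + h e + h (e+1)%R)%N].
Proof.
move=> Cx hh; have := hh (e+1); have := hh e.
rewrite (_ : e + 1 - 2 = e - 1); last by lia.
have := C_Sfun Cx (e-1); have := C_Lfun Cx (e-2); have := C_Lfun Cx (e-1) => A1 A2 A3 A4 A5; split;
  lia.
Qed.

Lemma mass_delta (h h' : config) (u v : int) : (forall e : int,
    h' e + (e == u) = h e + (e == v))%N -> mass h' = mass h.
Proof.
move=> hd; have [N hN] := supp_bound h; have [N' hN'] := supp_bound h'.
pose lo : int := - (N + N' + `|u| + `|v|)%N%:Z; pose W := (N + N' + `|u| + `|v| + (N + N' + `|u| +
  `|v|) + 1)%N.
rewrite !(@mass_wsum lo W); try by [move=> j /hN; rewrite /lo /W; lia | move=> j /hN';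
  rewrite /lo /W; lia].
have [nu eu] : exists n : nat, u = lo + n%:Z by exists `|u - lo|%N; rewrite /lo; lia.
have [nv ev] : exists n : nat, v = lo + n%:Z by exists `|v - lo|%N; rewrite /lo; lia.
have nuW : (nu < W)%N by rewrite /W /lo in eu *; lia.
have nvW : (nv < W)%N by rewrite /W /lo in ev *; lia.
have S1 := @sum_delta W (fun=> 1%N) nu nuW; have S2 := @sum_delta W (fun=> 1%N) nv nvW.
suff : (wsum (fun=> 1) lo W h' + \sum_(n < W) (n == nu :> nat) * 1 = wsum (fun=> 1) lo W h + \sum_(n
  < W) (n == nv :> nat) * 1)%N.
  by rewrite S1 S2 => /addIn.
rewrite /wsum -!big_split /=; apply: eq_bigr => n _; rewrite -!mulnDl; congr (_ * _)%N.
have := hd (lo + n%:Z).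
have -> : (lo + n%:Z == u) = (n == nu :> nat) by rewrite eu; lia.
by have -> : (lo + n%:Z == v) = (n == nv :> nat) by rewrite ev; lia.
Qed.

(** The unit of deficit that is lost at the edge [u] reappears at one of the edges
[u + 1, ..., u + 4] ([hole_local]); elsewhere the two solutions agree. *)
Lemma hole_rmv m x h h' (u : int) : (m < l)%N -> C k m x -> is_last k m x u -> hole k l x h ->
    hole k l (rmv u x) h' ->
  mass h' = mass h.
Proof.
move=> ml Cx hu hh hh'; have xu := last_entry Cx hu.
have Cx1 : C k l.-1 x by apply: C_mono_l Cx; lia.
have right (e : int) : u + 5 <= e -> h' e = h e.
  by move=> he; apply: (hole_eq hh' hh (u := u + 2)) => [j hj|]; [rewrite rmv_id //; lia|lia].
have HS (j : int) := Sfun_rmv j xu; have HL (j : int) := Lfun_rmv j xu.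
have xb (j : int) : j < u -> rmv u x j = x j by move=> hj; rewrite rmv_id //; lia.
move: (rmv u x) hh' HS HL xb => b hh' HS HL xb.
have us (j : int) : u < j -> (Sfun j x < m)%N /\ (Lfun j x < k + m)%N.
  by move=> hj; split; [apply: (unsatS Cx)|apply: (unsatL Cx)]; apply: hu.2.
have loc : (h' u + 1 = h u)%N /\ (
   [/\ h' (u+4)%R = h (u+4)%R + 1, h' (u+3)%R = h (u+3)%R,
     h' (u+2)%R = h (u+2)%R & h' (u+1)%R = h (u+1)%R]%N \/
   [/\ h' (u+4)%R = h (u+4)%R, h' (u+3)%R = h (u+3)%R + 1,
     h' (u+2)%R = h (u+2)%R & h' (u+1)%R = h (u+1)%R]%N \/
   [/\ h' (u+4)%R = h (u+4)%R, h' (u+3)%R = h (u+3)%R, h' (u+2)%R = h (u+2)%R + 1 & h' (u+1)%R = h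
     (u+1)%R]%N \/
   [/\ h' (u+4)%R = h (u+4)%R, h' (u+3)%R = h (u+3)%R, h' (u+2)%R = h (u+2)%R & h' (u+1)%R = h
     (u+1)%R + 1]%N).
  have E1 : (Sfun (u + 4 - 1) b = Sfun (u + 4 - 1) x)%N by have := HS (u+4-1); lia.
  have E2 : (Lfun (u + 4 - 2) b = Lfun (u + 4 - 2) x + 1)%N by have := HL (u+4-2); lia.
  have E3 : (Lfun (u + 4 - 1) b = Lfun (u + 4 - 1) x)%N by have := HL (u+4-1); lia.
  have E4 : (Sfun (u + 3 - 1) b = Sfun (u + 3 - 1) x)%N by have := HS (u+3-1); lia.
  have E5 : (Lfun (u + 3 - 2) b = Lfun (u + 3 - 2) x + 1)%N by have := HL (u+3-2); lia.
  have E6 : (Lfun (u + 3 - 1) b = Lfun (u + 3 - 1) x + 1)%N by have := HL (u+3-1); lia.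
  have E7 : (Sfun (u + 2 - 1) b = Sfun (u + 2 - 1) x + 1)%N by have := HS (u+2-1); lia.
  have E8 : (Lfun (u + 2 - 2) b = Lfun (u + 2 - 2) x)%N by have := HL (u+2-2); lia.
  have E9 : (Lfun (u + 2 - 1) b = Lfun (u + 2 - 1) x + 1)%N by have := HL (u+2-1); lia.
  have E10 : (Sfun (u + 1 - 1) b = Sfun (u + 1 - 1) x)%N by have := HS (u+1-1); lia.
  have E11 : (Lfun (u + 1 - 2) b = Lfun (u + 1 - 2) x - 1)%N by have := HL (u+1-2); lia.
  have E12 : (Lfun (u + 1 - 1) b = Lfun (u + 1 - 1) x)%N by have := HL (u+1-1); lia.
  have E13 : (Sfun (u - 1) b = Sfun (u - 1) x - 1)%N by have := HS (u-1); lia.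
  have E14 : (Lfun (u - 2) b = Lfun (u - 2) x - 1)%N by have := HL (u-2); lia.
  have E15 : (Lfun (u - 1) b = Lfun (u - 1) x - 1)%N by have := HL (u-1); lia.
  have u5 : u + 4 + 1 = u + 5 by lia.
  have r5 : h' (u + 5) = h (u + 5) by apply: right; lia.
  have st := hu.1.
  have := us (u+1) (ltac:(lia)); have := us (u+2) (ltac:(lia)); have := us (u+3) (ltac:(lia));
    have := us (u+4) (ltac:(lia)).
  have [B5 H51 H52 _] := hole_le (u+5) Cx1 hh.
  have R4 := hh (u+4); have R3 := hh (u+3); have R2 := hh (u+2); have R1 := hh (u+1);
    have R0 := hh u.
  have G4 := hh' (u+4); have G3 := hh' (u+3); have G2 := hh' (u+2); have G1 := hh' (u+1);
    have G0 := hh' u.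
  rewrite u5 in R4 G4; rewrite r5 in G4.
  rewrite E1 E2 E3 in G4.
  rewrite E4 E5 E6 in G3.
  rewrite E7 E8 E9 in G2.
  rewrite E10 E11 E12 in G1.
  rewrite E13 E14 E15 in G0.
  have LOC := @hole_local k l m (x (u-3)) (x (u-2)) (x (u-1)) (x u) (x (u+1)) (x (u+2)) (x (u+3)) (x
    (u+4)) (x (u+5))
    (h (u+5)) (h (u+4)) (h (u+3)) (h (u+2)) (h (u+1)) (h u) (h' (u+4)) (h' (u+3)) (h' (u+2)) (h'
      (u+1)) (h' u) ml lk xu.
  move: LOC st (C_Tri Cx (u-3)) (C_Tri Cx (u-2)) (C_Tri Cx (u-1)) (C_Tri Cx u) (C_Tri Cx (u+1))
    (C_Tri Cx (u+2)) (C_Tri Cx (u+3))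
    (C_Sfun Cx (u-3)) (C_Sfun Cx (u-2)) (C_Sfun Cx (u-1)) (C_Sfun Cx u) (C_Lfun Cx (u-2)) (C_Lfun Cx
      (u-1)) (C_Lfun Cx u) B5 H51 H52 R4 G4 R3 G3 R2 G2 R1 G1 R0 G0.
  rewrite /sat /Tri /Sfun /Lfun; clear; idx u.
  move=> LOC st T1 T2 T3 T4 T5 T6 T7 S1 S2 S3 S4 L1 L2 L3 B5 H51 H52 R4 G4 R3 G3 R2 G2 R1 G1 R0 G0
    [S8 _] [S7 L6] [S6 L5] [S5 L4].
  have [H0 H1] := LOC T1 T2 T3 T4 T5 T6 T7 S1 S2 S3 S4 S5 S6 S7 S8 L1 L2 L3 L4 L5 L6 st B5 H51 H52
    R4 G4 R3 G3 R2 G2 R1 G1 R0 G0.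
  by split=> //; case: H1 => [[? [? []]]|[[? [? []]]|[[? [? []]]|[? [? []]]]]]; [left|right;
    left|right; right; left|right; right; right].
case: loc => e0 loc.
have eu1 : h' (u - 1) = h (u - 1).
  rewrite hh hh'; have := HS (u-1-1); have := HL (u-1-2); have := HL (u-1-1);
    rewrite (_ : u - 1 + 1 = u); last by lia.
  lia.
have left (e : int) : e < u - 1 -> h' e = h e.
  apply: (hole_eq_left hh' hh (u := u - 1) _ eu1); last by lia.
  by move=> j hj; apply: xb; lia.
have fin (v : int) : (forall e : int, u < e < u + 5 -> h' e = (h e + (e == v))%N) ->
  u < v < u + 5 -> mass h' = mass h.
  move=> hv hvu; apply: (@mass_delta h h' u v) => e.
  have [h1|[h1|[h1|h1]]] : e < u \/ e = u \/ u < e < u + 5 \/ u + 5 <= e by lia.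
  - rewrite (_ : h' e = h e); first by lia.
    by have [/left //|->] : e < u - 1 \/ e = u - 1 by lia.
  - subst e; lia.
  - by rewrite hv //; lia.
  - by rewrite right //; lia.
have sp (e : int) : u < e < u + 5 -> e = u + 1 \/ e = u + 2 \/ e = u + 3 \/ e = u + 4 by lia.
by case: loc => [[e4 e3 e2 e1]|[[e4 e3 e2 e1]|[[e4 e3 e2 e1]|[e4 e3 e2 e1]]]];
  [apply: (fin (u+4))|apply: (fin (u+3))|apply: (fin (u+2))|apply: (fin (u+1))];
  try lia; move=> e /sp [->|[->|[->|->]]]; rewrite ?e4 ?e3 ?e2 ?e1; lia.
Qed.

End Hole.

(** * Mass of the deficits *)

Section Flux.
Variables (k l : nat).
Hypotheses (l0 : (0 < l)%N) (lk : (l <= k)%N).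

Lemma hole_left0 x h (e : int) : hole k l x h -> (forall j : int, j <= e + 1 -> x j = 0%N) ->
    h e = 0%N.
Proof. by move=> hh hx; rewrite hh /Sfun /Lfun !hx; lia. Qed.

Lemma hole_right0 x h (u : int) : hole k l x h -> (forall j : int, u <= j -> x j = 0%N) ->
    forall e : int, u + 3 <= e -> h e = 0%N.
Proof.
move=> hh hx e he.
have h0 : hole k l config0 config0 by move=> e'; rewrite /Sfun /Lfun !config0E; lia.
by rewrite (hole_eq l0 lk (u := u) hh h0) ?config0E // => j hj; rewrite hx // config0E.
Qed.

(** The isolated column produces the deficits [c], [c] and [max (c + l - k) 0] at three
successive edges.  These vanish beyond, so the recursion starts afresh at [x]. *)
Lemma hole_add_column x y h h' (q : int) (c : nat) : (c < l)%N -> hole k l x h -> hole k l y h' ->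
  (forall j : int, q - 6 <= j -> x j = 0%N) -> (forall j : int,
    y j = x j + (if j == q then c else 0))%N ->
  mass h' = (mass h + Acoef k l c)%N.
Proof.
move=> cl hh hh' hx hy.
pose P (e : int) := (if e == q then c else if e == (q + 1)%R then c else if e == (q + 2)%R then c +
  l - k else 0)%N.
have yq : y q = c by rewrite hy eqxx hx //; lia.
have y0 (j : int) : j <> q -> q - 6 <= j -> y j = 0%N by move=> h1 h2; rewrite hy hx // ifF //; lia.
have h0 := hole_right0 hh hx.
have h0' := @hole_right0 y h' (q+1) hh' (fun j hj => y0 j (ltac:(lia)) (ltac:(lia))).
have E3 : h' (q+3) = 0%N.
  rewrite hh' (h0' (q+3+1)) /Sfun /Lfun; last by lia.
  rewrite (_ : q + 3 - 2 - 1 = q); last by lia. rewrite yq !y0; lia.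
have E2 : h' (q+2) = (c + l - k)%N.
  rewrite hh' (_ : q + 2 + 1 = q + 3) ?E3; last by lia.
  rewrite /Sfun /Lfun (_ : q + 2 - 2 = q); last by lia.
  rewrite (_ : q + 2 - 1 - 1 = q); last by lia. rewrite yq !y0; lia.
have E1 : h' (q+1) = c.
  rewrite hh' (_ : q + 1 + 1 = q + 2) ?E2; last by lia.
  rewrite /Sfun /Lfun (_ : q + 1 - 1 = q); last by lia.
  rewrite (_ : q + 1 - 2 + 1 = q); last by lia. rewrite yq !y0; lia.
have E0 : h' q = c.
  rewrite hh' E1 /Sfun /Lfun.
  rewrite (_ : q - 2 + 2 = q); last by lia.
  rewrite (_ : q - 1 + 1 = q); last by lia. rewrite yq !y0; lia.
have E4 : h' (q-1) = 0%N.
  rewrite hh' (_ : q - 1 + 1 = q) ?E0; last by lia.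
  rewrite /Sfun /Lfun.
  rewrite (_ : q - 1 - 1 + 2 = q); last by lia. rewrite yq !y0; lia.
have left : forall e : int, e < q - 1 -> h' e = h e.
  apply: (hole_eq_left l0 lk hh' hh (u := q - 1)) => //; [|by rewrite E4 h0 //; lia].
  by move=> j hj; rewrite hy ifF ?addn0 //; lia.
have [p hp] : exists p : config, forall e : int, p e = P e.
  by apply: (@config_of P q 3) => j; rewrite /P; do ?[case: eqP => ?]; lia.
have eh (e : int) : h' e = (h e + p e)%N.
  rewrite hp /P; have [h1|[->|[->|[->|[->|h1]]]]] : e < q - 1 \/ e = q - 1 \/ e = q \/
    e = q + 1 \/ e = q + 2 \/ q + 3 <= e by lia.
  - by rewrite left // !ifF ?addn0 //; lia.
  - by rewrite E4 h0 ?ifF //; lia.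
  - by rewrite E0 h0; [do ?[case: eqP => ?]; lia|lia].
  - by rewrite E1 h0; [do ?[case: eqP => ?]; lia|lia].
  - by rewrite E2 h0; [do ?[case: eqP => ?]; lia|lia].
  - have e0 : h' e = 0%N by case: (eqVneq e (q + 3)) => [->|h2] //; apply: h0'; lia.
    rewrite e0 h0; [do ?[case: eqP => ?]; lia|lia].
have mp : mass p = Acoef k l c.
  rewrite (@mass_wsum q 3).
    rewrite /wsum !big_ord_recr big_ord0 /= !hp /P /Acoef.
    do ?[case: eqP => ?]; lia.
  by move=> j; rewrite hp /P; do ?[case: eqP => ?]; lia.
rewrite -mp; have [N hN] := supp_bound h; have [N' hN'] := supp_bound h';
  have [N'' hN''] := supp_bound p.
pose K := (N + N' + N'')%N.
rewrite !(@mass_wsum (- K%:Z) (K + K + 1)); try by [move=> j /hN; rewrite /K; lia|move=> j /hN';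
  rewrite /K; lia|move=> j /hN''; rewrite /K; lia].
by rewrite /wsum -big_split /=; apply: eq_bigr => n _; rewrite eh mulnDl.
Qed.

End Flux.

(** The last particle of the background, of weight [m < l], is moved to the right until it is
a single column of mass [m], far from the rest.  This does not change the mass of the
deficits ([hole_rmv]); the column then contributes [Acoef k l m], which is the
corresponding term of [Asum], and the rest is treated by induction. *)
Lemma mass_hole k l x h : (0 < l <= k)%N -> C k l.-1 x -> hole k l x h ->
    (mass h)%:Z = Asum k l (iota_map k x).
Proof.
move=> hl; have [l0 lk] := andP hl.
have [n hn] := ex_intro (fun n => (mass x < n)%N) _ (ltnSn (mass x)).
elim: n x h hn => // n IH x h hn Cx hh.
have [ex|hx] := pselect (x = config0).
  subst x; rewrite iota0 /Asum big_nil (_ : h = config0).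
    by rewrite (@mass_wsum 0 0) /wsum ?big_ord0 // => j; rewrite config0E.
  apply/fsfunP => e; rewrite config0E; apply: (hole_left0 l0 lk hh) => j _; exact: config0E.
have [m [hm hc]] := weight_ex Cx hx.
have m0 : (0 < m)%N by lia. have mk : (m <= k)%N by lia. have ml : (m < l)%N by lia.
have hmk : (0 < m <= k)%N by lia.
have [t0 [i0 [f0 est]]] := strip_ex m0 mk hc.
rewrite (iota_cons hmk hc est) Asum_cons /=.
set y := clear2 i0 _ in est *.
have [Cy hmass] := strip_C m0 mk hc est.
have [N hN] := supp_bound y.
set d0 := energy m i0 _ in est.
(* Far enough to the right of [y] for [hole_add_column]; a column of mass [m] there has the
   energy [q * m], and the particle does not exceed it at the outset. *)
pose q : int := (N + 7 + `|d0|)%N%:Z.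
have hq : d0 <= q * m%:Z by rewrite /q; nia.
have [s es] : exists s : nat, s%:Z = q * m%:Z - d0 by exists `|(q * m%:Z - d0)%R|%N; lia.
have [i [f e1 c1 _]] := free_iter m0 mk s f0.
rewrite -iterD in f e1 c1.
set b := iter _ _ _ in f e1 c1.
have [Cb bS bi bz] := (has_freeP m0 mk b i).1 f.
have [ei ec] : i = q /\ b i = m.
  apply: (energy_inj (l := m) m0 mk); [by move: bS; rewrite /Sfun; lia|by lia|].
  rewrite e1 -/d0 es [RHS](energyE m0 mk) //; lia.
subst i.
have bq1 : b (q+1) = 0%N by move: bS; rewrite /Sfun; lia.
have hb (j : int) : b j = (y j + (if j == q then m else 0))%N.
  have := congr1 (fun g : config => g j) c1; rewrite /= clear2E => <-.
  case: (eqVneq j q) => [->|n1] /=; first by rewrite ec.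
  by case: (eqVneq j (q+1)) => [->|n2] /=; rewrite ?bq1 ?addn0.
have [hb' Hb] := hole_ex l0 lk b.
have [hy Hy] := hole_ex l0 lk y.
have Ey : (mass hy)%:Z = Asum k l (iota_map k y).
  by apply: IH => //; [lia|apply: C_mono_l Cy; lia].
have := hole_add_column l0 lk ml Hy Hb _ hb => Eb.
have {}Eb : mass hb' = (mass hy + Acoef k l m)%N.
  by apply: Eb => j hj; apply: contrapT => /hN; rewrite /q in hj; lia.
suff key (t : nat) (h' : config) : hole k l (iter t (Mplus k m) x) h' -> mass h' = mass h.
  by have := key _ _ Hb; lia.
elim: t h' => [|t IHt] h' Hh' /=.
  have -> // : h' = h.
  by apply/fsfunP => e; apply: (hole_eq l0 lk (u := e - 3) Hh' hh _ _) => //; lia.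
have [h2 H2] := hole_ex l0 lk (iter t (Mplus k m) x).
have hct := iter_Mplus_Cunder t m0 hc; have [u hu] := Cunder_last m0 hct.
rewrite -(IHt _ H2); rewrite /= (MplusE hu) in Hh'; exact: (hole_rmv l0 lk ml hct.1 hu H2 Hh').
Qed.

(** * A particle crossing a background *)

Section Cross.
Variables (k l : nat).
Hypotheses (l0 : (0 < l)%N) (lk : (l <= k)%N).

Notation D := (Mminus_all k l 1).

Lemma Mminus1E a (j : int) : is_first k l a j -> D a = lmv j a.
Proof. by move=> h; rewrite /Mminus_all /= /Mminus /left_pos /= (first_posE h). Qed.

(** The particle is crossing the edge between [i] and [i + 1]: [n] units of the flux
[l - h i] have still to pass.  Left of [i] the background is intact; at the columns
from [i + 2] on the particle has come and gone, so that the column has received its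
flux from the right and passed on the flux to the left. *)
Definition crossing (x h : config) (i : int) (n : nat) (a : config) : Prop :=
  [/\ (forall j : int, j < i -> a j = x j), (a i + n = x i + (l - h i))%N,
      (a (i + 1)%R + (l - h i) = x (i + 1)%R + (l - h (i + 1)%R) + n)%N &
      forall j : int, i + 2 <= j -> (a j + (l - h (j - 1)%R) = x j + (l - h j))%N].

(** The inequalities of [hole_le] say that, as long as the flux is not complete, no column
before [i] is saturated, and the equation for [h (i + 1)] says that column [i] is: the
flux across the edge [i + 1] is the largest possible one. *)
Lemma crossing_first x h (i : int) n a : C k l.-1 x -> hole k l x h -> C k l a ->
    crossing x h i n.+1 a -> (n < l - h i)%N ->
  is_first k l a i.
Proof.
move=> Cx hh Ca [c1 c2 c3 c4] hn.
have [A1 A2 A3 A4] := hole_le l0 lk i Cx hh; have [B1 B2 B3 B4] := hole_le l0 lk (i+1) Cx hh.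
have [D1 _ _ _] := hole_le l0 lk (i+1+1) Cx hh.
have c5 := c4 (i+2) (lexx _).
have hi1 := hh (i+1).
split; last first.
  move=> j hj; have [e|[e|e]] : j = i - 1 \/ j = i - 2 \/ j < i - 2 by lia.
  - subst j; apply: unsat_intro.
      by move: A2 c2 hn (c1 (i-1) (ltac:(lia))); rewrite /Sfun; clear; idx i; lia.
    move: A4 A1 B1 c2 c3 hn (c1 (i-1) (ltac:(lia))) (c1 (i-2) (ltac:(lia))); rewrite /Lfun; clear;
      idx i; lia.
  - subst j; apply: unsat_intro.
      move: (C_Sfun Cx (i-2)) (c1 (i-2) (ltac:(lia))) (c1 (i-1) (ltac:(lia))) l0; rewrite /Sfun;
        clear; idx i; lia.
    move: A3 A1 c2 hn (c1 (i-3) (ltac:(lia))) (c1 (i-2) (ltac:(lia))) (c1 (i-1) (ltac:(lia)));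
      rewrite /Lfun; clear; idx i; lia.
  - move=> sj; apply: (C_unsat (i := j) l0 Cx); move: sj; rewrite /sat /Sfun /Lfun !c1 //; lia.
have c6 := c1 (i-1) (ltac:(lia)).
move: hi1 A1 A2 A3 A4 B1 B2 B3 B4 D1 c2 c3 c5 c6 hn; rewrite /sat /Sfun /Lfun; clear; idx i; lia.
Qed.

Lemma crossing_step x h (i : int) n a : C k l.-1 x -> hole k l x h -> C k l a ->
    crossing x h i n.+1 a -> (n < l - h i)%N ->
  C k l (D a) /\ crossing x h i n (D a).
Proof.
move=> Cx hh Ca hc hn; have hf := crossing_first Cx hh Ca hc hn.
have ai := first_entry Ca hf; rewrite (Mminus1E hf); split; first exact: lmv_first_C hf.
case: hc => c1 c2 c3 c4; split.
- by move=> j hj; rewrite lmv_id ?c1 //; lia.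
- by rewrite lmv_at; lia.
- by rewrite lmv_at1; lia.
- by move=> j hj; rewrite lmv_id ?c4 //; lia.
Qed.

(** When the flux across one edge is complete, the next one begins. *)
Lemma crossing_prev x h (i : int) a : crossing x h (i + 1) 0 a -> crossing x h i (l - h i) a.
Proof.
case=> c1 c2 c3 c4; split.
- by move=> j hj; apply: c1; lia.
- by rewrite c1; lia.
- by lia.
- move=> j hj; have [e|e] : j = i + 2 \/ i + 3 <= j by lia.
    subst j; move: c3; rewrite (_ : i + 1 + 1 = i + 2); last by lia.
    by rewrite (_ : i + 2 - 1 = i + 1); lia.
  by apply: c4; lia.
Qed.

Lemma crossing_edge x h (i : int) a : C k l.-1 x -> hole k l x h -> C k l a ->
    crossing x h (i + 1) 0 a ->
  let b := iter (l - h i) D a in C k l b /\ crossing x h i 0 b.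
Proof.
move=> Cx hh Ca hc /=.
have gen (n : nat) c : C k l c -> (n <= l - h i)%N -> crossing x h i n c ->
  C k l (iter n D c) /\ crossing x h i 0 (iter n D c).
  elim: n c => [|n IH] c Cc hn hc' //; have [h1 h2] := crossing_step Cx hh Cc hc' hn.
  by rewrite iterSr; apply: IH => //; lia.
by apply: gen => //; apply: crossing_prev.
Qed.

Lemma crossing_iter x h (Q : nat) a : C k l.-1 x -> hole k l x h -> C k l a ->
    crossing x h Q%:Z 0 a ->
  let b := iter (\sum_(e < Q) (l - h e%:Z)) D a in C k l b /\ crossing x h 0 0 b.
Proof.
move=> Cx hh; elim: Q a => [|Q IH] a Ca hc /=; first by rewrite big_ord0.
have e : Q.+1%:Z = Q%:Z + 1 by lia. rewrite e in hc.
have [h1 h2] := crossing_edge Cx hh Ca hc.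
rewrite big_ord_recr /= iterD; exact: IH.
Qed.

(** Left moves cannot empty the negative columns again, which fixes the moment at which a
configuration stands at column 0. *)
Lemma negative_iter (n : nat) a : C k l a -> positions k l a [:: first_pos k l a] ->
    (exists j : int, j < 0 /\ a j <> 0%N) ->
  exists j : int, j < 0 /\ iter n D a j <> 0%N.
Proof.
elim: n a => // n IH a Ca hp hj; rewrite iterSr.
have [hf hu] := hp; have [j' hj'] := positions_lmv_head l0 lk Ca hp.
apply: IH; rewrite (Mminus1E hf).
- exact: lmv_first_C hf.
- by rewrite (first_posE hj'.1).
case: hj => j [j0 aj]; have ai := first_entry Ca hf; move: hf ai; set i := first_pos k l a => hf ai.
have [e|ne] : j = i + 1 \/ j <> i + 1 by lia.
  by exists i; split; [lia|rewrite lmv_at].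
by exists j; split=> //; have := lmvD j ai; lia.
Qed.

(** At [p <= - 2] the sums involve at most one copy of column 0, too little for saturation. *)
Lemma negative_sat a (p : int) : C k l a -> (forall j : int, j < 0 -> a j = 0%N) ->
    sat k l a p -> p < 0 -> p = - 1 /\ a 0 = l.
Proof.
move=> Ca z sp hp.
have [e|[e|e]] : p = - 1 \/ p = - 2 \/ p <= - 3 by lia.
- subst p; split=> //; have : Sfun (- 1) a = l.
    by case: sp => // sp; apply: (satL_prev0 Ca) => //; apply: z.
  by rewrite /Sfun z // addNr.
- exfalso; move: sp (C_Sfun Ca (p + 2)); rewrite /sat /Sfun /Lfun (z p) // (z (p + 1)) ?(z (p - 1));
    lia.
- by exfalso; move: sp; rewrite /sat /Sfun /Lfun !z; lia.
Qed.

Lemma rmv_nonneg a (i : int) : C k l a -> is_last k l a i -> (forall j : int, j < 0 ->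
    a j = 0%N) -> forall j : int, j < 0 -> rmv i a j = 0%N.
Proof.
move=> Ca hi z j hj; have ai := last_entry Ca hi.
have i0 : 0 <= i by rewrite leNgt; apply/negP => /z; lia.
by rewrite rmv_id ?z //; lia.
Qed.

Lemma iter_Mplus_nonneg a t : Cunder k l a -> (forall j : int, j < 0 -> a j = 0%N) ->
    forall j : int, j < 0 -> iter t (Mplus k l) a j = 0%N.
Proof.
move=> hc z; elim: t => //= t IH; have hct := iter_Mplus_Cunder t l0 hc;
  have [i hi] := Cunder_last l0 hct.
rewrite (MplusE hi); exact: rmv_nonneg hct.1 hi IH.
Qed.

(** With a single particle of weight [l], the collective left move is inverse to the right
move. *)
Lemma Mplus_iter_D n b (j : int) : C k l b -> positions k l b [:: j] ->
  [/\ C k l (iter n D b), (exists j', positions k l (iter n D b) [:: j']) & iter n (Mplus k l) (iter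
    n D b) = b].
Proof.
move=> Cb hp; elim: n => [|n [h1 [j' h2] h3]]; first by split=> //; exists j.
have [j'' h4] := positions_lmv_head l0 lk h1 h2.
split.
- by rewrite /= (Mminus1E h2.1); apply: lmv_first_C h2.1.
- by exists j''; rewrite /= (Mminus1E h2.1).
- rewrite iterSr /=; rewrite (@Mplus_Mminus_all k l l0 lk _ [::] j' h1 h2).
  by rewrite /Mminus_all /= h3.
Qed.

(** Let the particle be moved right until it is the single column [l] at [Q], with energy
[Q * l], after [t] moves.  Running this backwards, the particle crosses the
edges from [Q - 1] down to 0, with flux [l - h e] across the edge [e]; hence
[t] is the sum of [l - h e], and [Q * l - t] is the mass of [h]. *)
Lemma strip_leftmost a s x : C k l a -> (forall j : int, j < 0 -> a j = 0%N) -> a 0 = l ->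
    strip k l a = (s, x) -> C k l.-1 x ->
  s = Asum k l (iota_map k x).
Proof.
move=> Ca za a0 es Cx.
have hl : (0 < l <= k)%N by rewrite l0.
have [h hh] := hole_ex l0 lk x; rewrite -(mass_hole hl Cx hh).
have sa : sat k l a (- 1) by left; rewrite /Sfun za // addNr.
have hc : Cunder k l a by apply/(CunderE k a l0); split=> //; exists (- 1).
have fa : is_first k l a (- 1).
  split=> // p hp sp; have [e _] := negative_sat Ca za sp (ltac:(lia)); lia.
have [t0 [i0 [f0 est]]] := strip_ex l0 lk hc.
rewrite es in est; case: est => es0 ex.
have [N hN] := supp_bound x.
move: es0 ex; set d0 := energy l i0 _; set y := clear2 i0 _ => es0 ex.
(* A column right of the support of [x] which the particle has not yet passed. *)
pose Q := (N + 7 + `|d0|)%N.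
have hq : d0 <= Q%:Z * l%:Z by rewrite /Q; nia.
have [n en] : exists n : nat, n%:Z = Q%:Z * l%:Z - d0 by exists `|(Q%:Z * l%:Z - d0)%R|%N; lia.
have [i [f e1 c1 _]] := free_iter l0 lk n f0.
rewrite -iterD in f e1 c1; move: f e1 c1; set t := (n + t0)%N; set b := iter t _ _ => f e1 c1.
have [Cb bS bi bz] := (has_freeP l0 lk b i).1 f.
have [ei ec] : i = Q%:Z /\ b i = l.
  apply: (energy_inj (l := l) l0 lk); [by move: bS; rewrite /Sfun; lia|by lia|].
  rewrite e1 -/d0 en [RHS](energyE l0 lk) //; lia.
subst i.
have bq1 : b (Q%:Z + 1) = 0%N by move: bS; rewrite /Sfun; lia.
have cbx : clear2 Q%:Z b = x by rewrite c1 ex.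
have bx (j : int) : j <> Q%:Z -> b j = x j.
  move=> hj; rewrite -cbx clear2E; case: ifP => // h1; have -> : j = Q%:Z + 1 by lia.
  by rewrite bq1.
have xz (j : int) : N%:Z < j -> x j = 0%N by move=> hj; apply: contrapT => /hN; lia.
have h0 := hole_right0 l0 lk hh (u := N%:Z + 1) (fun j hj => xz j (ltac:(lia))).
have xneg (j : int) : j < 0 -> x j = 0%N.
  move=> hj; rewrite -bx; last by lia. exact: iter_Mplus_nonneg.
(* Right of the support of [x] all deficits vanish and the whole particle is in one column. *)
have cQ : crossing x h Q%:Z 0 b.
  split.
  - by move=> j hj; apply: bx; lia.
  - by rewrite ec xz ?h0 /Q; lia.
  - by rewrite bq1 xz ?h0 ?h0 /Q; lia.
  - by move=> j hj; rewrite bx ?xz ?h0 ?h0 /Q; lia.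
have [Cstar cstar] := crossing_iter Cx hh Cb cQ.
set N0 := (\sum_(e < Q) (l - h e%:Z))%N in Cstar cstar.
have [j1 hp1] : exists j : int, positions k l b [:: j].
  apply: (positions_add_free l0 lk (js := [::]) f); rewrite cbx => u; exact: C_unsat.
have eDt : iter t D b = a.
  have [q1 [q2 q3] q4] := Mplus_iter_D t Cb hp1.
  have hc' : Cunder k l (iter t D b) by apply: (Cunder_positions l0 q1 q3).
  exact: (iter_Mplus_inj l0 hc' hc q4).
have pfirst c j : positions k l c [:: j] -> positions k l c [:: first_pos k l c].
  by move=> hp; rewrite (first_posE hp.1).
have hm1 : h (- 1) = 0%N.
  have [p ep] : exists p : int, p = - 1 by exists (- 1).
  rewrite -ep; have [_ A2 _ _] := hole_le l0 lk (p + 1) Cx hh.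
  move: (hh p) A2 lk (xneg p (ltac:(lia))) (xneg (p - 1) (ltac:(lia))) (xneg (p - 2) (ltac:(lia)))
    (xneg (p - 3) (ltac:(lia))).
  by rewrite /Sfun /Lfun; clear; idx p; lia.
have eN : t = N0.
  (* The crossing reaches column 0 after [N0] moves and its next move enters column [- 1], from
   which the mass never returns. *)
  have [lt|[e|gt]] : (t < N0)%N \/ t = N0 \/ (N0 < t)%N by lia.
  - exfalso; have [m em] : exists m, N0 = (m.+1 + t)%N by exists (N0 - t.+1)%N; lia.
    move: cstar; rewrite em iterD eDt iterSr => -[c1' _ _ _].
    have [q1 [q2 q3] _] := Mplus_iter_D t.+1 Cb hp1.
    rewrite /= eDt in q1 q3.
    have [|j [hj hne]] := negative_iter m q1 (pfirst _ _ q3).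
      by exists (- 1); split=> //; rewrite (Mminus1E fa) lmv_at.
    by apply: hne; rewrite c1' // xneg.
  - done.
  - exfalso; have [m em] : exists m, t = (m.+1 + N0)%N by exists (t - N0.+1)%N; lia.
    have [q1 [q2 q3] _] := Mplus_iter_D N0.+1 Cb hp1.
    move: eDt; rewrite em iterD iterSr => eDt.
    have [p ep] : exists p : int, p = - 1 by exists (- 1).
    have cp : crossing x h (p + 1) 0 (iter N0 D b) by rewrite (_ : p + 1 = 0) //; lia.
    have {}cp := crossing_prev cp; rewrite ep hm1 subn0 in cp.
    have hf : is_first k l (iter N0 D b) (- 1).
      by apply: (@crossing_first x h (-1) l.-1 _ Cx hh Cstar); [rewrite prednK|rewrite hm1; lia].
    have [|j [hj hne]] := negative_iter m q1 (pfirst _ _ q3).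
      by exists (- 1); split=> //; rewrite /= (Mminus1E hf) lmv_at.
    by apply: hne; rewrite [iter N0.+1 _ _]/= eDt za.
have hneg (e : int) : e < 0 -> h e = 0%N.
  move=> he; case: (eqVneq e (- 1)) => [-> //|ne].
  by apply: (hole_left0 l0 lk hh) => j hj; apply: xneg; lia.
have -> : mass h = (\sum_(e < Q) h e%:Z)%N.
  rewrite (@mass_wsum 0 Q); last first.
    move=> j hj; have [h1|[h1|h1]] : j < 0 \/ Q%:Z <= j \/ 0 <= j < 0 + Q%:Z by lia.
    + by case: hj; apply: hneg.
    + by case: hj; apply: h0; rewrite /Q in h1; lia.
    + by lia.
  by rewrite /wsum; apply: eq_bigr => e _; rewrite muln1 add0r.
have hsum : (N0 + \sum_(e < Q) h e%:Z = Q * l)%N.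
  rewrite /N0 -big_split /= (eq_bigr (fun=> l)); first by rewrite sum_nat_const card_ord.
  by move=> e _; have [hle _ _ _] := hole_le l0 lk e%:Z Cx hh; lia.
lia.
Qed.

End Cross.

(** * Positivity *)

Section Pos.
Variables (k l : nat).
Hypotheses (l0 : (0 < l)%N) (lk : (l <= k)%N).

Definition nonneg (a : config) := forall j : int, j < 0 -> a j = 0%N.

(** Left moves lower the rigging by 1 each time and stay in the nonnegative columns until the
particle is [l] in column 0, with rigging 0. *)
Lemma single_strip_ge0 a (j : int) s x : C k l a -> positions k l a [:: j] -> nonneg a ->
    strip k l a = (s, x) ->
  0 <= s - Asum k l (iota_map k x).
Proof.
have [N hN] := supp_bound a.
have {}hN (i : int) : a i <> 0%N -> i < (N + 1)%N%:Z by move=> /hN; lia.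
move: (N + 1)%N hN => W hW.
have [n hn] := ex_intro (fun n => (wsum id 0 W a < n)%N) _ (ltnSn (wsum id 0 W a)).
elim: n a j s hW hn => // n IH a j s hW hn Ca hp za es.
have [/= es1 hx] := @strip_Mminus_all k l l0 lk a [::] j s x Ca hp es.
have hc := Cunder_positions l0 Ca hp (ltac:(by [])).
have [Cx _] := strip_C l0 lk hc es.
have hf := hp.1; have aj := first_entry Ca hf.
case: (ltP j 0) => hj.
  have [ej a0] := negative_sat l0 lk Ca za hf.1 hj.
  by rewrite (strip_leftmost l0 lk Ca za a0 es) ?subrr //; apply: unsat_C.
have [j' hj'] := positions_lmv_head l0 lk Ca hp.
have ED : Mminus_all k l 1 a = lmv j a by rewrite (Mminus1E hf).
rewrite ED /= in es1.
have hjW := hW (j + 1) (ltac:(lia)).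
have [n0 en] : exists n0 : nat, j = 0 + n0%:Z by exists `|j|%N; lia.
suff : 0 <= s - 1 - Asum k l (iota_map k x) by lia.
apply: (IH (lmv j a) j').
- by move=> i; have := lmvD i aj; case: (eqVneq i j) => [->|ne] h1 h2; [lia|apply: hW; lia].
- have aj' : (0 < a (0 + n0%:Z + 1)%R)%N by rewrite -en.
  have := @wsum_lmv id 0 W a n0 aj' (ltac:(lia)); rewrite -en /=; lia.
- exact: lmv_first_C hf.
- exact: hj'.
- by move=> i hi; rewrite lmv_id ?za //; lia.
- exact: es1.
Qed.

(** If the right move at [i < 0] had just left the negative columns, its result would be a
particle with [l] in column 0, of rigging 0, and the rigging of [y] would be [- 1]. *)
Lemma nonneg_back y s x : Cunder k l y -> nonneg (Mplus k l y) -> strip k l y = (s, x) ->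
    0 <= s - Asum k l (iota_map k x) ->
  nonneg y.
Proof.
move=> hc hz es hs; have [i hi] := Cunder_last l0 hc; have Cy := hc.1.
rewrite (MplusE hi) in hz; have yi := last_entry Cy hi; have Cz := rmv_last_C Cy hi.
apply: contrapT => hn.
have i0 : i < 0.
  rewrite ltNge; apply/negP => h; apply: hn => j hj.
  by have := hz j hj; rewrite rmv_id //; lia.
have sz : sat k l (rmv i y) i by apply/rmv_sat => //; case: hi.
have [ei z0] := negative_sat l0 lk Cz hz sz i0.
have fz : is_first k l (rmv i y) i.
  by split=> // p hp sp; have [ep _] := negative_sat l0 lk Cz hz sp (ltac:(lia)); lia.
have hp : positions k l (rmv i y) [:: i].
  split=> //= u su; have [h1 h2] := sat_erase_ge l0 lk Cz (first_entry Cz fz) su.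
  have suz := erase_sat Cz su; apply: (hi.2 u); first by lia.
  have HS := Sfun_rmv u yi; have HL := Lfun_rmv u yi.
  have [e|ne] : u = i + 2 \/ i + 2 < u by lia.
    by left; have := h2 e; lia.
  by move: suz; rewrite /sat; lia.
have [t [i1 [f est]]] := strip_ex l0 lk hc.
have [i2 [f2 e2 c2 _]] := free_step l0 lk f.
have esz : strip k l (rmv i y) = (s + 1, x).
  rewrite es in est; case: est => e1 e3.
  rewrite -(MplusE hi); rewrite -iterS iterSr in f2 e2 c2.
  by rewrite (stripE l0 lk f2) e2 c2 e3 e1; congr (_, _); lia.
have [_ hx] := @strip_Mminus_all k l l0 lk _ [::] i _ x Cz hp esz.
have [Cx _] := strip_C l0 lk hc es.
have := strip_leftmost l0 lk Cz hz z0 esz (unsat_C l0 Cx hx); lia.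
Qed.

End Pos.

(** Riggings of equal parts decrease, so it is enough to look at the last one, where the
configuration has a single particle of weight [l]. *)
Lemma iota_nonneg k l a : (l <= k)%N -> C k l a -> nonneg a ->
    all (fun rho : int => 0 <= rho) (unzip2 (iota_map k a)).
Proof.
have [n hn] := ex_intro (fun n => (mass a < n)%N) _ (ltnSn (mass a)).
elim: n l a hn => // n IH l' a hn hlk Ca za.
have [->|ha] := pselect (a = config0); first by rewrite iota0.
have [l [hl hc]] := weight_ex Ca ha.
have l0 : (0 < l)%N by lia. have lk : (l <= k)%N by lia.
have hl2 : (0 < l <= k)%N by lia.
have [t [i [f es]]] := strip_ex l0 lk hc.
have hR := iota_R lk hc.1.
set s := _ - _ in es; set x := clear2 _ _ in es.
rewrite (iota_cons hl2 hc es) /= in hR *.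
have [Cx hm] := strip_C l0 lk hc es.
have zx : nonneg x.
  by move=> j hj; rewrite /x clear2E (iter_Mplus_nonneg l0 lk t hc za) // if_same.
have hx : all (fun rho : int => 0 <= rho) (unzip2 (iota_map k x)) by apply: IH Cx zx => //; lia.
rewrite hx andbT.
have [hcx|hnx] := pselect (Cunder k l x).
  have [t1 [i1 [_ es1]]] := strip_ex l0 lk hcx.
  move: hR hx; rewrite (iota_cons hl2 hcx es1) /= => -[/and3P [_ _ /= /andP [h1 _]] _] /andP [h2 _].
  by rewrite eqxx /= in h1; apply: le_trans h1.
have hu (u : int) : ~ sat k l x u by move=> su; apply: hnx; apply/(CunderE _ _ l0); split=> //;
  exists u.
have [js hjs] := positions_ex l0 lk hc.1.
case/lastP: js hjs => [h|js j hjs].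
  by move/(CunderE _ _ l0): hc => [_ [u /h]].
have [_ hp] := strip_Mminus_all l0 lk hc.1 hjs es.
case: js hjs hp => [|p js] hjs; last by case=> -[/hu].
by move=> _; apply: single_strip_ge0 hc.1 hjs za es.
Qed.

(** Far to the right, the free particle and, by induction, the rest are in nonnegative
columns; going back with [nonneg_back], the configuration stays there as long as
the rigging is nonnegative. *)
Lemma nonneg_iota k l a : (l <= k)%N -> C k l a -> all (fun rho : int => 0 <= rho) (unzip2 (iota_map
    k a)) -> nonneg a.
Proof.
have [n hn] := ex_intro (fun n => (mass a < n)%N) _ (ltnSn (mass a)).
elim: n l a hn => // n IH l' a hn hlk Ca hpos.
have [->|ha] := pselect (a = config0); first by move=> j _; rewrite config0E.
have [l [hl hc]] := weight_ex Ca ha.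
have l0 : (0 < l)%N by lia. have lk : (l <= k)%N by lia.
have hl2 : (0 < l <= k)%N by lia.
have [t [i [f es]]] := strip_ex l0 lk hc.
move: hpos; rewrite (iota_cons hl2 hc es) /=.
set s := _ - _ in es *; set x := clear2 _ _ in es * => /andP [h1 h2].
have [Cx hm] := strip_C l0 lk hc es.
have zx : nonneg x by apply: IH Cx h2 => //; lia.
(* [|i| + 2] columns further right are reached after [(|i| + 2) * l] moves. *)
have [m [i' [f' c' hi']]] : exists m i', [/\ has_free k l (iter m (Mplus k l) a) i',
  clear2 i' (iter m (Mplus k l) a) = x & 0 <= i'].
  have [i' [f' e' c' _]] := free_iter l0 lk (`|i| * l + 2 * l)%N f; rewrite -iterD in f' e' c'.
  exists ((`|i| * l + 2 * l) + t)%N, i'; split=> //.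
  have [_ g1 g2 _] := (has_freeP l0 lk _ _).1 f; have [_ g3 g4 _] := (has_freeP l0 lk _ _).1 f'.
  rewrite !(energyE l0 lk) in e'; [|by move: g1 g3; rewrite /Sfun; lia..].
  rewrite leNgt; apply/negP => h.
  move: g1 g3 e'; rewrite /Sfun; nia.
have zm : nonneg (iter m (Mplus k l) a).
  move=> j hj; have := zx j hj; rewrite -c' clear2E; case: ifP => // h _; lia.
have key r : (r <= m)%N -> nonneg (iter (m - r) (Mplus k l) a).
  elim: r => [|r IHr] hr; first by rewrite subn0.
  have e : (m - r = (m - r.+1).+1)%N by lia.
  have := IHr (ltnW hr); rewrite e /= => hz.
  have hcr := iter_Mplus_Cunder (m - r.+1) l0 hc.
  have er : strip k l (iter (m - r.+1) (Mplus k l) a) = (s + (m - r.+1)%N%:Z, x).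
    have [j [fj ej cj _]] := free_iter l0 lk (m - r.+1)%N f; rewrite -iterD in fj ej cj.
    rewrite addnC iterD in fj ej cj.
    by rewrite (stripE l0 lk fj) ej cj /s; congr (_, _); lia.
  by apply: (nonneg_back l0 lk hcr hz er); lia.
by have := key m (leqnn _); rewrite subnn.
Qed.

Theorem theorem3p28 (k l : nat) (hlk : (l <= k)%N) :
  [/\ set_bij (Cpos k l) (Rpos l) (iota_map k),
      set_bij (Rpos l) (Cpos k l) (kappa_map k l),
      (forall a, Cpos k l a -> kappa_map k l (iota_map k a) = a) &
      (forall r, Rpos l r -> iota_map k (kappa_map k l r) = r)].
Proof.
have i1 a : Cpos k l a -> Rpos l (iota_map k a).
  by move=> [Ca za]; split; [apply: iota_R Ca|apply: iota_nonneg Ca za].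
have k2 r : Rpos l r -> iota_map k (kappa_map k l r) = r.
  by move=> [hr _]; case: (kappa_spec hlk hr).
have k1 r : Rpos l r -> Cpos k l (kappa_map k l r).
  move=> [hr hp]; have [Ca e] := kappa_spec hlk hr; split=> //.
  by apply: (nonneg_iota hlk Ca); rewrite e.
have inj a a' : C k l a -> C k l a' -> iota_map k a = iota_map k a' -> a = a'.
  by move=> h h'; apply: iota_inj; [apply: C_mono_l h|apply: C_mono_l h'].
have i2 a : Cpos k l a -> kappa_map k l (iota_map k a) = a.
  move=> ha; have hr := i1 a ha; apply: inj; [by case: (k1 _ hr)|by case: ha|exact: k2].
split=> //; split.
- by move=> a /i1.
- by move=> a a' /set_mem [h _] /set_mem [h' _]; apply: inj.
- by move=> r hr; exists (kappa_map k l r); [apply: k1|apply: k2].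
- by move=> r /k1.
- by move=> r r' /set_mem h /set_mem h' e; rewrite -(k2 r h) e k2.
- by move=> a ha; exists (iota_map k a); [apply: i1|apply: i2].
Qed.
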